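(* Let $(Z,G,\tau)$ be a Lipschitz continuous dynamical system such that $G$ is unimodular and strictly polynomially growing. For $N\in\mathbb N$, let $k:G\times Z\to\mathbb C^{N\times N}$ be a linearly decaying and bounded kernel. Assume that $A_x$ is a normal operator for each $x\in Z$, where $(A_x)_{x\in Z}$ is the dynamically-defined operator family associated with $k$. Then the following hold. (a) If $k$ is Lipschitz continuous, then the spectral map $\Sigma_k:\mathscr S\to\mathcal K(\mathbb C)$, $Y\mapsto\sigma(A_Y)$, is root-Hölder continuous. More precisely, there exists a constant $C=C(G,k)>0$ such that $$d_H\big(\sigma(A_X),\sigma(A_Y)\big)\le C\,\delta_H(X,Y)^{1/2}\qquad\text{for all }X,Y\in\mathscr S.$$ (b) If $k$ is locally constant, then the spectral map $\Sigma_k$ is Lipschitz continuous. That is, there exists a constant $C=C(G,k)>0$ such that $$d_H\big(\sigma(A_X),\sigma(A_Y)\big)\le C\,\delta_H(X,Y)\qquad\text{for all }X,Y\in\mathscr S.$$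
   Context: $G$ is a locally compact, second countable, Hausdorff group with identity $e$, equipped with a fixed adapted metric $d_G$, i.e. a metric that is continuous, left-invariant, proper (closed balls are compact) and locally bounded (every point has a neighborhood of finite diameter). $B(r)=\{g\in G: d_G(e,g)<r\}$. $m_G$ is the left Haar measure and $dh$ denotes integration with respect to it; $G$ is unimodular if $m_G$ is left- and right-invariant. $G$ is strictly polynomially growing if there are constants $0<c_0\le c_1$ and $\kappa>0$ with $c_0r^\kappa\le m_G(B(r))\le c_1r^\kappa$ for all $r\ge1$. A (topological) dynamical system $(Z,G,\tau)$ consists of a compact metric space $(Z,d)$ and a continuous left action $\tau$ of $G$ on $Z$, written $gx=\tau(g,x)$. It is Lipschitz continuous if there is $C_\tau>0$ with $d(gx,gy)\le(C_\tau d_G(e,g)+1)\,d(x,y)$ for all $x,y\in Z$, $g\in G$. $\mathscr S$ is the set of all non-empty, closed, $G$-invariant subsets of $Z$, equipped with the Hausdorff metric $\delta_H$ induced by $d$. $\mathcal K(\mathbb C)$ is the set of compact subsets of $\mathbb C$ with the Hausdorff metric $d_H$ induced by the Euclidean metric. On $\mathbb C^{N\times N}$ use the norm $\|A\|_M=\max_{m,n}|a_{m,n}|$. A (bounded) kernel is a measurable function $k:G\times Z\to\mathbb C^{N\times N}$ such that $k(g,\cdot)$ is continuous for each $g\in G$ and $\sup_{x\in Z}\int_G\sup_{g\in G}\|k(h,g^{-1}x)\|_M\,dh<\infty$. The associated dynamically-defined operator family $(A_x)_{x\in Z}$ consists of the bounded operators on $L^2(G,m_G)\otimes\mathbb C^N$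 given by $$(A_x\psi)_n(g)=\int_G\big(k(g^{-1}h,g^{-1}x)\psi(h)\big)_n\,dh,\qquad 1\le n\le N.$$ For $Y\in\mathscr S$, $\sigma(A_Y):=\overline{\bigcup_{y\in Y}\sigma(A_y)}$. The kernel $k$ is: - linearly decaying if there is $c_s>0$ with $\sup_{x\in Z}\int_G\sup_{g\in G}\|k(h,g^{-1}x)\|_M\,d_G(e,h)\,dh\le c_s$; - Lipschitz continuous if there is a non-negative $c_k\in L^1(G)$ such that for $m_G$-a.e. $h\in G$, $\|k(h,x)-k(h,y)\|_M\le c_k(h)\,d(x,y)$ for all $x,y\in Z$; - locally constant if there is a non-negative $c_k\in L^\infty(G)$ such that for $m_G$-a.e. $h\in G$, $d(x,y)<\frac1{c_k(h)}$ implies $k(h,x)=k(h,y)$ (with $1/0=\infty$). *)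

(* Defs.v *)
From HB Require Import structures.
From mathcomp Require Import all_boot all_order all_algebra.
From mathcomp Require Import all_classical all_reals all_analysis.
From mathcomp Require Import measurable_realfun complex ring lra.

Set Implicit Arguments.
Unset Strict Implicit.
Unset Printing Implicit Defensive.

Import Order.TTheory GRing.Theory Num.Theory.
Import numFieldNormedType.Exports.

Local Open Scope classical_set_scope.
Local Open Scope ring_scope.

HB.instance Definition _ (R : realType) :=
  PseudoPointedMetric.copy R[i] R[i]^o.

(* The points required by the next two structures carry no information: they
   are there because the measurable types of the library are pointed. *)
HB.mixin Record isTopologicalGroup G & Group G & PointedTopological G := {
  mulg_continuous : continuous (fun p : G * G => (p.1 * p.2)%g) ;
  invg_continuous : continuous (fun g : G => (g^-1)%g) }.

#[short(type="topologicalGroupType")]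
HB.structure Definition TopologicalGroup :=
  { G of Group G & PointedTopological G & isTopologicalGroup G }.

#[short(type="pmetricType")]
HB.structure Definition PointedMetric (K : numDomainType) :=
  { M of Metric K M & Pointed M }.

Notation borel T := (g_sigma_algebraType (@open T)).
Notation cmod := ComplexField.Normc.normc.

Section Complex.
Context d (T : measurableType d) (R : realType).

Definition complex_measurable (f : T -> R[i]) : Prop :=
  measurable_fun setT (fun x => complex.Re (f x)) /\
  measurable_fun setT (fun x => complex.Im (f x)).

Definition complex_integral (mu : {measure set T -> \bar R}) (f : T -> R[i]) :
    R[i] :=
  Complex (\int[mu]_x complex.Re (f x)) (\int[mu]_x complex.Im (f x)).

Definition cdist (z w : R[i]) : R := cmod (z - w).

Definition mxmax_norm N (A : 'M[R[i]]_N) : R :=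
  \big[Num.max/0]_i \big[Num.max/0]_j cmod (A i j).

End Complex.

(* The distance is [\bar R]-valued so that it makes sense for arbitrary sets;
   on non-empty bounded sets it is finite and the usual one. *)
Definition hausdorff_dist (R : realType) (T : Type) (dist : T -> T -> R)
    (A B : set T) : \bar R :=
  maxe (ereal_sup [set ereal_inf [set (dist a b)%:E | b in B] | a in A])
       (ereal_sup [set ereal_inf [set (dist a b)%:E | a in A] | b in B]).

Section SquareIntegrable.
Context d (T : measurableType d) (R : realType).
Variables (mu : {measure set T -> \bar R}) (N : nat).
Local Notation C := R[i].
Local Notation V := 'cV[C]_N.

Definition sqnorm (v : V) : R := \sum_i cmod (v i 0) ^+ 2.

Definition square_integrable (f : T -> V) : Prop :=
  (forall i, complex_measurable (fun x => f x i 0)) /\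
  (\int[mu]_x (sqnorm (f x))%:E < +oo)%E.

Lemma cmod2E (z : C) : cmod z ^+ 2 = complex.Re z ^+ 2 + complex.Im z ^+ 2.
Proof. by case: z => a b /=; rewrite sqr_sqrtr// addr_ge0// sqr_ge0. Qed.

Lemma sqnorm_ge0 v : 0 <= sqnorm v.
Proof. by apply: sumr_ge0 => i _; exact: sqr_ge0. Qed.

Lemma sqnormZ a v : sqnorm (a *: v) = cmod a ^+ 2 * sqnorm v.
Proof.
rewrite /sqnorm mulr_sumr; apply: eq_bigr => i _.
by rewrite mxE ComplexField.Normc.normcM exprMn.
Qed.

Lemma sqnormD u v : sqnorm (u + v) <= 2 * sqnorm u + 2 * sqnorm v.
Proof.
rewrite /sqnorm !mulr_sumr -big_split/=; apply: ler_sum => i _.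
rewrite mxE !cmod2E; case: (u i 0) => a b; case: (v i 0) => c e /=.
have := sqr_ge0 (a - c); have := sqr_ge0 (b - e); nra.
Qed.

Lemma measurable_sqnorm (f : T -> V) :
  (forall i, complex_measurable (fun x => f x i 0)) ->
  measurable_fun setT (fun x => (sqnorm (f x))%:E).
Proof.
move=> mf; apply/measurable_EFinP; apply: measurable_sum => i.
under eq_fun do rewrite cmod2E.
have [mR mI] := mf i.
by apply: measurable_funD; exact: measurable_funX.
Qed.

Lemma square_integrable0 : square_integrable (fun=> 0).
Proof.
split=> [i|].
  by split; under eq_fun do rewrite mxE; exact: measurable_cst.
rewrite integral0_eq// => x _; congr EFin.
by rewrite /sqnorm big1// => i _; rewrite mxE ComplexField.Normc.normc0 expr0n.
Qed.

Lemma complex_ReD (z w : C) : complex.Re (z + w) = complex.Re z + complex.Re w.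
Proof. by case: z w => [a b] [c e]. Qed.

Lemma complex_ImD (z w : C) : complex.Im (z + w) = complex.Im z + complex.Im w.
Proof. by case: z w => [a b] [c e]. Qed.

Lemma complex_ReM (z w : C) : complex.Re (z * w) =
  complex.Re z * complex.Re w - complex.Im z * complex.Im w.
Proof. by case: z w => [a b] [c e]. Qed.

Lemma complex_ImM (z w : C) : complex.Im (z * w) =
  complex.Re z * complex.Im w + complex.Im z * complex.Re w.
Proof. by case: z w => [a b] [c e]. Qed.

Lemma square_integrableD f g : square_integrable f -> square_integrable g ->
  square_integrable (fun x => f x + g x).
Proof.
move=> [mf If] [mg Ig].
have mfg i : complex_measurable (fun x => (f x + g x) i 0).
  have [? ?] := mf i; have [? ?] := mg i.
  split; under eq_fun do rewrite mxE ?complex_ReD ?complex_ImD;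
    exact: measurable_funD.
split=> //.
have m2 (h : T -> V) : (forall i, complex_measurable (fun x => h x i 0)) ->
    measurable_fun setT (fun x => (2%:E * (sqnorm (h x))%:E)%E).
  by move=> mh; apply: measurable_funeM; exact: measurable_sqnorm.
apply: (@le_lt_trans _ _
  (\int[mu]_x (2%:E * (sqnorm (f x))%:E + 2%:E * (sqnorm (g x))%:E))%E).
  apply: ge0_le_integral => //.
  - by move=> x _; rewrite lee_fin sqnorm_ge0.
  - exact: measurable_sqnorm.
  - by apply: emeasurable_funD; exact: m2.
  - by move=> x _; rewrite -!EFinM -EFinD lee_fin sqnormD.
rewrite ge0_integralD//; [|by move=> x _; rewrite -EFinM lee_fin mulr_ge0//
  sqnorm_ge0|exact: m2|by move=> x _; rewrite -EFinM lee_fin mulr_ge0//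
  sqnorm_ge0|exact: m2].
rewrite !ge0_integralZl_EFin//;
  try (by move=> x _; rewrite lee_fin sqnorm_ge0); try exact: measurable_sqnorm.
by rewrite lte_add_pinfty// lte_mul_pinfty.
Qed.

Lemma square_integrableZ a f : square_integrable f ->
  square_integrable (fun x => a *: f x).
Proof.
move=> [mf If]; split=> [i|].
  have [? ?] := mf i.
  split; under eq_fun do rewrite mxE ?complex_ReM ?complex_ImM.
    by apply: measurable_funB; exact: measurable_funM.
  by apply: measurable_funD; exact: measurable_funM.
under eq_integral do rewrite sqnormZ EFinM.
rewrite ge0_integralZl_EFin//; first by rewrite lte_mul_pinfty// lee_fin sqr_ge0.
- by move=> x _; rewrite lee_fin sqnorm_ge0.
- exact: measurable_sqnorm.
- exact: sqr_ge0.
Qed.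

(* L^2(mu) (x) C^N is realised as the space L^2(mu; C^N) of square integrable
   C^N-valued functions modulo equality almost everywhere. *)
Record sqint := SqInt {
  sqint_val :> T -> V ;
  sqint_prop : square_integrable sqint_val }.

HB.instance Definition _ := gen_eqMixin sqint.
HB.instance Definition _ := gen_choiceMixin sqint.

Definition sqint_ae_eq (f g : sqint) : bool :=
  `[< (f : T -> V) = g %[ae mu] >].

Lemma sqint_ae_eq_refl : reflexive sqint_ae_eq.
Proof. by move=> f; apply/asboolP; exact: ae_eq_refl. Qed.

Lemma sqint_ae_eq_sym : symmetric sqint_ae_eq.
Proof. by move=> f g; apply/asboolP/asboolP => /ae_eq_sym. Qed.

Lemma sqint_ae_eq_trans : transitive sqint_ae_eq.
Proof.
by move=> g f h /asboolP fg /asboolP gh; apply/asboolP; exact: ae_eq_trans gh.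
Qed.

Canonical sqint_equiv :=
  EquivRel sqint_ae_eq sqint_ae_eq_refl sqint_ae_eq_sym sqint_ae_eq_trans.

Local Open Scope quotient_scope.

Definition L2 : Type := {eq_quot sqint_ae_eq}.
HB.instance Definition _ := Choice.on L2.
HB.instance Definition _ := EqQuotient.on L2.

Definition L2_fun (u : L2) : T -> V := repr u.
Coercion L2_fun : L2 >-> Funclass.

Definition L2_class (f : T -> V) (sf : square_integrable f) : L2 :=
  \pi_L2 (SqInt sf).

Lemma L2_class_eq f g (sf : square_integrable f) (sg : square_integrable g) :
  (f = g %[ae mu]) -> L2_class sf = L2_class sg.
Proof. by move=> fg; apply/eqmodP/asboolP. Qed.

Lemma L2_classE f (sf : square_integrable f) :
  (L2_class sf : T -> V) = f %[ae mu].
Proof. by have /eqmodP/asboolP := reprK (L2_class sf). Qed.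

Lemma L2_classK (u : L2) (su : square_integrable u) : L2_class su = u.
Proof.
rewrite -[RHS](reprK u) /L2_class; congr (\pi_L2 _).
rewrite /L2_fun in su *; case: (repr u) su => f p su.
by congr SqInt; exact: Prop_irrelevance.
Qed.

Lemma L2_fun_square_integrable (u : L2) : square_integrable u.
Proof. exact: sqint_prop. Qed.

Lemma L2_eqP (u v : L2) : ((u : T -> V) = v %[ae mu]) -> u = v.
Proof.
move=> uv; rewrite -(L2_classK (L2_fun_square_integrable u)).
rewrite -[RHS](L2_classK (L2_fun_square_integrable v)).
exact: L2_class_eq.
Qed.

Definition L2_zero : L2 := L2_class square_integrable0.
Definition L2_add (u v : L2) : L2 := L2_class
  (square_integrableD (L2_fun_square_integrable u) (L2_fun_square_integrable v)).
Definition L2_scale (a : C) (u : L2) : L2 :=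
  L2_class (square_integrableZ a (L2_fun_square_integrable u)).
Definition L2_opp (u : L2) : L2 := L2_scale (-1) u.

Lemma L2_addE u v : (L2_add u v : T -> V) = (fun x => u x + v x) %[ae mu].
Proof. exact: L2_classE. Qed.

Lemma L2_scaleE a u : (L2_scale a u : T -> V) = (fun x => a *: u x) %[ae mu].
Proof. exact: L2_classE. Qed.

Lemma L2_zeroE : (L2_zero : T -> V) = (fun=> 0) %[ae mu].
Proof. exact: L2_classE. Qed.

Lemma ae_and (P Q : T -> Prop) : (\forall x \ae mu, P x) ->
  (\forall x \ae mu, Q x) -> \forall x \ae mu, P x /\ Q x.
Proof. by apply: filterS2 => x. Qed.

Lemma L2_addA : associative L2_add.
Proof.
move=> u v w; apply: L2_eqP.
move: (L2_addE u (L2_add v w)) (L2_addE v w).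
have := ae_and (L2_addE (L2_add u v) w) (L2_addE u v).
move=> H1 H2 H3; apply: (filterS3 _ _ H1 H2 H3) => x /= [c e] a b _.
by rewrite (a I) (b I) (c I) (e I) addrA.
Qed.

Lemma L2_addC : commutative L2_add.
Proof.
move=> u v; apply: L2_eqP; move: (L2_addE u v) (L2_addE v u).
by apply: filterS2 => x /= a b _; rewrite (a I) (b I) addrC.
Qed.

Lemma L2_add0 : left_id L2_zero L2_add.
Proof.
move=> u; apply: L2_eqP; move: (L2_addE L2_zero u) L2_zeroE.
by apply: filterS2 => x /= a b _; rewrite (a I) (b I) add0r.
Qed.

Lemma L2_addN : left_inverse L2_zero L2_opp L2_add.
Proof.
move=> u; apply: L2_eqP.
move: (L2_addE (L2_opp u) u) (L2_scaleE (-1) u) L2_zeroE.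
move=> H1 H2 H3; apply: (filterS3 _ _ H1 H2 H3) => x /= a b c _.
by rewrite (a I) (b I) (c I) scaleN1r addNr.
Qed.

HB.instance Definition _ :=
  GRing.isZmodule.Build L2 L2_addA L2_addC L2_add0 L2_addN.

Lemma L2_scaleA a b u : L2_scale a (L2_scale b u) = L2_scale (a * b) u.
Proof.
apply: L2_eqP.
move: (L2_scaleE a (L2_scale b u)) (L2_scaleE b u) (L2_scaleE (a * b) u).
move=> H1 H2 H3; apply: (filterS3 _ _ H1 H2 H3) => x /= p q r _.
by rewrite (p I) (q I) (r I) scalerA.
Qed.

Lemma L2_scale1 : left_id 1 L2_scale.
Proof.
move=> u; apply: L2_eqP; move: (L2_scaleE 1 u).
by apply: filterS => x /= p _; rewrite (p I) scale1r.
Qed.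

Lemma L2_scaleDr : right_distributive L2_scale L2_add.
Proof.
move=> a u v; apply: L2_eqP.
move: (L2_scaleE a (L2_add u v)) (L2_addE u v).
have := ae_and (L2_addE (L2_scale a u) (L2_scale a v))
  (ae_and (L2_scaleE a u) (L2_scaleE a v)).
move=> H1 H2 H3; apply: (filterS3 _ _ H1 H2 H3) => x /= [p [q r]] s t _.
by rewrite (p I) (q I) (r I) (s I) (t I) scalerDr.
Qed.

Lemma L2_scaleDl u : {morph L2_scale^~ u : a b / a + b >-> L2_add a b}.
Proof.
move=> a b; apply: L2_eqP; move: (L2_scaleE (a + b) u).
move: (L2_addE (L2_scale a u) (L2_scale b u)).
have := ae_and (L2_scaleE a u) (L2_scaleE b u).
move=> H1 H2 H3; apply: (filterS3 _ _ H1 H2 H3) => x /= [p q] r s _.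
by rewrite (s I) (r I) (p I) (q I) scalerDl.
Qed.

HB.instance Definition _ := GRing.Zmodule_isLmodule.Build C L2
  L2_scaleA L2_scale1 L2_scaleDr L2_scaleDl.

End SquareIntegrable.

Section Operators.
Context d (T : measurableType d) (R : realType).
Variables (mu : {measure set T -> \bar R}) (N : nat).
Local Notation C := R[i].
Local Notation H := (L2 mu N).
Implicit Types A S : H -> H.

Definition L2_dot (u v : H) : C :=
  \sum_i complex_integral mu (fun x => u x i 0 * ((v x i 0)^*)%C).

Definition L2_norm (u : H) : R := Num.sqrt (\int[mu]_x sqnorm (u x)).

Definition bounded_operator A : Prop :=
  linear A /\ exists M : R, forall u, L2_norm (A u) <= M * L2_norm u.

Definition is_adjoint A S : Prop := forall u v, L2_dot (A u) v = L2_dot u (S v).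

Definition normal_operator A : Prop :=
  bounded_operator A /\
  exists S, [/\ bounded_operator S, is_adjoint A S & A \o S =1 S \o A].

Definition resolvent_set A : set C :=
  [set z | exists S, [/\ bounded_operator S,
     forall u, S (A u - z *: u) = u & forall u, A (S u) - z *: S u = u]].

Definition spectrum A : set C := ~` resolvent_set A.

(* The class of f, or the junk value 0 when f is not square integrable. The
   functions defining [dyn_operator] below are square integrable whenever the
   kernel is bounded and the group is unimodular (Schur test). *)
Definition to_L2 (f : T -> 'cV[C]_N) : H :=
  if pselect (square_integrable mu f) is left sf then L2_class sf else 0.

End Operators.

Section Group.
Context (R : realType) (G : topologicalGroupType).

Definition is_metric (dG : G -> G -> R) : Prop :=
  [/\ forall g h, 0 <= dG g h, forall g h, dG g h = 0 <-> g = h,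
      forall g h, dG g h = dG h g & forall g h k, dG g k <= dG g h + dG h k].

Definition adapted_metric (dG : G -> G -> R) : Prop :=
  is_metric dG /\
  [/\ continuous (fun p : G * G => dG p.1 p.2),
      forall a g h : G, dG (a * g)%g (a * h)%g = dG g h,
      forall (g : G) (r : R), compact [set h | dG g h <= r] &
      forall g : G, exists2 U, nbhs g U &
        exists M : R, forall h k, U h -> U k -> dG h k <= M].

Definition gball (dG : G -> G -> R) (r : R) : set G := [set g | dG 1%g g < r].

(* A non-zero left-invariant Radon measure. *)
Definition left_haar (m : {measure set (borel G) -> \bar R}) : Prop :=
  [/\ forall (a : G) (E : set (borel G)), measurable E ->
        m [set (a * g)%g | g in E] = m E,
      m setT != 0%E &
      [/\ forall K : set G, compact K -> (m K < +oo)%E,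
          forall E : set (borel G), measurable E -> m E =
            ereal_inf [set m U | U in [set U : set G | open U /\ E `<=` U]] &
          forall U : set G, open U -> m U =
            ereal_sup [set m K | K in [set K : set G | compact K /\ K `<=` U]]]].

Definition unimodular (m : {measure set (borel G) -> \bar R}) : Prop :=
  forall (a : G) (E : set (borel G)), measurable E ->
    m [set (a * g)%g | g in E] = m E /\ m [set (g * a)%g | g in E] = m E.

Definition strictly_polynomial_growth (dG : G -> G -> R)
    (m : {measure set (borel G) -> \bar R}) : Prop :=
  exists c0 c1 kappa : R, [/\ 0 < c0, c0 <= c1, 0 < kappa &
    forall r : R, 1 <= r ->
      ((c0 * r `^ kappa)%:E <= m (gball dG r) <= (c1 * r `^ kappa)%:E)%E].

End Group.

Section DynamicalSystem.
Context (R : realType) (G : topologicalGroupType) (Z : pmetricType R).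
Variable tau : G -> Z -> Z.

Definition dynamical_system : Prop :=
  compact [set: Z] /\
  [/\ continuous (fun p : G * Z => tau p.1 p.2),
      forall x, tau 1%g x = x &
      forall (g h : G) x, tau (g * h)%g x = tau g (tau h x)].

Definition lipschitz_system (dG : G -> G -> R) : Prop :=
  exists2 Ctau : R, 0 < Ctau & forall x y g,
    mdist (tau g x) (tau g y) <= (Ctau * dG 1%g g + 1) * mdist x y.

Definition invariant_set (Y : set Z) : Prop :=
  [/\ Y !=set0, closed Y & forall g y, Y y -> Y (tau g y)].

Section Kernel.
Variables (dG : G -> G -> R) (m : {measure set (borel G) -> \bar R}).
Variables (N : nat) (k : G -> Z -> 'M[R[i]]_N).

(* sup_g ||k(h, g^-1 x)||_M *)
Definition orbit_sup (h : G) (x : Z) : \bar R :=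
  ereal_sup [set (mxmax_norm (k h (tau g^-1%g x)))%:E | g in [set: G]].

Definition bounded_kernel : Prop :=
  [/\ forall i j, complex_measurable
        (fun p : borel G * borel Z => k p.1 p.2 i j),
      forall g, continuous (k g) &
      (ereal_sup [set \int[m]_h orbit_sup h x | x in [set: Z]] < +oo)%E].

Definition linearly_decaying : Prop :=
  exists2 cs : R, 0 < cs &
  (ereal_sup [set \int[m]_h (orbit_sup h x * (dG 1%g h)%:E) | x in [set: Z]]
    <= cs%:E)%E.

Definition lipschitz_kernel : Prop :=
  exists ck : borel G -> R, [/\ forall h, 0 <= ck h, ck \in Lfun m 1 &
    \forall h \ae m, forall x y,
      mxmax_norm (k h x - k h y) <= ck h * mdist x y].

(* The first disjunct is the case c_k(h) = 0, where 1 / c_k(h) = +oo. *)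
Definition locally_constant_kernel : Prop :=
  exists ck : borel G -> R, [/\ forall h, 0 <= ck h, ck \in Lfun m +oo &
    \forall h \ae m, forall x y,
      ck h = 0 \/ mdist x y < (ck h)^-1 -> k h x = k h y].

Definition dyn_operator (x : Z) (psi : L2 m N) : L2 m N :=
  to_L2 m (fun g : borel G => \col_n complex_integral m (fun h : borel G =>
    (k (g^-1 * h)%g (tau g^-1%g x) *m psi h) n 0)).

Definition family_spectrum (Y : set Z) : set R[i] :=
  closure (\bigcup_(y in Y) spectrum (dyn_operator y)).

End Kernel.
End DynamicalSystem.

(* Main.v *)
Require Import Defs.
From HB Require Import structures.
From mathcomp Require Import all_boot all_order all_algebra.
From mathcomp Require Import all_classical all_reals all_analysis.
From mathcomp Require Import measurable_realfun ess_sup_inf complex ring lra.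

Set Implicit Arguments.
Unset Strict Implicit.
Unset Printing Implicit Defensive.

Import Order.TTheory GRing.Theory Num.Theory.
Import numFieldNormedType.Exports.

Local Open Scope classical_set_scope.
Local Open Scope ring_scope.

(** The spectrum of a normal operator [A] consists of approximate eigenvalues
    ([spectrum_approx]), and a non-zero vector [phi] with
    [|(A - z) phi| <= B |phi|] forces a spectral value within [4 B] of [z]
    ([near_spectrum]). So a spectral value [z] of [A_x] is carried over to [A_y]
    by testing [A_y] against a suitable almost eigenvector: take [psi] with
    [A_x psi] close to [z psi], and cut it off to [phi = chi psi], where [chi] is
    a plateau of radius of order [r] around a point [g] to be chosen. Then
    [(A_y - z) phi] is the sum of three errors.
    - [chi (A_x - z) psi], which is small since [(A_x - z) psi] is.
    - The commutator [(A_x chi - chi A_x) psi]. As [chi] has Lipschitz constant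
      [1 / (2 r)], the linear decay of the kernel makes it of order [1 / r]
      ([commutator_bound]).
    - [(A_y - A_x) phi]. As [phi] lives in the ball of radius [2 r] around [g],
      linear decay gains a factor [1 / r] at the points beyond distance [4 r]
      from [g]. Up to that distance, if [g^-1 y] is close to [g^-1 x], the
      Lipschitz action keeps the two orbits close and the modulus of continuity
      of the kernel applies ([difference_bound]).

    The first two errors have to be compared with the mass of [phi], which is
    about the mass of [psi] near [g], and not with the total mass of [psi]. An
    average over [g] provides a point where this works
    ([exists_local_mass_lt]): averaging turns masses near [g] into total masses
    multiplied by volumes of balls, and polynomial growth bounds the ratio of the
    volumes for the radii [2 r] and [r]. As the point [g] is found from [x] and
    [psi] alone, and as [Y] is invariant, [y] in [Y] may be chosen after [g] so
    that [g^-1 y] is as close to [g^-1 x] as the Hausdorff distance allows.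

    The outcome ([spectrum_transfer], [spectral_map_modulus]) is that the spectra
    are within [C (A0 + 1 / r)] of each other, where [A0] bounds the integral over
    the group of the oscillation of the kernel at scale [(4 C_tau r + 1) d], for
    sets [X] and [Y] at Hausdorff distance less than [d]. For a Lipschitz kernel
    [A0] is of order [r d], and [r = d^(-1/2)] gives the root Hoelder bound. For a
    locally constant kernel [A0 = 0] as long as [r d] stays below a constant, and
    [r] of order [1 / d] gives the Lipschitz bound.

    The two facts on normal operators are obtained without functional calculus.
    Let [c] be the infimum of [|(A - z) u|] over unit vectors. If [c > 0], one of
    the four points at distance [c / 2] from [z] along the axes has an infimum
    below [4/5 c] ([lower_bound_decreases]); minimising this infimum plus a small
    multiple of the distance to [z] therefore ends at a point where it vanishes
    ([approx_eigenvalue_near]). Conversely a normal operator that is bounded below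
    is inverted by an iteration ([normal_bounded_below_invertible]), which needs
    from the completeness of the Hilbert space only that geometric series
    converge. *)

(** * Normal operators on complex inner product spaces *)

Section InnerProduct.
Context (R : realType) (H : lmodType R[i]).
Implicit Types (dot : H -> H -> R) (u v w : H) (T S : H -> H).

(** The real part of a complex inner product determines norm and adjoint, and
    makes all the estimates below real. The third clause is what is left of
    sesquilinearity: the adjoint of a complex scalar is its conjugate. *)
Definition real_inner_product dot : Prop :=
  [/\ forall u v w, dot (u + v) w = dot u w + dot v w,
      forall u v, dot u v = dot v u,
      forall (a : R[i]) u v, dot (a *: u) v = dot u ((a^*)%C *: v),
      forall (r : R) u v, dot ((r%:C)%C *: u) v = r * dot u v &
      forall u, 0 <= dot u u].

Variable dot : H -> H -> R.
Hypothesis dotP : real_inner_product dot.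

Let dotDl u v w : dot (u + v) w = dot u w + dot v w. Proof. by case: dotP. Qed.
Let dotC u v : dot u v = dot v u. Proof. by case: dotP. Qed.
Let dotZ a u v : dot (a *: u) v = dot u ((a^*)%C *: v).
Proof. by case: dotP. Qed.
Let dotRl (r : R) u v : dot ((r%:C)%C *: u) v = r * dot u v.
Proof. by case: dotP. Qed.
Let dot_ge0 u : 0 <= dot u u. Proof. by case: dotP. Qed.

Definition dnorm u : R := Num.sqrt (dot u u).

Lemma dotDr u v w : dot u (v + w) = dot u v + dot u w.
Proof. by rewrite dotC dotDl dotC (dotC w). Qed.

Lemma dotNl u v : dot (- u) v = - dot u v.
Proof.
have -> : - u = ((-1)%:C)%C *: u by rewrite rmorphN1 scaleN1r.
by rewrite dotRl mulN1r.
Qed.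

Lemma dotNr u v : dot u (- v) = - dot u v.
Proof. by rewrite dotC dotNl dotC. Qed.

Lemma dotRr (r : R) u v : dot u ((r%:C)%C *: v) = r * dot u v.
Proof. by rewrite dotC dotRl dotC. Qed.

Lemma dot0l v : dot 0 v = 0.
Proof. by have := dotDl 0 0 v; rewrite addr0 -[LHS]addr0 => /addrI. Qed.

Lemma dotBB u v : dot (u - v) (u - v) = dot u u - 2 * dot u v + dot v v.
Proof. by rewrite dotDl !dotDr !dotNl !dotNr (dotC v u); ring. Qed.

Lemma dotDD u v : dot (u + v) (u + v) = dot u u + 2 * dot u v + dot v v.
Proof. by rewrite dotDl !dotDr (dotC v u); ring. Qed.

Lemma dnorm_ge0 u : 0 <= dnorm u. Proof. exact: sqrtr_ge0. Qed.

Lemma sqr_dnorm u : dnorm u ^+ 2 = dot u u.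
Proof. by rewrite sqr_sqrtr. Qed.

Lemma le_dnorm u (r : R) : 0 <= r -> dot u u <= r ^+ 2 -> dnorm u <= r.
Proof.
by move=> r0 h; rewrite -(ler_pXn2r (n := 2))// ?nnegrE ?dnorm_ge0// sqr_dnorm.
Qed.

Lemma dot_le_dnorm u v : dot u v <= dnorm u * dnorm v.
Proof.
have [u0|u0] := ltP 0 (dot u u); last first.
  have /eqP u00 : dot u u == 0 by rewrite eq_le u0 dot_ge0.
  have h t : 2 * t * dot u v <= dot v v.
    have := dot_ge0 ((t%:C)%C *: u - v).
    rewrite dotBB dotRl dotRr u00 dotRl; lra.
  have -> : dot u v = 0.
    apply/eqP; apply/negP => /negP nz.
    have := h ((dot v v + 1) / (2 * dot u v)).
    have -> : 2 * ((dot v v + 1) / (2 * dot u v)) * dot u v = dot v v + 1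
      by field.
    lra.
  by rewrite mulr_ge0 ?dnorm_ge0.
have h := dot_ge0 (((dot u u)%:C)%C *: v - ((dot u v)%:C)%C *: u).
rewrite dotBB !(dotRl, dotRr) (dotC v u) in h.
have {}h : dot u v ^+ 2 <= dot u u * dot v v.
  rewrite -(ler_pM2l u0); move: h; nra.
rewrite (le_trans (ler_norm _))// -(ler_pXn2r (n := 2))//.
- by rewrite real_normK ?num_real// exprMn !sqr_dnorm.
- by rewrite nnegrE mulr_ge0 ?dnorm_ge0.
Qed.

Lemma ler_dnormD u v : dnorm (u + v) <= dnorm u + dnorm v.
Proof.
apply: le_dnorm; first by rewrite addr_ge0 ?dnorm_ge0.
rewrite dotDD sqrrD !sqr_dnorm -mulr_natl.
have := dot_le_dnorm u v; lra.
Qed.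

Lemma dotZZ (a : R[i]) u : dot (a *: u) (a *: u) = cmod a ^+ 2 * dot u u.
Proof.
rewrite dotZ scalerA.
have -> : ((a^*)%C * a = (cmod a ^+ 2)%:C)%C.
  case: a => x y; rewrite cmod2E /=; apply/eqP.
  by rewrite eq_complex /=; apply/andP; split; apply/eqP; ring.
by rewrite dotRr.
Qed.

Lemma dnormZ (a : R[i]) u : dnorm (a *: u) = cmod a * dnorm u.
Proof.
rewrite /dnorm dotZZ sqrtrM ?sqr_ge0// sqrtr_sqr ger0_norm//.
by case: a => x y /=; rewrite sqrtr_ge0.
Qed.

Lemma dnorm_normalize u : 0 < dnorm u -> dnorm (((dnorm u)^-1)%:C%C *: u) = 1.
Proof.
move=> u0; rewrite dnormZ /= expr0n /= addr0 sqrtr_sqr gtr0_norm ?invr_gt0//.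
by rewrite mulVf// gt_eqF.
Qed.

Lemma dnormN u : dnorm (- u) = dnorm u.
Proof. by rewrite /dnorm dotNl dotNr opprK. Qed.

End InnerProduct.

Section NormalPair.
Context (R : realType) (H : lmodType R[i]) (dot : H -> H -> R).
Hypothesis dotP : real_inner_product dot.
Local Notation nm := (dnorm dot).

(** Normality with the adjoint [S] and the norm bound [K] as explicit data, on
    a space where adjoints need not exist. *)
Definition normal_pair (T S : H -> H) (K : R) : Prop :=
  [/\ linear T, linear S, forall u v, dot (T u) v = dot u (S v),
      forall u, T (S u) = S (T u) &
      forall u, nm (T u) <= K * nm u /\ nm (S u) <= K * nm u].

Lemma linear_fun0 (L : H -> H) : linear L -> L 0 = 0.
Proof.
move=> linL; apply: (addrI (L 0)); have := linL 1 0 0.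
by rewrite !scale1r !addr0 => <-.
Qed.

Lemma linear_funZ (L : H -> H) a u : linear L -> L (a *: u) = a *: L u.
Proof. by move=> linL; rewrite -[X in L X]addr0 linL linear_fun0// addr0. Qed.

Lemma linear_funD (L : H -> H) u v : linear L -> L (u + v) = L u + L v.
Proof. by move=> linL; rewrite -[u in LHS]scale1r linL scale1r. Qed.

Lemma linear_funB (L : H -> H) u v : linear L -> L (u - v) = L u - L v.
Proof. by move=> linL; rewrite addrC -[- v]scaleN1r linL scaleN1r addrC. Qed.

Lemma normal_pair_shift (T S : H -> H) (K : R) (w : R[i]) :
  normal_pair T S K ->
  normal_pair (fun u => T u - w *: u) (fun u => S u - (w^*)%C *: u) (K + cmod w).
Proof.
move=> [linT linS TS TSC TSbd].
have linM (L : H -> H) (z : R[i]) : linear L -> linear (fun u => L u - z *: u).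
  move=> linL a x y; rewrite linL scalerDr opprD addrACA scalerBr !scalerA.
  by rewrite (mulrC z).
split; [exact: linM|exact: linM| | |].
- have [dDl _ dZ _ _] := dotP.
  by move=> x y; rewrite dDl (dotDr dotP) (dotNl dotP) (dotNr dotP) TS dZ.
- move=> x; rewrite (linear_funB _ _ linT) (linear_funB _ _ linS).
  rewrite (linear_funZ _ _ linT) (linear_funZ _ _ linS) TSC.
  have subACA (a b c d : H) : a - b - (c - d) = a - c - (b - d).
    by rewrite !opprD !opprK addrACA.
  by rewrite !scalerBr !scalerA mulrC subACA.
- move=> x; have [Tx Sx] := TSbd x.
  have cw : cmod (w^*)%C = cmod w by case: (w) => a b /=; rewrite sqrrN.
  by split; rewrite (le_trans (ler_dnormD dotP _ _))// (dnormN dotP)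
    (dnormZ dotP) mulrDl ?cw lerD2r.
Qed.

End NormalPair.

Section NormalOperator.
Context (R : realType) (H : lmodType R[i]) (dot : H -> H -> R).
Hypothesis dotP : real_inner_product dot.
Local Notation nm := (dnorm dot).

(** Contradictions by letting [t] tend to 0. *)
Lemma pos_not_le_small (a b : R) : 0 < a ->
  (forall t, 0 < t -> t <= 1 -> a <= t * b) -> False.
Proof.
move=> a0 h; have [b0|b0] := leP b 0.
  by have := h 1 ltr01 (lexx _); lra.
have t0 : 0 < a / (a + b) / 2 by rewrite !divr_gt0// addr_gt0.
have t1 : a / (a + b) / 2 <= 1.
  by rewrite ler_pdivrMr// ler_pdivrMr ?addr_gt0//; lra.
have ab : a / (a + b) * (a + b) = a by field; rewrite gt_eqF// addr_gt0.
have := h _ t0 t1; nra.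
Qed.

(** Polarisation. The hypothesis controls the quadratic form of the symmetric
    operator [A] by that of [P], up to [k c^2]. At the vectors
    [k c u + A u] and [k c u - A u] its values have opposite cross terms
    [2 k c <A u, A u>], so adding both instances isolates [|A u|^2]. The result
    is [|A u|^2 <= k^2 c^2 |u|^2] up to terms that vanish with [P u]. *)
Lemma hermitian_part_le (A P : H -> H) (c k K : R) u :
    (forall u v, A (u + v) = A u + A v) ->
    (forall (r : R) u, A ((r%:C)%C *: u) = (r%:C)%C *: A u) ->
    (forall u v, dot (A u) v = dot u (A v)) ->
    (forall u v, P (u + v) = P u + P v) ->
    (forall (r : R) u, P ((r%:C)%C *: u) = (r%:C)%C *: P u) ->
    (forall u v, dot (P u) v = dot u (P v)) ->
    (forall u, A (P u) = P (A u)) ->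
    (forall u, nm (A u) <= K * nm u) ->
    0 < c -> 0 < k -> 0 <= K ->
    (forall u, c * `|dot (A u) u| <= dot (P u) u + k * c ^+ 2 * dot u u) ->
  k * c ^+ 2 * dot (A u) (A u) <= k ^+ 3 * c ^+ 4 * dot u u +
    k ^+ 2 * c ^+ 2 * dot (P u) u + K ^+ 2 * nm (P u) * nm u.
Proof.
move=> AD AR Asym PD PR Psym AP Abd c0 k0 K0 h.
pose a := (((k * c)%:C)%C *: u); pose b := A u.
have hp := h (a + b); have hm := h (a - b).
have dDl : forall u v w, dot (u + v) w = dot u w + dot v w by case: dotP.
have dC : forall u v, dot u v = dot v u by case: dotP.
have dRl : forall (r : R) u v, dot ((r%:C)%C *: u) v = r * dot u v
  by case: dotP.
have realN (v : H) : - v = ((-1)%:C)%C *: v by rewrite rmorphN1 scaleN1r.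
have AN v : A (- v) = - A v by rewrite realN AR -realN.
have PN v : P (- v) = - P v by rewrite realN PR -realN.
have {}hp := le_trans (ler_wpM2l (ltW c0) (ler_norm _)) hp.
rewrite -normrN in hm.
have {}hm := le_trans (ler_wpM2l (ltW c0) (ler_norm _)) hm.
rewrite !AD !PD ?AN ?PN !dDl !(dotDr dotP) ?(dotNl dotP) ?(dotNr dotP) in hp hm.
have Aba : dot (A b) a = dot (A a) b by rewrite Asym dC.
have Pba : dot (P b) a = dot (P a) b by rewrite Psym dC.
have e1 : dot (A a) b = k * c * dot b b by rewrite /a AR dRl.
have e2 : dot a a = (k * c) ^+ 2 * dot u u.
  by rewrite /a dRl (dotRr dotP) mulrA -expr2.
have e3 : dot (P a) a = (k * c) ^+ 2 * dot (P u) u.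
  by rewrite /a PR dRl (dotRr dotP) mulrA -expr2.
have PAA : dot (P b) b <= K ^+ 2 * nm (P u) * nm u.
  rewrite /b -AP Asym (le_trans (dot_le_dnorm dotP _ _))//.
  rewrite [leRHS](_ : _ = nm (P u) * (K ^+ 2 * nm u)); last by ring.
  rewrite ler_wpM2l ?dnorm_ge0//.
  by rewrite (le_trans (Abd _))// expr2 -mulrA ler_wpM2l.
move: hp hm; rewrite Aba Pba (dC b a) e1 e2 e3 -/b => hp hm.
have : 4 * k * c ^+ 2 * dot b b <= 2 * (k * c ^+ 2 * dot b b) +
    2 * (k ^+ 3 * c ^+ 4 * dot u u + k ^+ 2 * c ^+ 2 * dot (P u) u
    + dot (P b) b).
  have := lerD hp hm; rewrite -subr_ge0 => hh; rewrite -subr_ge0.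
  apply: le_trans hh _; rewrite le_eqVlt; apply/orP; left; apply/eqP; ring.
lra.
Qed.

(** Positivity of [P] at the vector [u - M^-1 P u]. *)
Lemma positive_operator_sqr_le (P : H -> H) (M : R) u :
    (forall u v, P (u + v) = P u + P v) ->
    (forall (r : R) u, P ((r%:C)%C *: u) = (r%:C)%C *: P u) ->
    (forall u v, dot (P u) v = dot u (P v)) ->
    (forall u, 0 <= dot (P u) u) -> 0 < M -> (forall u, nm (P u) <= M * nm u) ->
  dot (P u) (P u) <= M * dot (P u) u.
Proof.
move=> PD PR Psym P0 M0 PM.
have dDl : forall u v w, dot (u + v) w = dot u w + dot v w by case: dotP.
have dRl : forall (r : R) u v, dot ((r%:C)%C *: u) v = r * dot u v
  by case: dotP.
have := P0 (((- M^-1)%:C)%C *: P u + u).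
rewrite PD PR !dDl !(dotDr dotP) !dRl !(dotRr dotP) (Psym (P u) u) => h.
have h2 : dot (P (P u)) (P u) <= M * dot (P u) (P u).
  rewrite (le_trans (dot_le_dnorm dotP _ _))//.
  by rewrite -(sqr_dnorm dotP) expr2 mulrA ler_wpM2r ?dnorm_ge0.
have h3 : (M^-1) ^+ 2 * dot (P (P u)) (P u) <= M^-1 * dot (P u) (P u).
  have -> : M^-1 = (M^-1) ^+ 2 * M by rewrite expr2 mulfVK ?gt_eqF.
  rewrite -mulrA (_ : (M^-1 ^+ 2 * M) ^+ 2 = M^-1 ^+ 2) 1?ler_wpM2l ?sqr_ge0//.
  by field; rewrite gt_eqF.
have h4 : M^-1 * dot (P u) (P u) <= dot (P u) u.
  move: h h3; set x := dot (P u) (P u); lra.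
by rewrite -ler_pdivrMl.
Qed.

(** Let [H1] and [H2] be the real and imaginary part of [T], and
    [P = S T - c^2 >= 0]. If none of the four points [w = c/2, -c/2, i c/2, -i c/2]
    works, then [|(T - w) u|^2 >= (16/25) c^2 |u|^2] for each of them, which
    expands to [c |<H_j u, u>| <= <P u, u> + k c^2 |u|^2] with
    [k = 1 + 1/4 - 16/25 = 61/100]. By polarisation [|H_j u|^2] is at most
    [k^2 c^2 |u|^2] up to terms in [P u]. Take a unit vector [u] that almost
    minimises [|T u|]: there [P u] is negligible and
    [c^2 <= |T u|^2 = |H1 u|^2 + |H2 u|^2 <= 2 k^2 c^2] up to small terms. This is
    absurd since [2 k^2 < 1]. *)
Lemma lower_bound_decreases (T S : H -> H) (c K : R) :
    normal_pair dot T S K -> 0 < c -> 0 < K ->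
    (forall u, c * nm u <= nm (T u)) ->
    (forall e, 0 < e -> exists2 u, nm u = 1 & nm (T u) ^+ 2 <= c ^+ 2 + e) ->
  exists2 w : R[i], `|complex.Re w| + `|complex.Im w| <= c / 2 &
    exists2 u, nm u = 1 & nm (T u - w *: u) < 4 / 5 * c.
Proof.
move=> TSn c0 K0 Tlow Tinf; have [linT linS TS TSC TSbd] := TSn.
have Tbd u := (TSbd u).1; have Sbd u := (TSbd u).2.
apply: contrapT => nw.
have dot_ge0' u : 0 <= dot u u by case: dotP.
have hw w : `|complex.Re w| + `|complex.Im w| <= c / 2 ->
    forall u, 16 / 25 * c ^+ 2 * dot u u <= dot (T u - w *: u) (T u - w *: u).
  move=> wc u; rewrite leNgt; apply/negP => hlt; apply: nw.
  exists w => //.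
  have n0 : 0 < nm u.
    rewrite lt_neqAle dnorm_ge0 andbT; apply/eqP => n0.
    have := le_lt_trans (dot_ge0' _) hlt.
    by rewrite -(sqr_dnorm dotP) -n0 expr0n /= mulr0 ltxx.
  exists ((((nm u)^-1)%:C)%C *: u); first exact: dnorm_normalize.
  rewrite (linear_funZ _ _ linT) scalerA mulrC -scalerA -scalerBr (dnormZ dotP) /=.
  rewrite expr0n /= addr0 sqrtr_sqr gtr0_norm ?invr_gt0//.
  rewrite ltr_pdivrMl// mulrC -(ltr_pXn2r (n := 2)) ?nnegrE ?dnorm_ge0//; last first.
    by rewrite !mulr_ge0 ?dnorm_ge0 ?ltW.
  rewrite (sqr_dnorm dotP) (lt_le_trans hlt)// !exprMn (sqr_dnorm dotP).
  by rewrite le_eqVlt; apply/orP; left; apply/eqP; field.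
have dDl : forall u v w, dot (u + v) w = dot u w + dot v w by case: dotP.
have dC : forall u v, dot u v = dot v u by case: dotP.
have dZ : forall a u v, dot (a *: u) v = dot u ((a^*)%C *: v) by case: dotP.
have dRl : forall (r : R) u v, dot ((r%:C)%C *: u) v = r * dot u v
  by case: dotP.
have TD u v := linear_funD u v linT; have SD u v := linear_funD u v linS.
have TZ a u := linear_funZ a u linT; have SZ a u := linear_funZ a u linS.
have TB u v := linear_funB u v linT; have SB u v := linear_funB u v linS.
have ST u v : dot (S u) v = dot u (T v) by rewrite dC -TS dC.
(* [A1] and [A2] are the real and imaginary part [H1] and [H2] of [T]. *)
pose P u := S (T u) - ((c ^+ 2)%:C)%C *: u.
pose h : R[i] := ((2^-1)%:C)%C.
pose A1 u := h *: (T u + S u).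
pose A2 u := (h * 'i%C) *: (S u - T u).
have PD u v : P (u + v) = P u + P v.
  by rewrite /P TD SD scalerDr opprD addrACA.
have PZ a u : P (a *: u) = a *: P u.
  by rewrite /P TZ SZ scalerBr !scalerA mulrC.
have Psym u v : dot (P u) v = dot u (P v).
  by rewrite dDl (dotDr dotP) ST TS (dotNl dotP) (dotNr dotP) dRl (dotRr dotP).
have hC : (h^*)%C = h by rewrite /h conjc_real.
have A1sym u v : dot (A1 u) v = dot u (A1 v).
  by rewrite /A1 dZ hC dDl TS ST SZ TZ scalerDr (dotDr dotP) addrC.
have A2sym u v : dot (A2 u) v = dot u (A2 v).
  rewrite /A2 dZ.
  have -> : ((h * 'i)^* = - (h * 'i))%C.
    by apply/eqP; rewrite eq_complex /=; apply/andP; split; apply/eqP; ring.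
  rewrite dDl (dotNl dotP) ST TS TZ SZ scalerBr (dotDr dotP) (dotNr dotP).
  by rewrite !scaleNr !(dotNr dotP) opprK addrC.
have A1P u : A1 (P u) = P (A1 u).
  by rewrite /A1 PZ PD /P TB SB !TZ !SZ !TSC.
have A2P u : A2 (P u) = P (A2 u).
  rewrite /A2 PZ PD -[in RHS](scaleN1r (T u)) PZ scaleN1r.
  by rewrite /P TB SB !TZ !SZ !TSC.
have c2 : 0 < c ^+ 2 by rewrite exprn_gt0.
have kR : (0 : R) < 61 / 100 by lra.
have K0' := ltW K0.
have PE u : dot (T u) (T u) = dot (P u) u + c ^+ 2 * dot u u.
  by rewrite dDl (dotNl dotP) dRl ST; ring.
have lower u w : dot (T u - w *: u) (T u - w *: u) =
    dot (P u) u + c ^+ 2 * dot u u - 2 * dot (T u) (w *: u) +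
    cmod w ^+ 2 * dot u u.
  by rewrite (dotBB dotP) PE (dotZZ dotP).
have A1E u : dot (A1 u) u = dot (T u) u.
  by rewrite /A1 dRl dDl ST (dC u); field.
have A2E u : dot (A2 u) u = dot (T u) ('i%C *: u).
  rewrite /A2 -scalerA dRl scalerBr dDl (dotNl dotP) !dZ.
  have -> : ('i^*)%C = (- 'i)%C :> R[i].
    by apply/eqP; rewrite eq_complex /=; apply/andP; split; apply/eqP; ring.
  rewrite ST TZ !scaleNr !(dotNr dotP) [dot u _]dC dZ.
  have -> : ('i^*)%C = (- 'i)%C :> R[i].
    by apply/eqP; rewrite eq_complex /=; apply/andP; split; apply/eqP; ring.
  by rewrite scaleNr (dotNr dotP); field.
have A1low u : c * `|dot (A1 u) u| <= dot (P u) u + 61 / 100 * c ^+ 2 * dot u u.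
  have wc (e : R) : `|e| = 1 -> `|complex.Re (((e * c / 2)%:C)%C)| +
      `|complex.Im (((e * c / 2)%:C)%C)| <= c / 2.
    by move=> e1 /=; rewrite normr0 addr0 !normrM e1 mul1r !gtr0_norm// invr_gt0.
  have h1 := hw _ (wc 1 (normr1 _)) u.
  have h2 := hw _ (wc (-1) (normrN1 _)) u.
  rewrite !lower !(dotRr dotP) !cmod2E /= in h1 h2.
  rewrite A1E; have [d0|d0] := ger0P (dot (T u) u); lra.
have A2low u : c * `|dot (A2 u) u| <= dot (P u) u + 61 / 100 * c ^+ 2 * dot u u.
  have wc (e : R) : `|e| = 1 -> `|complex.Re (((e * c / 2)%:C * 'i)%C)| +
      `|complex.Im (((e * c / 2)%:C * 'i)%C)| <= c / 2.
    move=> e1 /=; rewrite mulr0 mul0r subr0 mulr1 mul0r addr0 normr0 add0r.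
    by rewrite !normrM e1 mul1r !gtr0_norm// invr_gt0.
  have h1 := hw _ (wc 1 (normr1 _)) u.
  have h2 := hw _ (wc (-1) (normrN1 _)) u.
  rewrite !lower -!scalerA !(dotRr dotP) !cmod2E /= in h1 h2.
  rewrite A2E; have [d0|d0] := ger0P (dot (T u) ('i%C *: u)); lra.
have A1D u v : A1 (u + v) = A1 u + A1 v.
  by rewrite /A1 TD SD addrACA scalerDr.
have A2D u v : A2 (u + v) = A2 u + A2 v.
  by rewrite /A2 TD SD opprD addrACA scalerDr.
have A1R (r : R) u : A1 ((r%:C)%C *: u) = (r%:C)%C *: A1 u.
  by rewrite /A1 TZ SZ -scalerDr !scalerA mulrC.
have A2R (r : R) u : A2 ((r%:C)%C *: u) = (r%:C)%C *: A2 u.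
  by rewrite /A2 TZ SZ -scalerBr !scalerA mulrC.
have ch : cmod h = 2^-1.
  by rewrite /h /= expr0n /= addr0 sqrtr_sqr gtr0_norm// invr_gt0.
have chi : cmod (h * 'i%C) = 2^-1.
  by rewrite ComplexField.Normc.normcM ch /= expr0n /= add0r expr1n sqrtr1 mulr1.
have A1bd u : nm (A1 u) <= K * nm u.
  rewrite /A1 (dnormZ dotP) ch; have := ler_dnormD dotP (T u) (S u).
  have := Tbd u; have := Sbd u; lra.
have A2bd u : nm (A2 u) <= K * nm u.
  rewrite /A2 (dnormZ dotP) chi; have := ler_dnormD dotP (S u) (- T u).
  rewrite (dnormN dotP); have := Tbd u; have := Sbd u; lra.
have AA u : dot (A1 u) (A1 u) + dot (A2 u) (A2 u) = dot (T u) (T u).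
  rewrite /A1 /A2 !(dotZZ dotP) ch chi (dotDD dotP) (dotBB dotP) (dC (S u) (T u)).
  have -> : dot (S u) (S u) = dot (T u) (T u) by rewrite ST TSC -TS.
  by field.
have P0 u : 0 <= dot (P u) u.
  have := Tlow u; rewrite -(ler_pXn2r (n := 2))// ?nnegrE ?dnorm_ge0//.
    by rewrite exprMn !(sqr_dnorm dotP) PE; lra.
  by rewrite mulr_ge0 ?dnorm_ge0 ?ltW.
pose M := K ^+ 2 + c ^+ 2.
have M0 : 0 < M by rewrite addr_gt0 ?exprn_gt0.
have PM u : nm (P u) <= M * nm u.
  rewrite (le_trans (ler_dnormD dotP _ _))// (dnormN dotP) (dnormZ dotP).
  rewrite mulrDl lerD//.
    by rewrite (le_trans (Sbd _))// expr2 -mulrA ler_wpM2l.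
  rewrite ler_wpM2r ?dnorm_ge0//=.
  by rewrite expr0n /= addr0 sqrtr_sqr gtr0_norm.
apply: (@pos_not_le_small (61 / 100 * c ^+ 4 * (1 - 2 * (61 / 100) ^+ 2))
  (2 * (61 / 100) ^+ 2 * c ^+ 2 / M + 2 * K ^+ 2)).
  by rewrite !mulr_gt0 ?exprn_gt0//; lra.
move=> t t0 t1.
have e0 : 0 < t ^+ 2 / M by rewrite divr_gt0 ?exprn_gt0.
have [u u1 uT] := Tinf _ e0.
have du1 : dot u u = 1 by rewrite -(sqr_dnorm dotP) u1 expr1n.
have Pu_le : dot (P u) u <= t ^+ 2 / M.
  by move: uT; rewrite (sqr_dnorm dotP) PE du1; lra.
have nPu : nm (P u) <= t.
  apply: le_dnorm => //; first exact: ltW.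
  rewrite (le_trans (positive_operator_sqr_le _ PD _ Psym P0 M0 PM))//.
  by rewrite -ler_pdivlMl// mulrC.
have h1 := hermitian_part_le u A1D A1R A1sym PD (fun r => PZ _) Psym A1P A1bd
  c0 kR K0' A1low.
have h2 := hermitian_part_le u A2D A2R A2sym PD (fun r => PZ _) Psym A2P A2bd
  c0 kR K0' A2low.
have h3 := AA u; rewrite PE du1 in h3.
have tM : t ^+ 2 / M <= t / M.
  by rewrite ler_pM2r ?invr_gt0// expr2 ler_piMl// ltW.
have h4 : K ^+ 2 * nm (P u) <= K ^+ 2 * t by rewrite ler_wpM2l ?sqr_ge0.
have h5 : c ^+ 2 * dot (P u) u <= c ^+ 2 * (t / M).
  by rewrite ler_wpM2l ?sqr_ge0// (le_trans Pu_le).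
have h6 : c ^+ 4 = c ^+ 2 * c ^+ 2 by ring.
have Pu0 := P0 u.
rewrite u1 du1 !mulr1 in h1 h2.
have h7 : 0 <= c ^+ 2 * dot (P u) u by rewrite mulr_ge0 ?sqr_ge0.
have h8 : 61 / 100 * c ^+ 2 * (dot (A1 u) (A1 u) + dot (A2 u) (A2 u)) =
  61 / 100 * (c ^+ 2 * dot (P u) u + c ^+ 4) by rewrite h3 h6; ring.
have h9 : t * (2 * (61 / 100) ^+ 2 * c ^+ 2 / M + 2 * K ^+ 2) =
  2 * (61 / 100) ^+ 2 * (c ^+ 2 * (t / M)) + 2 * (K ^+ 2 * t) by ring.
rewrite h9; lra.
Qed.

Let dot_ge0' u : 0 <= dot u u. Proof. by case: dotP. Qed.

(** If there are unit vectors, it vanishes exactly at the approximate eigenvalues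
    of [T]. *)
Definition lower_bound (T : H -> H) (w : R[i]) : R :=
  inf [set nm (T u - w *: u) | u in [set u | nm u = 1]].

(* The distance in which the four points of [lower_bound_decreases] lie, and
   which splits into the coordinates of the plane. *)
Let l1 (w : R[i]) : R := `|complex.Re w| + `|complex.Im w|.

Lemma cmod_le_l1 (w : R[i]) : cmod w <= l1 w.
Proof.
rewrite -(ler_pXn2r (n := 2)) ?nnegrE//; last by rewrite addr_ge0.
- by rewrite cmod2E /l1 sqrrD !real_normK ?num_real// lerD2r lerDl mulrn_wge0
    // mulr_ge0.
- by case: w => a b /=; exact: sqrtr_ge0.
Qed.

Lemma lower_bound_inf (T : H -> H) w u : nm u = 1 ->
  has_inf [set nm (T u - w *: u) | u in [set u | nm u = 1]].
Proof.
move=> u1; split; first by exists (nm (T u - w *: u)), u.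
by exists 0 => _ [v _ <-]; exact: dnorm_ge0.
Qed.

Lemma lower_bound_le (T : H -> H) w u : nm u = 1 ->
  lower_bound T w <= nm (T u - w *: u).
Proof.
by move=> u1; apply: ge_inf; [case: (lower_bound_inf T w u1)|exists u].
Qed.

Lemma lower_bound_lt (T : H -> H) w r v : nm v = 1 -> lower_bound T w < r ->
  exists2 u, nm u = 1 & nm (T u - w *: u) < r.
Proof.
move=> v1 /(inf_lt (proj1 (lower_bound_inf T w v1)))[_ [u u1 <-] ur].
by exists u.
Qed.

Lemma lower_bound_ge0 (T : H -> H) w : 0 <= lower_bound T w.
Proof.
rewrite /lower_bound.
have [->|/set0P[u u1]] := eqVneq [set u | nm u = 1] set0.
  by rewrite image_set0 inf0.
apply: lb_le_inf; first by exists (nm (T u - w *: u)), u.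
by move=> _ [v _ <-]; exact: dnorm_ge0.
Qed.

Lemma lower_bound_lip (T : H -> H) w w' v : nm v = 1 ->
  lower_bound T w <= lower_bound T w' + l1 (w - w').
Proof.
move=> v1; apply/ler_addgt0Pr => e e0.
have [u u1 ue] := @lower_bound_lt T w' (lower_bound T w' + e) v v1
  (ltac:(by rewrite ltrDl)).
apply: (le_trans (lower_bound_le T w u1)).
have -> : T u - w *: u = (T u - w' *: u) + (w' - w) *: u.
  by rewrite scalerBl addrA subrK.
rewrite (le_trans (ler_dnormD dotP _ _))// (dnormZ dotP) u1 mulr1.
have := cmod_le_l1 (w' - w).
have -> : l1 (w' - w) = l1 (w - w').
  rewrite -opprB /l1; case: (w - w') => a b /=.
  by rewrite !normrN.
by move: ue; lra.
Qed.

Lemma lower_bound_nm (T : H -> H) w u : linear T ->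
  lower_bound T w * nm u <= nm (T u - w *: u).
Proof.
move=> linT; have [u0|u0] := ltP 0 (nm u); last first.
  have -> : nm u = 0 by apply/eqP; rewrite eq_le u0 dnorm_ge0.
  by rewrite mulr0 dnorm_ge0.
have cn : cmod (((nm u)^-1)%:C)%C = (nm u)^-1.
  by rewrite /= expr0n /= addr0 sqrtr_sqr gtr0_norm// invr_gt0.
have u1 : nm ((((nm u)^-1)%:C)%C *: u) = 1 by exact: dnorm_normalize.
have := lower_bound_le T w u1.
rewrite (linear_funZ _ _ linT) scalerA mulrC -scalerA -scalerBr (dnormZ dotP) cn.
by rewrite ler_pdivlMl// mulrC.
Qed.

(** The descent step at [w], applied to the normal operator [T - w]. *)
Lemma lower_bound_step (T S : H -> H) (K : R) (w : R[i]) v :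
    normal_pair dot T S K -> 0 < K ->
    nm v = 1 -> 0 < lower_bound T w ->
  exists2 w' : R[i], l1 (w' - w) <= lower_bound T w / 2 &
    lower_bound T w' <= 4 / 5 * lower_bound T w.
Proof.
move=> TSn K0 v1 c0; set c := lower_bound T w.
have [linT _ _ _ _] := TSn.
have [||||w1 w1c [u u1 ulow]] :=
  @lower_bound_decreases _ _ c _ (normal_pair_shift dotP w TSn).
- by [].
- by rewrite ltr_wpDr//; case: (w) => a b /=; exact: sqrtr_ge0.
- by move=> x; exact: lower_bound_nm.
- move=> e e0; pose d := Num.min 1 (e / (2 * c + 1)).
  have c0' : 0 < 2 * c + 1 by rewrite addr_gt0// mulr_gt0.
  have d0 : 0 < d by rewrite lt_min ltr01 divr_gt0.
  have [u u1 ud] := @lower_bound_lt T w (c + d) v v1 (ltac:(by rewrite ltrDl)).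
  exists u => //; rewrite (le_trans (_ : _ <= (c + d) ^+ 2))//.
    by rewrite ler_pXn2r ?nnegrE ?dnorm_ge0 ?ltW// addr_gt0.
  have d1 : d <= 1 by rewrite ge_min lexx.
  have d2 : d * (2 * c + 1) <= e by rewrite -ler_pdivlMr// ge_min lexx orbT.
  have d3 : d ^+ 2 <= d by rewrite expr2 ler_piMl// ltW.
  rewrite sqrrD; lra.
exists (w + w1); first by rewrite addrC addKr.
rewrite ltW// (le_lt_trans (lower_bound_le T _ u1))//.
by rewrite scalerDl opprD addrA.
Qed.

Lemma l1_lipschitz_continuous (F : R * R -> R) (L : R) : 0 < L ->
  (forall p q, F p - F q <= L * (`|p.1 - q.1| + `|p.2 - q.2|)) -> continuous F.
Proof.
move=> L0 FL p; apply/cvgrPdist_lt => e e0.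
have h : \forall q \near p, `|p.1 - q.1| < e / L / 2 /\ `|p.2 - q.2| < e / L / 2.
  have e0' : 0 < e / L / 2 by rewrite !divr_gt0.
  exists (ball p.1 (e / L / 2), ball p.2 (e / L / 2)) => /=.
    by split; exact: nbhsx_ballx.
  by case=> a b /=.
near=> q; have [q1 q2] : `|p.1 - q.1| < e / L / 2 /\ `|p.2 - q.2| < e / L / 2.
  by near: q.
have eL : e = L * (e / L / 2 + e / L / 2) by field; rewrite gt_eqF.
have lt1 : L * (`|p.1 - q.1| + `|p.2 - q.2|) < e.
  by rewrite [ltRHS]eL ltr_pM2l// ltrD.
rewrite ltr_norml; have := FL p q; have := FL q p.
rewrite (distrC q.1) (distrC q.2); lra.
Unshelve. all: end_near. Qed.

(** Minimise [F w = lower_bound T w + 3/10 |w - z|] over a square around [z].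
    If the infimum [c] at the minimiser were positive, a step of length at most
    [c / 2] would save [c / 5] in the first term and cost at most
    [3/20 c < c / 5] in the second. The minimiser is within [4 B] of [z] because
    [F] is at most [B] there and [10/3 <= 4]. *)
Lemma approx_eigenvalue_near (T S : H -> H) (K B : R) (z : R[i]) phi :
    normal_pair dot T S K -> 0 < K ->
    0 < nm phi -> nm (T phi - z *: phi) <= B * nm phi ->
  exists2 w : R[i], cmod (w - z) <= 4 * B &
    forall c, 0 < c -> exists2 u, nm u = 1 & nm (T u - w *: u) < c.
Proof.
move=> TSn K0 phi0 phiB; have [linT _ _ _ _] := TSn.
have [v v1] : exists v, nm v = 1.
  by exists ((((nm phi)^-1)%:C)%C *: phi); exact: dnorm_normalize.
have fB : lower_bound T z <= B.
  by rewrite -(ler_pM2r phi0); exact: le_trans (lower_bound_nm _ _ linT) phiB.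
have B0 : 0 <= B := le_trans (lower_bound_ge0 T z) fB.
pose F (p : R * R) := lower_bound T (p.1 +i* p.2)%C +
  3 / 10 * (`|p.1 - complex.Re z| + `|p.2 - complex.Im z|).
pose E := `[complex.Re z - 4 * B, complex.Re z + 4 * B]%classic `*`
          `[complex.Im z - 4 * B, complex.Im z + 4 * B]%classic.
have cE : compact E by apply: compact_setX; exact: segment_compact.
have zE : E (complex.Re z, complex.Im z).
  by split; rewrite /= in_itv /=; apply/andP; split; lra.
have FL p q : F p - F q <= 2 * (`|p.1 - q.1| + `|p.2 - q.2|).
  have := lower_bound_lip T (p.1 +i* p.2)%C (q.1 +i* q.2)%C v1.
  rewrite /l1 /= /F.
  have := ler_distD q.1 p.1 (complex.Re z).
  have := ler_distD q.2 p.2 (complex.Im z).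
  have := normr_ge0 (p.1 - q.1); have := normr_ge0 (p.2 - q.2); lra.
have Fc := l1_lipschitz_continuous (ltr0Sn _ _ : 0 < 2) FL.
have [p /set_mem pE pmin] :=
  compact_EVT_min (ex_intro _ _ zE) cE (continuous_subspaceT Fc).
pose w : R[i] := (p.1 +i* p.2)%C.
have Fz : F (complex.Re z, complex.Im z) = lower_bound T z.
  by rewrite /F /= !subrr normr0 addr0 mulr0 addr0; case: (z).
have pB : F p <= B by rewrite (le_trans (pmin _ (mem_set zE)))// Fz.
have w0 := lower_bound_ge0 T w.
exists w.
  rewrite (le_trans (cmod_le_l1 _))//; move: pB.
  rewrite /F -/w /l1 /=.
  have -> : complex.Re (w - z) = p.1 - complex.Re z by case: (z).
  have -> : complex.Im (w - z) = p.2 - complex.Im z by case: (z).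
  lra.
move=> c c0; apply: (lower_bound_lt v1); rewrite (le_lt_trans _ c0)//.
rewrite leNgt; apply/negP => f0.
have [w1 w1w fw1] := lower_bound_step TSn K0 v1 f0.
pose p1 := (complex.Re w1, complex.Im w1).
have Fp1 : F p1 < F p.
  rewrite /F /= -/w (_ : (complex.Re w1 +i* complex.Im w1)%C = w1); last first.
    by case: (w1).
  have h1 : `|complex.Re w1 - p.1| + `|complex.Im w1 - p.2| <= lower_bound T w / 2.
    by move: w1w; rewrite /l1 /w; case: (w1).
  have := ler_distD p.1 (complex.Re w1) (complex.Re z).
  have := ler_distD p.2 (complex.Im w1) (complex.Im z).
  lra.
suff : E p1 by move=> /mem_set /pmin; rewrite leNgt Fp1.
have : F p1 <= B by rewrite (le_trans (ltW Fp1)).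
rewrite /F /= (_ : (complex.Re w1 +i* complex.Im w1)%C = w1); last first.
  by case: (w1).
have := lower_bound_ge0 T w1 => w10 FB.
have a0 := normr_ge0 (complex.Re w1 - complex.Re z).
have b0 := normr_ge0 (complex.Im w1 - complex.Im z).
have h1 : `|complex.Re w1 - complex.Re z| <= 4 * B by lra.
have h2 : `|complex.Im w1 - complex.Im z| <= 4 * B by lra.
split; rewrite /= in_itv /=.
  by move: h1; rewrite ler_norml; lra.
by move: h2; rewrite ler_norml; lra.
Qed.

End NormalOperator.

Section Invertibility.
Context (R : realType) (H : lmodType R[i]) (dot : H -> H -> R).
Hypothesis dotP : real_inner_product dot.
Local Notation nm := (dnorm dot).

(** The form of completeness that a Neumann series needs. It is easier to verify
    for square integrable functions than the convergence of Cauchy sequences,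
    because a geometric series converges pointwise almost everywhere without
    passing to a subsequence. The remainder may decay more slowly than the terms
    do. *)
Definition geometrically_complete : Prop :=
  forall (e : nat -> H) (K q : R), 0 < q -> q < 1 ->
    (forall n, nm (e n) <= K * q ^+ n) ->
  exists u : H, exists2 Kp : R * R, 0 < Kp.2 < 1 &
    forall n, nm (u - \sum_(i < n) e i) <= Kp.1 * Kp.2 ^+ n.

Lemma geometric_le0 (a K q : R) : 0 < q -> q < 1 ->
  (forall n, a <= K * q ^+ n) -> a <= 0.
Proof.
move=> q0 q1 h; have cv : (fun n => K * q ^+ n) @ \oo --> 0.
  by apply: cvg_geometric; rewrite gtr0_norm.
rewrite -(cvg_lim (@Rhausdorff R) cv).
by apply: limr_ge; [apply/cvg_ex; exists 0|exact: nearW].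
Qed.

(** Since [S T >= c^2], the map [u |-> u - t S T u] is a contraction for small
    [t > 0], so that the equation [S T u = v] is solved by a Neumann series. As
    [S T = T S], the vector [S u] is a preimage of [v] under [T]. *)
Lemma normal_bounded_below_invertible (T S : H -> H) (c K : R) :
    geometrically_complete -> (forall u, dot u u = 0 -> u = 0) ->
    normal_pair dot T S K -> 0 < c -> 0 < K ->
    (forall u, c * nm u <= nm (T u)) ->
  exists I : H -> H, [/\ linear I, forall u, nm (I u) <= c^-1 * nm u,
    forall u, I (T u) = u & forall u, T (I u) = u].
Proof.
move=> Hc Hd [linT linS TS TSC TSbd] c0 K0 Tlow.
have Tbd u := (TSbd u).1; have Sbd u := (TSbd u).2.
have [_ dC _ dRl _] := dotP.
have nm0 u : nm u <= 0 -> u = 0.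
  move=> h; apply: Hd; have /eqP h0 : nm u == 0 by rewrite eq_le h dnorm_ge0.
  by rewrite -(sqr_dnorm dotP) h0 expr0n.
have Tinj u v : T u = T v -> u = v.
  move=> uv; apply/eqP; rewrite -subr_eq0; apply/eqP/nm0.
  rewrite -(ler_pM2l c0) mulr0 (le_trans (Tlow _))//.
  by rewrite (linear_funB _ _ linT) uv subrr /dnorm (dot0l dotP) sqrtr0.
(* With [k >= c] the contraction factor below is nonnegative. *)
pose k := K + c; have k0 : 0 < k by rewrite addr_gt0.
have Tbd' u : nm (T u) <= k * nm u.
  by rewrite (le_trans (Tbd u))// ler_wpM2r ?dnorm_ge0// lerDl ltW.
have Sbd' u : nm (S u) <= k * nm u.
  by rewrite (le_trans (Sbd u))// ler_wpM2r ?dnorm_ge0// lerDl ltW.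
(* [t] minimises the bound [1 - 2 t c^2 + t^2 k^4] for [|u - t S T u|^2], whose
   minimum [1 - x] is at most [(1 - x/2)^2]. *)
pose t := c ^+ 2 / k ^+ 4; have t0 : 0 < t by rewrite divr_gt0 ?exprn_gt0.
pose x := c ^+ 4 / k ^+ 4; have x0 : 0 < x by rewrite divr_gt0 ?exprn_gt0.
have x1 : x <= 1.
  rewrite ler_pdivrMr ?exprn_gt0// mul1r.
  by rewrite ler_pXn2r// ?nnegrE ?(ltW c0) ?(ltW k0)// /k lerDr (ltW K0).
pose L u := u - ((t%:C)%C) *: S (T u).
have L_le u : nm (L u) <= (1 - x / 2) * nm u.
  apply: (le_dnorm dotP); first by rewrite mulr_ge0 ?dnorm_ge0//; lra.
  rewrite (dotBB dotP) !(dotRr dotP) !dRl exprMn (sqr_dnorm dotP).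
  have -> : dot u (S (T u)) = dot (T u) (T u) by rewrite TS.
  have h1 : c ^+ 2 * dot u u <= dot (T u) (T u).
    rewrite -!(sqr_dnorm dotP) -exprMn.
    by rewrite ler_pXn2r ?nnegrE ?mulr_ge0 ?dnorm_ge0// ltW.
  have h2 : dot (S (T u)) (S (T u)) <= k ^+ 4 * dot u u.
    rewrite -!(sqr_dnorm dotP) (_ : k ^+ 4 = (k ^+ 2) ^+ 2); last by ring.
    rewrite -exprMn ler_pXn2r ?nnegrE ?mulr_ge0 ?dnorm_ge0 ?sqr_ge0 ?(ltW k0)//.
    by rewrite (le_trans (Sbd' _))// expr2 -mulrA ler_wpM2l// ltW.
  have e1 : t * (c ^+ 2 * dot u u) = x * dot u u by rewrite /t /x; field; rewrite gt_eqF.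
  have e2 : t ^+ 2 * (k ^+ 4 * dot u u) = x * dot u u.
    by rewrite /t /x; field; rewrite gt_eqF.
  have h1' := ler_wpM2l (ltW t0) h1.
  have h2' : t ^+ 2 * dot (S (T u)) (S (T u)) <= t ^+ 2 * (k ^+ 4 * dot u u).
    by rewrite ler_wpM2l ?sqr_ge0.
  rewrite e1 in h1'; rewrite e2 in h2'.
  have dd : 0 <= dot u u by case: dotP.
  have h3 : 0 <= x ^+ 2 * dot u u by rewrite mulr_ge0 ?sqr_ge0.
  have -> : (1 - x / 2) ^+ 2 * dot u u =
    dot u u - x * dot u u + x ^+ 2 * dot u u / 4 by field.
  lra.
have surj v : exists u, T u = v.
  pose e n := iter n L ((t%:C)%C *: v).
  have q0 : 0 < 1 - x / 2 by lra.
  have q1 : 1 - x / 2 < 1 by lra.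
  have e_le n : nm (e n) <= nm ((t%:C)%C *: v) * (1 - x / 2) ^+ n.
    elim: n => [|n IH]; first by rewrite expr0 mulr1.
    rewrite exprS mulrCA (le_trans (L_le _))// ler_wpM2l//; exact: ltW.
  have [u [Kp Kp01 hu]] := Hc e _ _ q0 q1 e_le.
  have /andP[p0 p1] := Kp01.
  pose A w := (t%:C)%C *: S (T w).
  have AB w w' : A (w - w') = A w - A w'.
    by rewrite /A (linear_funB _ _ linT) (linear_funB _ _ linS) scalerBr.
  have Asum n : A (\sum_(i < n) e i) = (t%:C)%C *: v - e n.
    elim: n => [|n IH].
      by rewrite big_ord0 /A (linear_fun0 linT) (linear_fun0 linS) scaler0 subrr.
    have AD w w' : A (w + w') = A w + A w'.
      by rewrite /A (linear_funD _ _ linT) (linear_funD _ _ linS) scalerDr.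
    have eS : e n.+1 = e n - A (e n) by [].
    rewrite eS big_ord_recr /= AD IH opprB -addrA.
    by congr (_ + _); rewrite addrC.
  have Abd w : nm (A w) <= t * k ^+ 2 * nm w.
    rewrite /A (dnormZ dotP) /= expr0n /= addr0 sqrtr_sqr gtr0_norm//.
    rewrite -mulrA ler_wpM2l// ?(ltW t0)//.
    by rewrite (le_trans (Sbd' _))// expr2 -mulrA ler_wpM2l// ltW.
  exists (S u); rewrite TSC; apply/eqP; rewrite -subr_eq0.
  have tn : (t%:C)%C != 0 :> R[i].
    by rewrite eq_complex /= negb_and gt_eqF.
  suff : (t%:C)%C *: (S (T u) - v) == 0 by rewrite scaler_eq0 (negbTE tn).
  rewrite scalerBr -/(A u); apply/eqP/nm0.
  (* A ratio that dominates both the remainder and the last term. *)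
  pose q := Num.max Kp.2 (1 - x / 2).
  have qq0 : 0 < q by rewrite lt_max p0.
  have qq1 : q < 1 by rewrite gt_max p1 q1.
  apply: (@geometric_le0 _ (t * k ^+ 2 * `|Kp.1| + nm ((t%:C)%C *: v)) q) => // n.
  have -> : A u - (t%:C)%C *: v = A (u - \sum_(i < n) e i) - e n.
    by rewrite AB Asum opprB addrA addrAC [A u + _]addrC addrK addrC.
  rewrite (le_trans (ler_dnormD dotP _ _))// (dnormN dotP) mulrDl lerD//.
    apply: (le_trans (Abd _)); rewrite -(mulrA (t * k ^+ 2)).
    apply: ler_wpM2l; first by rewrite mulr_ge0 ?(ltW t0) ?sqr_ge0.
    apply: (le_trans (hu n)).
    apply: (@le_trans _ _ (`|Kp.1| * Kp.2 ^+ n)).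
      by rewrite ler_wpM2r ?ler_norm// exprn_ge0 ?ltW.
    rewrite ler_wpM2l//; apply: lerXn2r; rewrite ?nnegrE ?(ltW p0) ?(ltW qq0)//.
    by rewrite /q le_max lexx.
  rewrite (le_trans (e_le n))// ler_wpM2l ?dnorm_ge0//.
  apply: lerXn2r; rewrite ?nnegrE ?(ltW q0) ?(ltW qq0)//.
  by rewrite /q le_max lexx orbT.
have /choice[I IP] := surj.
exists I; split => //.
- by move=> a u v; apply: Tinj; rewrite linT !IP.
- by move=> u; rewrite ler_pdivlMl// (le_trans (Tlow _))// IP.
- by move=> u; apply: Tinj; rewrite IP.
Qed.

End Invertibility.

(** * The Hilbert space of square integrable functions *)

Section ComplexMeasurable.
Context d (T : measurableType d) (R : realType).
Implicit Types f g : T -> R[i].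

Lemma complex_measurable_cst (c : R[i]) : complex_measurable (fun _ : T => c).
Proof. by split; exact: measurable_cst. Qed.

Lemma complex_measurableD f g : complex_measurable f -> complex_measurable g ->
  complex_measurable (fun x => f x + g x).
Proof.
move=> [? ?] [? ?]; split.
  by under eq_fun do rewrite complex_ReD; exact: measurable_funD.
by under eq_fun do rewrite complex_ImD; exact: measurable_funD.
Qed.

Lemma complex_measurableM f g : complex_measurable f -> complex_measurable g ->
  complex_measurable (fun x => f x * g x).
Proof.
move=> [? ?] [? ?]; split.
  under eq_fun do rewrite complex_ReM.
  by apply: measurable_funB; exact: measurable_funM.
under eq_fun do rewrite complex_ImM.
by apply: measurable_funD; exact: measurable_funM.
Qed.

Lemma complex_measurableB f g : complex_measurable f -> complex_measurable g ->
  complex_measurable (fun x => f x - g x).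
Proof.
move=> mf mg; rewrite (_ : (fun _ => _) = (fun x => f x + (-1) * g x)).
  apply: complex_measurableD => //.
  by apply: complex_measurableM => //; exact: complex_measurable_cst.
by apply/funext => x; rewrite mulN1r.
Qed.

Lemma complex_measurable_sum (I : Type) (s : seq I) (F : I -> T -> R[i]) :
  (forall i, complex_measurable (F i)) ->
  complex_measurable (fun x => \sum_(i <- s) F i x).
Proof.
move=> mF; elim: s => [|i s IH].
  by under eq_fun do rewrite big_nil; exact: complex_measurable_cst.
by under eq_fun do rewrite big_cons; exact: complex_measurableD.
Qed.

Lemma complex_measurable_conj f : complex_measurable f ->
  complex_measurable (fun x => (f x)^*%C).
Proof.
move=> [mR mI]; split.
  rewrite (_ : (fun _ => _) = (fun x => complex.Re (f x)))//.
  by apply/funext => x; case: (f x).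
rewrite (_ : (fun _ => _) = (fun x => - complex.Im (f x))).
  exact: measurableT_comp.
by apply/funext => x; case: (f x).
Qed.

Lemma measurable_cmod f : complex_measurable f ->
  measurable_fun setT (fun x => cmod (f x)).
Proof.
move=> [mR mI].
rewrite (_ : (fun _ => _) = (fun x => Num.sqrt (complex.Re (f x) ^+ 2 +
  complex.Im (f x) ^+ 2))).
  apply: (@measurableT_comp _ _ _ _ _ _ (@Num.sqrt R)).
    by apply: continuous_measurable_fun; exact: sqrt_continuous.
  by apply: measurable_funD; exact: measurable_funX.
apply/funext => x; rewrite -cmod2E; case: (f x) => a b /=.
by rewrite sqrtr_sqr ger0_norm// sqrtr_ge0.
Qed.

Lemma complex_measurable_comp d' (T' : measurableType d') (h : T' -> T) f :
  measurable_fun setT h -> complex_measurable f ->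
  complex_measurable (fun x => f (h x)).
Proof.
by move=> mh [mR mI]; split;
  [exact: (measurableT_comp mR mh)|exact: (measurableT_comp mI mh)].
Qed.

End ComplexMeasurable.

Section L2Hilbert.
Context d (T : measurableType d) (R : realType).
Variables (mu : {measure set T -> \bar R}) (N : nat).
Local Notation H := (L2 mu N).
Local Notation V := 'cV[R[i]]_N.
Local Notation l2 := (square_integrable mu).

Definition l2_inner (u v : H) : R := complex.Re (L2_dot u v).

Lemma sqnorm_integrable (f : T -> V) : l2 f ->
  mu.-integrable setT (EFin \o (fun x => sqnorm (f x))).
Proof.
move=> [mf If]; apply/integrableP; split; first exact: measurable_sqnorm.
rewrite (eq_integral (fun x => (sqnorm (f x))%:E))// => x _ /=.
by rewrite ger0_norm// sqnorm_ge0.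
Qed.

Definition inner_term (i : 'I_N) (f g : T -> V) (x : T) : R :=
  complex.Re (f x i 0 * (g x i 0)^*%C).

Lemma inner_term_measurable i f g : l2 f -> l2 g ->
  measurable_fun setT (inner_term i f g).
Proof.
move=> [mf _] [mg _].
by have [] := complex_measurableM (mf i) (complex_measurable_conj (mg i)).
Qed.

Lemma inner_term_integrable i f g : l2 f -> l2 g ->
  mu.-integrable setT (EFin \o inner_term i f g).
Proof.
move=> lf lg.
apply: (@le_integrable _ _ _ _ _ _ _
    ((EFin \o (fun x => sqnorm (f x))) \+ (EFin \o (fun x => sqnorm (g x))))%E).
- exact: measurableT.
- by apply/measurable_EFinP; exact: inner_term_measurable.
- move=> x _ /=; rewrite lee_fin [leRHS]ger0_norm ?addr_ge0 ?sqnorm_ge0//.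
  have hi (h : T -> V) : cmod (h x i 0) ^+ 2 <= sqnorm (h x).
    by rewrite /sqnorm (bigD1 i)//= lerDl sumr_ge0// => j _; exact: sqr_ge0.
  apply: le_trans (lerD (hi f) (hi g)); rewrite !cmod2E /inner_term.
  case: (f x i 0) => a b; case: (g x i 0) => c e /=.
  rewrite ler_norml.
  have := sqr_ge0 (a - c); have := sqr_ge0 (a + c).
  have := sqr_ge0 (b - e); have := sqr_ge0 (b + e).
  move=> *; apply/andP; split; nra.
- by apply: integrableD => //; exact: sqnorm_integrable.
Qed.

Let lu (u : H) : l2 u := L2_fun_square_integrable u.

Lemma inner_ae_eq (u v : H) f g : l2 f -> l2 g -> (u : T -> V) = f %[ae mu] ->
  (v : T -> V) = g %[ae mu] ->
  \sum_i \int[mu]_x inner_term i u v x = \sum_i \int[mu]_x inner_term i f g x :> R.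
Proof.
move=> lf lg uf vg; apply: eq_bigr => i _; congr fine.
apply: ae_eq_integral => //.
- apply/measurable_EFinP; apply: inner_term_measurable; exact: lu.
- by apply/measurable_EFinP; exact: inner_term_measurable.
- move: uf vg; apply: filterS2 => x /= e1 e2 _.
  by rewrite /inner_term (e1 I) (e2 I).
Qed.

Lemma l2_innerE u v : l2_inner u v = \sum_i \int[mu]_x inner_term i u v x.
Proof.
rewrite /l2_inner /L2_dot (big_morph (@complex.Re R) (@complex_ReD R) erefl).
by apply: eq_bigr.
Qed.

Lemma l2_inner_self u : (l2_inner u u)%:E = (\int[mu]_x (sqnorm (u x))%:E)%E.
Proof.
rewrite l2_innerE.
have E x : sqnorm (u x) = \sum_i inner_term i u u x.
  apply: eq_bigr => i _; rewrite cmod2E /inner_term.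
  by case: (u x i 0) => a b /=; ring.
under eq_integral do rewrite E -sumEFin.
rewrite ge0_integral_sum//.
- rewrite -sumEFin; apply: eq_bigr => i _; rewrite /Rintegral fineK//.
  by apply: integrable_fin_num => //; exact: inner_term_integrable.
- by move=> i; apply/measurable_EFinP; exact: inner_term_measurable.
- move=> i x _; rewrite lee_fin /inner_term.
  by case: (u x i 0) => a b /=; rewrite mulrN opprK addr_ge0// -expr2 sqr_ge0.
Qed.

Lemma l2_inner_real_inner_product : real_inner_product l2_inner.
Proof.
split.
- move=> u v w; rewrite !l2_innerE.
  rewrite (inner_ae_eq (square_integrableD (lu u) (lu v)) (lu w) (L2_addE u v)
    (ae_eq_refl _ _ _)).
  rewrite -big_split; apply: eq_bigr => i _ /=.
  rewrite -RintegralD//; try exact: inner_term_integrable.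
  by apply: eq_Rintegral => x _; rewrite /inner_term !mxE mulrDl complex_ReD.
- move=> u v; rewrite !l2_innerE; apply: eq_bigr => i _.
  apply: eq_Rintegral => x _; rewrite /inner_term.
  by case: ((u : H) x i 0) ((v : H) x i 0) => [a b] [c e] /=; ring.
- move=> a u v; rewrite !l2_innerE.
  rewrite (inner_ae_eq (square_integrableZ a (lu u)) (lu v) (L2_scaleE a u)
    (ae_eq_refl _ _ _)).
  rewrite (inner_ae_eq (lu u) (square_integrableZ (a^*%C) (lu v))
    (ae_eq_refl _ _ _) (L2_scaleE _ v)).
  apply: eq_bigr => i _; apply: eq_Rintegral => x _; rewrite /inner_term !mxE.
  by case: a ((u : H) x i 0) ((v : H) x i 0) => [a1 a2] [b c] [e f] /=; ring.
- move=> r u v; rewrite !l2_innerE.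
  rewrite (inner_ae_eq (square_integrableZ (r%:C)%C (lu u)) (lu v) (L2_scaleE _ u)
    (ae_eq_refl _ _ _)).
  rewrite mulr_sumr; apply: eq_bigr => i _.
  rewrite -RintegralZl//; last exact: inner_term_integrable.
  apply: eq_Rintegral => x _; rewrite /inner_term !mxE.
  by case: ((u : H) x i 0) ((v : H) x i 0) => [b c] [e f] /=; ring.
- move=> u; rewrite -lee_fin l2_inner_self.
  by apply: integral_ge0 => x _; rewrite lee_fin sqnorm_ge0.
Qed.

Lemma L2_normE u : L2_norm u = dnorm l2_inner u.
Proof.
by rewrite /L2_norm /dnorm /Rintegral -l2_inner_self.
Qed.

Lemma l2_inner_definite u : l2_inner u u = 0 -> u = 0.
Proof.
move=> u0; have := l2_inner_self u; rewrite u0 => /esym.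
have -> : (\int[mu]_x (sqnorm (u x))%:E = \int[mu]_x `|(sqnorm (u x))%:E|)%E.
  by apply: eq_integral => x _; rewrite gee0_abs// lee_fin sqnorm_ge0.
move=> /ae_eq_integral_abs => /(_ measurableT (measurable_sqnorm (lu u).1)) h.
apply: L2_eqP; move: h (L2_zeroE mu N); apply: filterS2 => x /= h1 h2 _.
rewrite (h2 I); have := h1 I => -[] s0.
apply/matrixP => i j; rewrite (ord1 j) mxE.
have /eqP := s0; rewrite psumr_eq0; last by move=> k _; exact: sqr_ge0.
move=> /allP/(_ i (mem_index_enum _)); rewrite sqrf_eq0 => /eqP.
exact: ComplexField.Normc.eq0_normc.
Qed.

End L2Hilbert.

Lemma geometric_sum_le (R : realType) (q : R) n : 0 < q -> q < 1 ->
  \sum_(i < n) q ^+ i <= (1 - q)^-1.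
Proof.
move=> q0 q1; rewrite -[leRHS]div1r ler_pdivlMr ?subr_gt0//.
suff -> : (\sum_(i < n) q ^+ i) * (1 - q) = 1 - q ^+ n.
  by rewrite gerBl exprn_ge0// ltW.
elim: n => [|n IH]; first by rewrite big_ord0 expr0 mul0r subrr.
by rewrite big_ord_recr /= mulrDl IH exprS; ring.
Qed.

Lemma geometric_series_tail (R : realType) (a : nat -> R) (M q : R) :
    0 < q -> q < 1 -> 0 <= M -> (forall n, `|a n| <= M * q ^+ n) ->
  cvgn (series a) /\
  forall n, `|limn (series a) - \sum_(i < n) a i| <= M * q ^+ n / (1 - q).
Proof.
move=> q0 q1 M0 aM; have cva : cvgn (series a).
  apply: normed_cvg; apply: (@series_le_cvg _ _ (geometric M q)) => //.
  - by move=> n /=.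
  - by move=> n; rewrite /= mulr_ge0// exprn_ge0// ltW.
  - by apply: is_cvg_geometric_series; rewrite gtr0_norm.
split=> // n.
have tail m : (n <= m)%N ->
    `|series a m - \sum_(i < n) a i| <= M * q ^+ n / (1 - q).
  move=> nm; rewrite /series /= -(big_mkord xpredT a).
  rewrite (big_cat_nat (leq0n n) nm) /= addrAC subrr add0r.
  rewrite (le_trans (ler_norm_sum _ _ _))//.
  apply: (@le_trans _ _ (\sum_(n <= i < m) M * q ^+ i)).
    by apply: ler_sum => i _; exact: aM.
  rewrite -mulr_sumr -[X in M * X](_ : q ^+ n * \sum_(i < m - n) q ^+ i = _).
    rewrite mulrA ler_wpM2l ?mulr_ge0 ?exprn_ge0 ?(ltW q0)//.
    exact: geometric_sum_le.
  rewrite mulr_sumr -[n in RHS]add0n big_addn big_mkord.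
  by apply: eq_bigr => i _; rewrite -exprD addnC.
have cvd : `|series a m - \sum_(i < n) a i| @[m --> \oo] -->
    `|limn (series a) - \sum_(i < n) a i|.
  by apply: cvg_norm; apply: cvgB => //; exact: cvg_cst.
rewrite -(cvg_lim (@Rhausdorff R) cvd).
apply: limr_le; first by apply/cvg_ex; eexists; exact: cvd.
by exists n => // m /= /tail.
Qed.

Section L2Complete.
Context d (T : measurableType d) (R : realType).
Variables (mu : {measure set T -> \bar R}) (N : nat).
Local Notation H := (L2 mu N).
Local Notation V := 'cV[R[i]]_N.
Local Notation nm := (dnorm (@l2_inner d T R mu N)).

Lemma sqr_l2_norm (u : H) : ((nm u ^+ 2)%:E = \int[mu]_x (sqnorm (u x))%:E)%E.
Proof. by rewrite (sqr_dnorm (l2_inner_real_inner_product mu N)) l2_inner_self. Qed.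

Lemma L2_sum_ae (e : nat -> H) n :
  ((\sum_(i < n) e i : H) : T -> V) = (fun x => \sum_(i < n) e i x) %[ae mu].
Proof.
elim: n => [|n IH].
  rewrite big_ord0; move: (L2_zeroE mu N); apply: filterS => x /= h _.
  by rewrite big_ord0 -(h I).
rewrite big_ord_recr /=; move: IH (L2_addE (\sum_(i < n) e i) (e n)).
apply: filterS2 => x /= h1 h2 _.
by rewrite big_ord_recr /= -(h1 I) -(h2 I).
Qed.

Lemma L2_sub_ae (u v : H) : ((u - v : H) : T -> V) = (fun x => u x - v x) %[ae mu].
Proof.
move: (L2_addE u (- v)) (L2_scaleE (-1) v).
by apply: filterS2 => x /= h1 h2 _; rewrite (h1 I) (h2 I) scaleN1r.
Qed.

(** By the monotone convergence theorem the weighted sum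
    [g = sum_n p^(-2n) |e_n|^2] is integrable, where [q <= p^2 < 1]. Hence
    [|e_n| <= p^n sqrt g] almost everywhere: the series converges pointwise, with
    a remainder of order [p^n sqrt g], and the square of this bound is
    integrable. *)
Lemma l2_geometric_series (e : nat -> H) (K q : R) : 0 < q -> q < 1 ->
    (forall n, nm (e n) <= K * q ^+ n) ->
  exists u : H, exists2 Kp : R * R, 0 < Kp.2 < 1 &
    forall n, nm (u - \sum_(i < n) e i) <= Kp.1 * Kp.2 ^+ n.
Proof.
move=> q0 q1 eK.
have K0 : 0 <= K.
  by have := eK 0%N; rewrite expr0 mulr1; apply: le_trans; exact: dnorm_ge0.
have [p [p0 p1 qp]] : exists p, [/\ 0 < p, p < 1 & q <= p ^+ 2].
  exists ((1 + q) / 2); split; [by rewrite divr_gt0// addr_gt0|lra|].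
  have := sqr_ge0 (1 - q); lra.
pose c n := (p ^+ 2)^-1 ^+ n.
have c0 n : 0 < c n by rewrite exprn_gt0// invr_gt0 exprn_gt0.
pose F n x := (c n * sqnorm (e n x))%:E.
have mE n : measurable_fun setT (fun x => (sqnorm (e n x))%:E).
  exact: measurable_sqnorm (L2_fun_square_integrable _).1.
have mF n : measurable_fun setT (F n).
  apply/measurable_EFinP; apply: measurable_funM => //.
  by apply/measurable_EFinP; exact: mE.
have F0 n x : (0 <= F n x)%E by rewrite lee_fin mulr_ge0 ?sqnorm_ge0// ltW.
pose g x := (\sum_(n <oo) F n x)%E.
have g0 x : (0 <= g x)%E by apply: nneseries_ge0 => n _ _; exact: F0.
have mg : measurable_fun setT g.
  by apply: ge0_emeasurable_sum => // n x _ _; exact: F0.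
have ig : (\int[mu]_x g x <= (K ^+ 2 / (1 - p ^+ 2))%:E)%E.
  rewrite integral_nneseries//.
  apply: lime_le.
    by apply: is_cvg_nneseries => n _ _; apply: integral_ge0 => x _; exact: F0.
  apply: nearW => n.
  apply: (@le_trans _ _ (\sum_(0 <= i < n) (K ^+ 2 * (p ^+ 2) ^+ i)%:E)%E).
    apply: lee_sum => i _; rewrite /F.
    under eq_integral do rewrite EFinM.
    rewrite ge0_integralZl_EFin//; last 2 first.
    - by move=> x _; rewrite lee_fin sqnorm_ge0.
    - exact: ltW.
    rewrite -sqr_l2_norm -EFinM lee_fin /c exprVn ler_pdivrMl ?exprn_gt0//.
    have h : nm (e i) <= K * (p ^+ 2) ^+ i.
      rewrite (le_trans (eK i))// ler_wpM2l//.
      by apply: lerXn2r; rewrite ?nnegrE ?sqr_ge0 ?(ltW q0).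
    rewrite (_ : _ * (K ^+ 2 * _) = (K * (p ^+ 2) ^+ i) ^+ 2); last by ring.
    by apply: lerXn2r; rewrite ?nnegrE ?dnorm_ge0 ?mulr_ge0 ?exprn_ge0 ?(ltW p0).
  rewrite sumEFin lee_fin -mulr_sumr ler_wpM2l ?sqr_ge0// big_mkord.
  by apply: geometric_sum_le; [exact: exprn_gt0|rewrite expr_lt1// ltW].
have g_int : mu.-integrable setT g.
  apply/integrableP; split => //.
  under eq_integral => x _ do rewrite gee0_abs//.
  by rewrite (le_lt_trans ig)// ltry.
pose D := [set x | (g x < +oo)%E].
have mD : measurable D.
  by rewrite -[D]setTI; exact: emeasurable_fun_infty_o.
have Dae : \forall x \ae mu, D x.
  have := integrable_ae measurableT g_int; apply: filterS => x /= /(_ I).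
  by rewrite ge0_fin_numE.
pose G x := fine (g x).
have G0 x : 0 <= G x by rewrite fine_ge0.
have Gx x : D x -> (G x)%:E = g x by move=> Dx; rewrite fineK// ge0_fin_numE.
have eG x n : D x -> sqnorm (e n x) <= (p ^+ n) ^+ 2 * G x.
  move=> Dx; have : (F n x <= g x)%E.
    apply: (@le_trans _ _ (\sum_(0 <= i < n.+1) F i x)%E).
      by rewrite big_nat_recr//= leeDr// sume_ge0.
    by apply: nneseries_lim_ge => i _ _; exact: F0.
  rewrite -(Gx _ Dx) lee_fin /c exprVn ler_pdivrMl ?exprn_gt0//.
  by rewrite -!exprM mulnC.
(* Set to 0 outside [D], the series converge everywhere, which makes their sums
   measurable. *)
pose aR (i : 'I_N) x n : R := \1_D x * complex.Re (e n x i 0).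
pose aI (i : 'I_N) x n : R := \1_D x * complex.Im (e n x i 0).
pose Mx x := \1_D x * Num.sqrt (G x).
have Mx0 x : 0 <= Mx x by rewrite mulr_ge0 ?sqrtr_ge0// indicE; case: (_ \in _).
have compG (t : R) x n : t ^+ 2 <= sqnorm (e n x) ->
    `|\1_D x * t| <= Mx x * p ^+ n.
  move=> te; rewrite /Mx indicE; have [xD|xD] := boolP (x \in D); last first.
    by rewrite !mul0r normr0.
  rewrite !mul1r -(ler_pXn2r (n := 2))//;
    rewrite ?nnegrE ?mulr_ge0 ?sqrtr_ge0 ?exprn_ge0 ?(ltW p0)//.
  rewrite real_normK ?num_real// exprMn sqr_sqrtr// mulrC.
  by rewrite (le_trans te)// eG//; exact/set_mem.
have comp (u : H) x i : cmod (u x i 0) ^+ 2 <= sqnorm (u x).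
  by rewrite /sqnorm (bigD1 i)//= lerDl sumr_ge0// => j _; exact: sqr_ge0.
have aRM i x n : `|aR i x n| <= Mx x * p ^+ n.
  apply: compG; apply: le_trans (comp _ _ i).
  by rewrite cmod2E lerDl sqr_ge0.
have aIM i x n : `|aI i x n| <= Mx x * p ^+ n.
  apply: compG; apply: le_trans (comp _ _ i).
  by rewrite cmod2E lerDr sqr_ge0.
pose U x : V := \col_i ((limn (series (aR i x))) +i* (limn (series (aI i x))))%C.
have mlim (a : T -> nat -> R) : (forall n, measurable_fun setT (a ^~ n)) ->
    (forall x, cvgn (series (a x))) ->
    measurable_fun setT (fun x => limn (series (a x))).
  move=> ma ca; apply: (@measurable_fun_cvg _ _ _ _ (fun n x => series (a x) n)).
  - move=> n; rewrite /series /=; apply: measurable_sum => i; exact: ma.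
  - by move=> x _; exact: ca.
have mU i : complex_measurable (fun x => U x i 0).
  have [mRn mIn] : (forall n, measurable_fun setT (fun x => complex.Re (e n x i 0)))
    /\ (forall n, measurable_fun setT (fun x => complex.Im (e n x i 0))).
    by split=> n; have [] := (L2_fun_square_integrable (e n)).1 i.
  split; under eq_fun do rewrite mxE /=; apply: mlim => [n|x].
  - by apply: measurable_funM => //; exact: measurable_indic.
  - exact: (geometric_series_tail p0 p1 (Mx0 x) (aRM i x)).1.
  - by apply: measurable_funM => //; exact: measurable_indic.
  - exact: (geometric_series_tail p0 p1 (Mx0 x) (aIM i x)).1.
(* [N] coordinates, each with a real and an imaginary part, and the
   square of the sum [(1 - p)^-1] of the geometric series. *)
pose C := N%:R * (2 / (1 - p) ^+ 2).
have C0 : 0 <= C.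
  by rewrite mulr_ge0// divr_ge0// sqr_ge0.
have tailU x n : sqnorm (U x - ((\1_D x)%:C)%C *: \sum_(i < n) e i x) <=
    C * (p ^+ n) ^+ 2 * G x.
  have -> : C * (p ^+ n) ^+ 2 * G x =
      \sum_(i < N) 2 * (Num.sqrt (G x) * p ^+ n / (1 - p)) ^+ 2.
    rewrite sumr_const card_ord -mulr_natl !exprMn sqr_sqrtr// exprVn /C.
    have p10 : 1 - p != 0 by rewrite subr_eq0 eq_sym lt_eqF.
    by field.
  apply: ler_sum => i _; rewrite cmod2E !mxE summxE.
  have MG : Mx x <= Num.sqrt (G x).
    by rewrite /Mx indicE; case: (_ \in _); rewrite ?mul1r ?mul0r ?sqrtr_ge0.
  have le2 (t : R) : `|t| <= Mx x * p ^+ n / (1 - p) ->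
      t ^+ 2 <= (Num.sqrt (G x) * p ^+ n / (1 - p)) ^+ 2.
    move=> ht; rewrite -real_normK ?num_real//.
    have ht' : `|t| <= Num.sqrt (G x) * p ^+ n / (1 - p).
      rewrite (le_trans ht)// ler_wpM2r ?invr_ge0 ?subr_ge0 ?(ltW p1)//.
      by rewrite ler_wpM2r// exprn_ge0// ltW.
    apply: lerXn2r; rewrite ?nnegrE//.
    exact: le_trans ht'.
  rewrite mulr_natl mulr2n; apply: lerD; apply: le2.
    rewrite complex_ReD.
    have -> : complex.Re (- (((\1_D x)%:C)%C * \sum_(j < n) e j x i 0)) =
        - \sum_(j < n) aR i x j.
      rewrite mulr_sumr -sumrN (big_morph _ (@complex_ReD R) erefl) -sumrN.
      apply: eq_bigr => j _; rewrite /aR; case: (e j x i 0) => a b /=; ring.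
    exact: (geometric_series_tail p0 p1 (Mx0 x) (aRM i x)).2.
  rewrite complex_ImD.
  have -> : complex.Im (- (((\1_D x)%:C)%C * \sum_(j < n) e j x i 0)) =
      - \sum_(j < n) aI i x j.
    rewrite mulr_sumr -sumrN (big_morph _ (@complex_ImD R) erefl) -sumrN.
    apply: eq_bigr => j _; rewrite /aI; case: (e j x i 0) => a b /=; ring.
  exact: (geometric_series_tail p0 p1 (Mx0 x) (aIM i x)).2.
have mG : measurable_fun setT G by exact: measurableT_comp.
have iG : (\int[mu]_x (G x)%:E <= (K ^+ 2 / (1 - p ^+ 2))%:E)%E.
  apply: le_trans ig; apply: ge0_le_integral => //.
  - by move=> x _; rewrite lee_fin.
  - exact/measurable_EFinP.
  - by move=> x _; rewrite /G; case: (g x) (g0 x) => [r| |] //= _; rewrite leey.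
have intC n : (\int[mu]_x (C * (p ^+ n) ^+ 2 * G x)%:E <=
    (C * (p ^+ n) ^+ 2 * (K ^+ 2 / (1 - p ^+ 2)))%:E)%E.
  under eq_integral do rewrite EFinM.
  rewrite ge0_integralZl_EFin//; last 3 first.
  - by move=> x _; rewrite lee_fin.
  - exact/measurable_EFinP.
  - by rewrite mulr_ge0// sqr_ge0.
  by rewrite [leRHS]EFinM lee_wpmul2l// lee_fin mulr_ge0// sqr_ge0.
have mCG n : measurable_fun setT (fun x => (C * (p ^+ n) ^+ 2 * G x)%:E).
  by apply/measurable_EFinP; apply: measurable_funM.
have lU : square_integrable mu U.
  split=> //; apply: (le_lt_trans _ (ltry (C * (p ^+ 0) ^+ 2 * (K ^+ 2 / (1 - p ^+ 2))))).
  apply: le_trans (intC 0%N); apply: ge0_le_integral => //.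
  - by move=> x _; rewrite lee_fin sqnorm_ge0.
  - exact: measurable_sqnorm.
  - move=> x _; rewrite lee_fin; have := tailU x 0%N.
    by rewrite big_ord0 scaler0 subr0.
pose u : H := L2_class lU.
exists u, (Num.sqrt (C * (K ^+ 2 / (1 - p ^+ 2))), p); first by rewrite /= p0.
move=> n /=.
have S0 : 0 <= C * (K ^+ 2 / (1 - p ^+ 2)).
  rewrite mulr_ge0// divr_ge0 ?sqr_ge0// subr_ge0.
  by rewrite expr_le1// ltW.
apply: le_dnorm.
- exact: l2_inner_real_inner_product.
- by rewrite mulr_ge0 ?sqrtr_ge0// exprn_ge0// ltW.
rewrite -lee_fin l2_inner_self exprMn sqr_sqrtr//.
rewrite -mulrA [X in (_ <= (_ * X)%:E)%E]mulrC mulrA.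
apply: le_trans (intC n).
apply: ae_ge0_le_integral => //.
- by move=> x _; rewrite lee_fin sqnorm_ge0.
- exact: measurable_sqnorm (L2_fun_square_integrable _).1.
- by move=> x _; rewrite lee_fin (le_trans _ (tailU x n))// sqnorm_ge0.
have := ae_and (L2_sub_ae u (\sum_(i < n) e i)) (L2_classE lU).
move=> h1; have h2 := L2_sum_ae e n.
apply: (filterS3 _ _ h1 h2 Dae) => x [a b] c' Dx _.
rewrite lee_fin (a I) (b I) (c' I); apply: le_trans (tailU x n).
by rewrite indicE mem_set// scale1r.
Qed.

Lemma l2_geometrically_complete : geometrically_complete (@l2_inner d T R mu N).
Proof. by move=> e K q; exact: l2_geometric_series. Qed.

End L2Complete.

Section L2Spectrum.
Context d (T : measurableType d) (R : realType).
Variables (mu : {measure set T -> \bar R}) (N : nat).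
Local Notation H := (L2 mu N).
Local Notation inner := (@l2_inner d T R mu N).
Implicit Types A : H -> H.

Let innerP := @l2_inner_real_inner_product d T R mu N.

Lemma normal_operator_pair A : normal_operator A ->
  exists S K, 0 < K /\ normal_pair inner A S K.
Proof.
move=> [[linA [M AM]] [S [[linS [M' SM']] adj comm]]].
exists S, (`|M| + `|M'| + 1); split.
  by rewrite ltr_wpDl// addr_ge0.
split=> //.
- by move=> u v; rewrite /l2_inner adj.
- move=> u; rewrite -!L2_normE; split.
    rewrite (le_trans (AM u))// ler_wpM2r ?sqrtr_ge0//.
    by rewrite (le_trans (ler_norm M))// -addrA lerDl addr_ge0.
  rewrite (le_trans (SM' u))// ler_wpM2r ?sqrtr_ge0//.
  by rewrite (le_trans (ler_norm M'))// addrAC lerDr addr_ge0.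
Qed.

(** Otherwise [A - z] would be bounded below by [c], hence invertible. *)
Lemma spectrum_approx A z c : normal_operator A -> spectrum A z -> 0 < c ->
  exists2 u, L2_norm u = 1 & L2_norm (A u - z *: u) < c.
Proof.
move=> nA sz c0; apply: contrapT => nex; apply: sz.
have [S [K [K0 ASn]]] := normal_operator_pair nA.
have [linA _ _ _ _] := ASn.
have low u : c * dnorm inner u <= dnorm inner (A u - z *: u).
  have [u0|u0] := ltP 0 (dnorm inner u); last first.
    have -> : dnorm inner u = 0 by apply/eqP; rewrite eq_le u0 dnorm_ge0.
    by rewrite mulr0 dnorm_ge0.
  apply: le_trans (lower_bound_nm innerP z u linA).
  rewrite ler_wpM2r ?dnorm_ge0//; apply: lb_le_inf.
    by eexists; eexists; [exact: (dnorm_normalize innerP u0)|reflexivity].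
  move=> _ [v v1 <-]; rewrite leNgt; apply/negP => hlt; apply: nex.
  by exists v; rewrite L2_normE.
have [_ _ _ _ bdz] := normal_pair_shift innerP z ASn.
have cz : 0 < K + cmod z.
  by rewrite ltr_wpDr//; case: (z) => a b /=; exact: sqrtr_ge0.
have [I [linI Ibd IA AI]] := normal_bounded_below_invertible innerP
  (@l2_geometrically_complete d T R mu N) (@l2_inner_definite d T R mu N)
  (normal_pair_shift innerP z ASn) c0 cz low.
exists I; split; [|exact: IA|exact: AI].
by split=> //; exists c^-1 => u; rewrite !L2_normE.
Qed.

(** A bounded inverse of [A - z] would bound [A - z] from below. *)
Lemma approx_spectrum A z :
  (forall c, 0 < c -> exists2 u, L2_norm u = 1 & L2_norm (A u - z *: u) < c) ->
  spectrum A z.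
Proof.
move=> h [S [[linS [M SM]] SA _]].
have M0 : 0 < (`|M| + 1)^-1 by rewrite invr_gt0 ltr_wpDl.
have [u u1 uM] := h _ M0.
have := SM (A u - z *: u); rewrite SA u1 leNgt => /negP; apply.
apply: (@le_lt_trans _ _ (`|M| * L2_norm (A u - z *: u))).
  by rewrite ler_wpM2r ?sqrtr_ge0// ler_norm.
apply: (@le_lt_trans _ _ (`|M| * (`|M| + 1)^-1)).
  by rewrite ler_wpM2l// ltW.
by rewrite ltr_pdivrMr ?ltr_wpDl// mul1r ltrDl.
Qed.

Lemma near_spectrum A z u B : normal_operator A -> 0 < L2_norm u ->
    L2_norm (A u - z *: u) <= B * L2_norm u ->
  exists2 w, spectrum A w & cmod (w - z) <= 4 * B.
Proof.
move=> nA; rewrite !L2_normE => u0 uB.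
have [S [K [K0 ASn]]] := normal_operator_pair nA.
have [w wz wlow] := approx_eigenvalue_near innerP ASn K0 u0 uB.
exists w => //; apply: approx_spectrum => c /wlow[v v1 vc].
by exists v; rewrite L2_normE.
Qed.

End L2Spectrum.

(** * Integration on the group *)

Section Borel.
Context (R : realType).

Lemma open_borel (T : ptopologicalType) (U : set T) : open U ->
  measurable (U : set (borel T)).
Proof. by move=> oU; exact: sub_sigma_algebra. Qed.

Lemma borel_measurable_fun d (T : measurableType d) (S : ptopologicalType)
    (f : T -> S) : (forall U, open U -> measurable (f @^-1` U)) ->
  measurable_fun setT (f : T -> borel S).
Proof.
move=> mf; apply: (@measurability _ _ T (borel S) setT f (@open S)) => //.
by move=> _ [U oU <-]; rewrite setTI; exact: mf.
Qed.

(** Unlike [borel_measurable_fun], for the measurable structure that the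
    integral uses on the target [R]. *)
Lemma real_measurable_fun d (T : measurableType d) (f : T -> R) :
  (forall U, open U -> measurable (f @^-1` U)) -> measurable_fun setT f.
Proof.
move=> mf; apply: (measurability _ (RGenOpens.measurableE R)).
move=> _ [_ [a [b ->] <-]]; rewrite setTI; apply: mf; exact: interval_open.
Qed.

Lemma continuous_borel (S S' : ptopologicalType) (f : S -> S') : continuous f ->
  measurable_fun setT (f : borel S -> borel S').
Proof.
move=> /continuousP cf; apply: borel_measurable_fun => U /cf.
exact: open_borel.
Qed.

Lemma continuous_borel_real (S : ptopologicalType) (f : S -> R) : continuous f ->
  measurable_fun setT (f : borel S -> R).
Proof.
move=> /continuousP cf; apply: real_measurable_fun => U /cf.
exact: open_borel.
Qed.

Lemma countable_bigcup_measurable d (T : measurableType d) (I : Type)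
    (D : set I) (F : I -> set T) : countable D ->
  (forall i, D i -> measurable (F i)) -> measurable (\bigcup_(i in D) F i).
Proof.
move=> /countable_injP[f injf] mF.
pose E n := [set i | D i /\ f i = n].
have -> : \bigcup_(i in D) F i = \bigcup_n \bigcup_(i in E n) F i.
  apply/seteqP; split=> [x [i Di Fx]|x [n _ [i [Di _] Fx]]].
    by exists (f i) => //; exists i.
  by exists i.
apply: bigcupT_measurable => n.
have [->|/set0P[i [Di fi]]] := eqVneq (E n) set0; first by rewrite bigcup_set0.
have -> : E n = [set i].
  apply/seteqP; split=> [j [Dj fj]|_ -> //=].
  by apply: injf; rewrite ?inE// fi.
by rewrite bigcup_set1; exact: mF.
Qed.

(** Second countability makes every open set a countable union of rectangles. *)
Lemma open_prod_borel (S : ptopologicalType) (U : set (S * S)) :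
  @second_countable S -> open U -> measurable (U : set (borel S * borel S)).
Proof.
move=> [B cB [oB bB]] oU.
pose I := [set p : set S * set S | [/\ B p.1, B p.2 & p.1 `*` p.2 `<=` U]].
have cI : countable I.
  apply: (@sub_countable _ _ _ (B `*` B)); last exact: countableX.
  by apply: subset_card_le => p [].
have -> : U = \bigcup_(p in I) (p.1 `*` p.2).
  apply/seteqP; split; last by move=> x [p [_ _ h]] /h.
  case=> x y Uxy; have /= : nbhs (x, y) U by exact: open_nbhs_nbhs.
  case=> -[P Q] /= [/bB[P' [BP' P'x] P'P] /bB[Q' [BQ' Q'y] Q'Q]] PQ.
  exists (P', Q'); last by split.
  split=> //= -[a b] [/= /P'P Pa /Q'Q Qb]; exact: PQ.
apply: countable_bigcup_measurable => // p [B1 B2 _].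
by apply: measurableX; apply: open_borel; exact: oB.
Qed.

Lemma continuous_prod_borel (S S' : ptopologicalType) (f : S * S -> S') :
  @second_countable S -> continuous f ->
  measurable_fun setT (f : borel S * borel S -> borel S').
Proof.
move=> cS /continuousP cf; apply: borel_measurable_fun => U /cf.
exact: open_prod_borel.
Qed.

End Borel.

Section Translation.
Context (R : realType) (G : topologicalGroupType).
Variable m : {measure set (borel G) -> \bar R}.
Hypothesis uni : unimodular m.
Implicit Types f : borel G -> \bar R.

Lemma mulg_borel (a : G) : measurable_fun setT (fun g : borel G => (a * g)%g : borel G).
Proof.
apply: continuous_borel => g.
apply: (@continuous_comp _ _ _ (fun g => (a, g)) (fun p : G * G => (p.1 * p.2)%g)).
  by apply: cvg_pair => /=; [exact: cvg_cst|exact: cvg_id].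
exact: mulg_continuous.
Qed.

Lemma mulgr_borel (a : G) : measurable_fun setT (fun g : borel G => (g * a)%g : borel G).
Proof.
apply: continuous_borel => g.
apply: (@continuous_comp _ _ _ (fun g => (g, a)) (fun p : G * G => (p.1 * p.2)%g)).
  by apply: cvg_pair => /=; [exact: cvg_id|exact: cvg_cst].
exact: mulg_continuous.
Qed.

(** The measure agrees with its image under a translation. *)
Lemma integral_mulgl (a : G) f : measurable_fun setT f -> (forall g, 0 <= f g)%E ->
  (\int[m]_g f (a * g)%g = \int[m]_g f g)%E.
Proof.
move=> mf f0.
have -> : (\int[m]_g f g =
    \int[pushforward m (fun g : borel G => (a * g)%g : borel G)]_g f g)%E.
  apply: eq_measure_integral => [|mphi A mA _]; first exact: mulg_borel.
  rewrite /pushforward /=.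
  rewrite -[LHS](uni (a^-1)%g mA).1; congr (m _).
  apply/seteqP; split=> [_ [g Ag <-]|g /= Ag]; first by rewrite /= mulVKg.
  by exists (a * g)%g => //; rewrite mulKg.
rewrite (ge0_integral_pushforward (mulg_borel a))//.
Qed.

Lemma integral_mulgr (a : G) f : measurable_fun setT f -> (forall g, 0 <= f g)%E ->
  (\int[m]_g f (g * a)%g = \int[m]_g f g)%E.
Proof.
move=> mf f0.
have -> : (\int[m]_g f g =
    \int[pushforward m (fun g : borel G => (g * a)%g : borel G)]_g f g)%E.
  apply: eq_measure_integral => [|mphi A mA _]; first exact: mulgr_borel.
  rewrite /pushforward /=.
  rewrite -[LHS](uni (a^-1)%g mA).2; congr (m _).
  apply/seteqP; split=> [_ [g Ag <-]|g /= Ag]; first by rewrite /= mulgVK.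
  by exists (g * a)%g => //; rewrite mulgK.
rewrite (ge0_integral_pushforward (mulgr_borel a))//.
Qed.

End Translation.

Section CauchySchwarz.
Context d (T : measurableType d) (R : realType).
Variable mu : {measure set T -> \bar R}.
Local Open Scope ereal_scope.

(** Integrate [2 f <= t + f^2 / t] against [k] and choose [t = I / A] for
    [I = int k f]. As [k] is extended-valued, this avoids its square root. *)
Lemma integral_cauchy_schwarz (k : T -> \bar R) (f : T -> R) (A : R) :
    measurable_fun setT k -> measurable_fun setT f ->
    (forall x, 0 <= k x) -> (forall x, 0 <= f x)%R -> (0 < A)%R ->
    \int[mu]_x k x <= A%:E ->
  (\int[mu]_x (k x * (f x)%:E)) ^+ 2 <=
  A%:E * \int[mu]_x (k x * (f x ^+ 2)%:E).
Proof.
move=> mk mf k0 f0 A0 kA.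
set I := \int[mu]_x (k x * (f x)%:E); set b := \int[mu]_x (k x * _).
have mkf (h : T -> R) : measurable_fun setT h ->
    measurable_fun setT (fun x => k x * (h x)%:E).
  by move=> mh; apply: emeasurable_funM => //; exact/measurable_EFinP.
have mf2 : measurable_fun setT (fun x => f x ^+ 2)%R by exact: measurable_funX.
have I0 : 0 <= I by apply: integral_ge0 => x _; rewrite mule_ge0 ?lee_fin.
have b0 : 0 <= b.
  by apply: integral_ge0 => x _; rewrite mule_ge0 ?lee_fin ?sqr_ge0.
have [boo|bfin] := eqVneq b +oo.
  by rewrite boo gt0_muley ?lte_fin// leey.
have key (t : R) : (0 < t)%R -> 2%:E * I <= (t * A)%:E + t^-1%:E * b.
  move=> t0.
  have -> : 2%:E * I = \int[mu]_x (2%:E * (k x * (f x)%:E)).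
    by rewrite ge0_integralZl//; [exact: mkf|move=> x _; rewrite mule_ge0 ?lee_fin].
  apply: (@le_trans _ _ (\int[mu]_x (t%:E * k x + t^-1%:E * (k x * (f x ^+ 2)%:E)))).
    apply: ge0_le_integral => //.
    - by move=> x _; rewrite !mule_ge0 ?lee_fin.
    - by apply: measurable_funeM; exact: mkf.
    - by apply: emeasurable_funD; apply: measurable_funeM => //; exact: mkf.
    - move=> x _; rewrite muleCA (muleC t%:E) (muleCA t^-1%:E) -!EFinM.
      rewrite -ge0_muleDr ?lee_fin ?(ltW t0)//; last first.
        by rewrite mulr_ge0 ?sqr_ge0// invr_ge0 ltW.
      rewrite lee_wpmul2l// -EFinD lee_fin -subr_ge0.
      have -> : (t + t^-1 * f x ^+ 2 - 2 * f x = t^-1 * (t - f x) ^+ 2)%R.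
        by field; rewrite gt_eqF.
      by rewrite mulr_ge0 ?sqr_ge0// invr_ge0 ltW.
  rewrite ge0_integralD//; last 4 first.
  - by move=> x _; rewrite mule_ge0// lee_fin ltW.
  - exact: measurable_funeM.
  - by move=> x _; rewrite !mule_ge0 ?lee_fin ?sqr_ge0// invr_ge0 ltW.
  - by apply: measurable_funeM; exact: mkf.
  rewrite !ge0_integralZl//; first last.
  - by rewrite lee_fin ltW.
  - by rewrite lee_fin invr_ge0 ltW.
  - by move=> x _; rewrite mule_ge0 ?lee_fin ?sqr_ge0.
  - exact: mkf.
  by rewrite EFinM leeD// lee_wpmul2l// lee_fin ltW.
have bE : b = (fine b)%:E by rewrite fineK// ge0_fin_numE// ltey.
have Ifin : I \is a fin_num.
  rewrite ge0_fin_numE//; have := key 1%R ltr01.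
  rewrite bE -EFinM -EFinD => h.
  rewrite ltey; apply/eqP => Ioo; move: h.
  by rewrite Ioo mulry gtr0_sg// mul1e.
rewrite bE -(fineK Ifin) -EFin_expe -EFinM lee_fin.
have {}key (t : R) : (0 < t)%R -> (2 * fine I <= t * A + t^-1 * fine b)%R.
  by move=> /key; rewrite bE -{1}(fineK Ifin) -!EFinM -EFinD lee_fin.
have [fI0|fI0] := ltP 0%R (fine I); last first.
  have -> : fine I = 0%R by apply/eqP; rewrite eq_le fI0 fine_ge0.
  by rewrite expr0n /= mulr_ge0 ?fine_ge0// ltW.
have := key (fine I / A)%R (divr_gt0 fI0 A0).
rewrite mulfVK ?gt_eqF// invf_div => h.
have : (fine I <= A / fine I * fine b)%R by lra.
by rewrite mulrAC ler_pdivlMr// expr2.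
Qed.

End CauchySchwarz.

Section Convolution.
Context (R : realType) (G : topologicalGroupType).
Variable m : {sigma_finite_measure set (borel G) -> \bar R}.
Hypothesis cG : @second_countable G.
Hypothesis uni : unimodular m.
Local Open Scope ereal_scope.
Implicit Types (k w : borel G -> \bar R) (f : borel G -> R).

Lemma mulg_prod_borel : measurable_fun setT
  (fun p : borel G * borel G => (p.1 * p.2)%g : borel G).
Proof. by apply: continuous_prod_borel => //; exact: mulg_continuous. Qed.

Let mtrans d (S : measurableType d) (h : borel G -> S) : measurable_fun setT h ->
  measurable_fun setT (fun p : borel G * borel G => h (p.1 * p.2)%g).
Proof. by move=> mh; exact: measurableT_comp mh mulg_prod_borel. Qed.

Let msnd d (S : measurableType d) (h : borel G -> S) : measurable_fun setT h ->
  measurable_fun setT (fun p : borel G * borel G => h p.2).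
Proof. by move=> mh; exact: measurableT_comp mh measurable_snd. Qed.

Lemma measurable_convolution k w : measurable_fun setT k -> measurable_fun setT w ->
  (forall u, 0 <= k u) -> (forall u, 0 <= w u) ->
  measurable_fun setT (fun g : borel G => \int[m]_u (k u * w (g * u)%g)).
Proof.
move=> mk mw k0 w0.
apply: (measurable_fun_fubini_tonelli_F
  (fun p : borel G * borel G => k p.2 * w (p.1 * p.2)%g)).
  by apply: emeasurable_funM; [exact: msnd|exact: mtrans].
by move=> p; rewrite mule_ge0.
Qed.

(** Tonelli's theorem, then right invariance in [g] for fixed [u]. *)
Lemma integral_convolution k w : measurable_fun setT k -> measurable_fun setT w ->
  (forall u, 0 <= k u) -> (forall u, 0 <= w u) ->
  \int[m]_g \int[m]_u (k u * w (g * u)%g) = \int[m]_u k u * \int[m]_g w g.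
Proof.
move=> mk mw k0 w0.
rewrite (fubini_tonelli (fun p : borel G * borel G => k p.2 * w (p.1 * p.2)%g))/=.
- rewrite -ge0_integralZr//; last exact: integral_ge0.
  apply: eq_integral => u _; rewrite ge0_integralZl//.
  + by rewrite (integral_mulgr uni).
  + exact: measurableT_comp mw (mulgr_borel u).
- by apply: emeasurable_funM; [exact: msnd|exact: mtrans].
- by move=> p; rewrite mule_ge0.
Qed.

(** The inner integral is estimated by the Cauchy-Schwarz inequality for the
    measure [k m], the outer one by [integral_convolution]. *)
Lemma schur_test k f (A : R) : measurable_fun setT k -> measurable_fun setT f ->
    (forall x, 0 <= k x) -> (forall x, 0 <= f x)%R -> (0 < A)%R ->
    \int[m]_x k x <= A%:E ->
  \int[m]_g (\int[m]_u (k u * (f (g * u)%g)%:E)) ^+ 2 <=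
  (A ^+ 2)%:E * \int[m]_g (f g ^+ 2)%:E.
Proof.
move=> mk mf k0 f0 A0 kA.
have mf2 : measurable_fun setT (fun g => (f g ^+ 2)%:E).
  by apply/measurable_EFinP; exact: measurable_funX.
have mfE : measurable_fun setT (fun g => (f g)%:E) by exact/measurable_EFinP.
apply: (@le_trans _ _ (\int[m]_g (A%:E * \int[m]_u (k u * (f (g * u)%g ^+ 2)%:E)))).
  apply: ge0_le_integral => //.
  - by move=> g _; rewrite sqre_ge0.
  - under eq_fun do rewrite expe2.
    have mkf : measurable_fun setT
        (fun g : borel G => \int[m]_u (k u * (f (g * u)%g)%:E)).
      by apply: (@measurable_convolution k (fun u => (f u)%:E)).
    exact: emeasurable_funM.
  - apply: measurable_funeM.
    apply: (@measurable_convolution k (fun u => (f u ^+ 2)%:E)) => // u /=.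
    by rewrite lee_fin sqr_ge0.
  - move=> g _; apply: integral_cauchy_schwarz => //.
    exact: measurableT_comp mf (mulg_borel g).
rewrite ge0_integralZl//; last 3 first.
- apply: (@measurable_convolution k (fun u => (f u ^+ 2)%:E)) => // u /=.
  by rewrite lee_fin sqr_ge0.
- by move=> g _; apply: integral_ge0 => u _; rewrite mule_ge0// lee_fin sqr_ge0.
- by rewrite lee_fin ltW.
rewrite (@integral_convolution k (fun u => (f u ^+ 2)%:E))//; last first.
  by move=> u /=; rewrite lee_fin sqr_ge0.
rewrite expr2 EFinM -muleA lee_wpmul2l ?lee_fin ?(ltW A0)//.
by rewrite lee_wpmul2r//; apply: integral_ge0 => g _; rewrite lee_fin sqr_ge0.
Qed.

End Convolution.

Section Averaging.
Context (R : realType) (G : topologicalGroupType) (dG : G -> G -> R).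
Variable m : {sigma_finite_measure set (borel G) -> \bar R}.
Hypothesis cG : @second_countable G.
Hypothesis uni : unimodular m.
Hypothesis adG : adapted_metric dG.
Local Open Scope ereal_scope.
Implicit Types (w : borel G -> \bar R).

Definition nearby (r : R) : set (borel G * borel G) :=
  [set p | (dG p.1 p.2 < r)%R].

Lemma measurable_nearby r : measurable (nearby r).
Proof.
have [_ [/continuousP cd _ _ _]] := adG.
exact: open_prod_borel cG (cd _ (@open_lt R r)).
Qed.

Lemma measurable_nearbyr r h : measurable [set g : borel G | (dG g h < r)%R].
Proof.
rewrite (_ : [set g | _] = ysection (nearby r) h).
  by apply: measurable_ysection; exact: measurable_nearby.
by apply/seteqP; split=> g /=; rewrite /ysection /= ?inE.
Qed.

Lemma measurable_gball r : measurable (gball dG r : set (borel G)).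
Proof.
rewrite (_ : gball dG r = xsection (nearby r) 1%g).
  by apply: measurable_xsection; exact: measurable_nearby.
by apply/seteqP; split=> g /=; rewrite /xsection /= ?inE.
Qed.

Lemma measure_nearbyr r h : m [set g : borel G | (dG g h < r)%R] = m (gball dG r).
Proof.
rewrite -[RHS](uni h (measurable_gball r)).1; congr (m _).
have [[_ _ sym _] [_ inv _ _]] := adG.
apply/seteqP; split=> [g /= gh|_ [g gr <-] /=].
  exists (h^-1 * g)%g; last by rewrite mulVKg.
  by rewrite /gball /= -(inv h) mulVKg mulg1 sym.
by rewrite sym -[X in dG X _]mulg1 inv.
Qed.

Definition local_mass (r : R) w (g : borel G) : \bar R :=
  \int[m]_h ((\1_(nearby r) (g, h))%:E * w h).

Let mind r : measurable_fun setT (fun p => (\1_(nearby r) p)%:E : \bar R).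
Proof. by apply/measurable_EFinP; apply: measurable_indic; exact: measurable_nearby. Qed.

Let ind0 r (p : borel G * borel G) : 0 <= (\1_(nearby r) p)%:E :> \bar R.
Proof. by rewrite lee_fin indicE; case: (_ \in _). Qed.

Let mprod r w : measurable_fun setT w -> measurable_fun setT
  (fun p : borel G * borel G => (\1_(nearby r) p)%:E * w p.2).
Proof.
move=> mw; apply: emeasurable_funM; first exact: mind.
exact: measurableT_comp mw measurable_snd.
Qed.

Lemma measurable_local_mass r w : measurable_fun setT w -> (forall h, 0 <= w h) ->
  measurable_fun setT (local_mass r w).
Proof.
move=> mw w0; apply: (measurable_fun_fubini_tonelli_F
  (fun p : borel G * borel G => (\1_(nearby r) p)%:E * w p.2)).
  exact: mprod.
by move=> p; rewrite mule_ge0.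
Qed.

Lemma local_mass_ge0 r w g : (forall h, 0 <= w h) -> 0 <= local_mass r w g.
Proof. by move=> w0; apply: integral_ge0 => h _; rewrite mule_ge0. Qed.

(** Exchange the integrals: every [h] is counted with the volume of the ball of
    radius [r] around it. *)
Lemma integral_local_mass r w : measurable_fun setT w -> (forall h, 0 <= w h) ->
  \int[m]_g local_mass r w g = m (gball dG r) * \int[m]_h w h.
Proof.
move=> mw w0.
rewrite (fubini_tonelli (fun p : borel G * borel G =>
  (\1_(nearby r) p)%:E * w p.2))/=; last 2 first.
- exact: mprod.
- by move=> p; rewrite mule_ge0.
rewrite -ge0_integralZl//; apply: eq_integral => h _.
rewrite ge0_integralZr//; last by apply: measurableT_comp (mind r) _.
have <- : \int[m]_g (\1_[set g : borel G | (dG g h < r)%R] g)%:E = m (gball dG r).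
  rewrite integral_indic//; last exact: measurable_nearbyr.
  by rewrite setIT; exact: measure_nearbyr.
by congr (_ * _); apply: eq_integral => g _; congr EFin.
Qed.

(** By [integral_local_mass], integrating the opposite inequality over [g] would
    give [a' m(B(r1)) int w <= m(B(r2)) int W <= a D m(B(r1)) int w], against
    [a D < a']. *)
Lemma exists_local_mass_lt r1 r2 w W (D a a' : R) :
    measurable_fun setT w -> (forall h, 0 <= w h) ->
    measurable_fun setT W -> (forall h, 0 <= W h) ->
    0 < m (gball dG r1) < +oo -> m (gball dG r2) <= D%:E * m (gball dG r1) ->
    0 < \int[m]_h w h < +oo -> \int[m]_h W h <= a%:E * \int[m]_h w h ->
    (0 <= a)%R -> (a * D < a')%R -> (0 <= D)%R ->
  exists g, local_mass r2 W g < a'%:E * local_mass r1 w g.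
Proof.
move=> mw w0 mW W0 /andP[m0 moo] mD /andP[iw0 iwoo] iW a0 aD D0.
apply: contrapT => nex.
have h g : a'%:E * local_mass r1 w g <= local_mass r2 W g.
  by rewrite leNgt; apply/negP => hg; apply: nex; exists g.
have a'0 : (0 <= a')%R by rewrite ltW// (le_lt_trans _ aD)// mulr_ge0.
have : \int[m]_g (a'%:E * local_mass r1 w g) <= \int[m]_g local_mass r2 W g.
  apply: ge0_le_integral => //.
  - by move=> g _; rewrite mule_ge0 ?lee_fin// local_mass_ge0.
  - by apply: measurable_funeM; exact: measurable_local_mass.
  - exact: measurable_local_mass.
rewrite ge0_integralZl ?lee_fin//; last 2 first.
- exact: measurable_local_mass.
- by move=> g _; exact: local_mass_ge0.
rewrite !integral_local_mass// leNgt => /negP; apply.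
have mE : m (gball dG r1) = (fine (m (gball dG r1)))%:E.
  by rewrite fineK// ge0_fin_numE// ltW.
have wE : \int[m]_h w h = (fine (\int[m]_h w h))%:E.
  by rewrite fineK// ge0_fin_numE// ltW.
apply: (@le_lt_trans _ _ ((D%:E * m (gball dG r1)) * (a%:E * \int[m]_h w h))).
  by apply: lee_pmul => //; exact: integral_ge0.
move: m0 iw0; rewrite mE wE -!EFinM !lte_fin => m0 iw0.
rewrite mulrACA [ltRHS]mulrA (mulrC D) mulrA -[ltLHS]mulrA -[ltRHS]mulrA.
by rewrite ltr_pM2r// mulr_gt0.
Qed.

End Averaging.

Section Growth.
Context (R : realType) (G : topologicalGroupType) (dG : G -> G -> R).
Variable m : {measure set (borel G) -> \bar R}.

(** All that the proof retains of the growth of the group. *)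
Lemma polynomial_growth_doubling : strictly_polynomial_growth dG m ->
  exists2 D : R, 0 < D & forall r : R, 1 <= r ->
    (0 < m (gball dG r) < +oo /\
     m (gball dG (2 * r)%R) <= D%:E * m (gball dG r))%E.
Proof.
move=> [c0 [c1 [kappa [c0_gt0 c01 kappa0 h]]]].
have c10 : 0 < c1 by rewrite (lt_le_trans c0_gt0).
exists (c1 / c0 * 2 `^ kappa); first by rewrite !mulr_gt0 ?invr_gt0 ?powR_gt0.
move=> r r1; have r0 : 0 < r by rewrite (lt_le_trans _ r1).
have /andP[h1 h2] := h r r1.
split.
  apply/andP; split; last by rewrite (le_lt_trans h2)// ltry.
  by rewrite (lt_le_trans _ h1)// lte_fin mulr_gt0 ?powR_gt0.
have r2 : 1 <= 2 * r by lra.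
have /andP[_ h3] := h _ r2.
apply: (le_trans h3).
apply: (@le_trans _ _ ((c1 / c0 * 2 `^ kappa)%:E * (c0 * r `^ kappa)%:E)%E).
  rewrite -EFinM lee_fin powRM ?(ltW r0)// le_eqVlt; apply/orP; left; apply/eqP.
  by field; rewrite gt_eqF.
by rewrite lee_wpmul2l// lee_fin !mulr_ge0 ?invr_ge0 ?powR_ge0 ?ltW.
Qed.

(** The closed balls around the identity are compact. *)
Lemma proper_metric_sigma_finite : adapted_metric dG -> left_haar m ->
  sigma_finite setT m.
Proof.
move=> [[dge0 d0 sym tri] [cd inv cpt _]] [_ _ [mK _ _]].
pose F n : set G := [set h | dG 1%g h <= n%:R].
exists F.
  apply/seteqP; split=> // g _.
  exists (Num.bound (dG 1%g g)) => //=.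
  by rewrite /F /= ltW// archi_boundP.
move=> n; split; last exact: mK (cpt _ _).
rewrite -[F n]setCK; apply: measurableC; apply: open_borel.
rewrite (_ : ~` F n = (fun h => dG 1%g h) @^-1` [set x | n%:R < x]); last first.
  by apply/seteqP; split=> h /=; rewrite /F /= ltNge => /negP.
have cd1 : continuous (fun h : G => dG 1%g h).
  move=> h; apply: (@continuous_comp _ _ _ (fun h => (1%g, h))
    (fun p : G * G => dG p.1 p.2)).
    by apply: cvg_pair => /=; [exact: cvg_cst|exact: cvg_id].
  exact: cd.
by move/continuousP : cd1; apply; exact: open_gt.
Qed.

End Growth.

(** * Dynamically defined operators and their cut-offs *)

Section ComplexNorm.
Context (R : realType).
Implicit Types z w : R[i].

Lemma cmod_ge0 z : 0 <= cmod z.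
Proof. by case: z => a b /=; exact: sqrtr_ge0. Qed.

Lemma cmodM z w : cmod (z * w) = cmod z * cmod w.
Proof. exact: ComplexField.Normc.normcM. Qed.

Lemma cmodD z w : cmod (z + w) <= cmod z + cmod w.
Proof. exact: le_normcD. Qed.

Lemma cmodN z : cmod (- z) = cmod z.
Proof. by case: z => a b /=; rewrite !sqrrN. Qed.

Lemma cmod0 : cmod (0 : R[i]) = 0.
Proof. exact: ComplexField.Normc.normc0. Qed.

Lemma cmod_sum (I : Type) (s : seq I) (F : I -> R[i]) :
  cmod (\sum_(i <- s) F i) <= \sum_(i <- s) cmod (F i).
Proof.
elim: s => [|i s IH]; first by rewrite !big_nil cmod0.
by rewrite !big_cons (le_trans (cmodD _ _))// lerD2l.
Qed.

Lemma normr_Re_le z : `|complex.Re z| <= cmod z.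
Proof.
rewrite -(ler_pXn2r (n := 2)) ?nnegrE ?cmod_ge0//.
by rewrite real_normK ?num_real// cmod2E lerDl sqr_ge0.
Qed.

Lemma normr_Im_le z : `|complex.Im z| <= cmod z.
Proof.
rewrite -(ler_pXn2r (n := 2)) ?nnegrE ?cmod_ge0//.
by rewrite real_normK ?num_real// cmod2E lerDr sqr_ge0.
Qed.

Lemma cmod_real (r : R) : cmod (r%:C)%C = `|r|.
Proof. by rewrite /= expr0n /= addr0 sqrtr_sqr. Qed.

Lemma nbhs_cmod z (e : R) : 0 < e -> nbhs z [set w | cmod (z - w) < e].
Proof.
move=> e0; have e0' : (0 : R[i]) < (e%:C)%C by rewrite ltcR.
have := @nbhsx_ballx R[i] R[i]^o z ((e%:C)%C : R[i]) e0'.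
rewrite -(@ball_normE R[i] R[i]^o).
have -> : ball_ [eta @Num.norm R[i] R[i]^o] z (e%:C)%C = [set w | cmod (z - w) < e].
  apply/seteqP; split=> w; rewrite /ball_ /= => h.
    by rewrite -ltcR; apply: h.
  by rewrite -ltcR in h; apply: h.
by [].
Qed.

Context (N : nat).
Implicit Types (A B : 'M[R[i]]_N) (v : 'cV[R[i]]_N).

Definition l1norm v : R := \sum_j cmod (v j 0).

Lemma l1norm_ge0 v : 0 <= l1norm v.
Proof. by apply: sumr_ge0 => j _; exact: cmod_ge0. Qed.

Lemma sqr_l1norm v : l1norm v ^+ 2 <= N%:R * sqnorm v.
Proof.
rewrite expr2 /l1norm mulr_suml.
apply: (@le_trans _ _ (\sum_i \sum_j ((cmod (v i 0) ^+ 2 + cmod (v j 0) ^+ 2) / 2))).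
  apply: ler_sum => i _; rewrite mulr_sumr; apply: ler_sum => j _.
  have := sqr_ge0 (cmod (v i 0) - cmod (v j 0)); lra.
under eq_bigr do rewrite -mulr_suml big_split /= sumr_const card_ord.
rewrite -mulr_suml big_split /= sumr_const card_ord -/(sqnorm v).
by rewrite sumrMnl -/(sqnorm v) -(mulr_natl (sqnorm v)); lra.
Qed.

Lemma mxmax_norm_le A (c : R) : 0 <= c -> (forall i j, cmod (A i j) <= c) ->
  mxmax_norm A <= c.
Proof. by move=> c0 h; apply: bigmax_le => // i _; apply: bigmax_le. Qed.

Lemma le_mxmax_norm A i j : cmod (A i j) <= mxmax_norm A.
Proof.
rewrite /mxmax_norm (bigmaxD1 i)//= le_max; apply/orP; left.
by rewrite (bigmaxD1 j)//= le_max lexx.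
Qed.

Lemma mxmax_norm_ge0 A : 0 <= mxmax_norm A.
Proof. by apply: bigmax_ge_id. Qed.

Lemma mxmax_normB A B : mxmax_norm (A - B) <= mxmax_norm A + mxmax_norm B.
Proof.
apply: mxmax_norm_le; first by rewrite addr_ge0 ?mxmax_norm_ge0.
move=> i j; rewrite !mxE (le_trans (cmodD _ _))// cmodN.
by rewrite lerD// le_mxmax_norm.
Qed.

Lemma cmod_mulmx A v n : cmod ((A *m v) n 0) <= mxmax_norm A * l1norm v.
Proof.
rewrite mxE (le_trans (cmod_sum _ _))// /l1norm mulr_sumr.
apply: ler_sum => j _; rewrite cmodM ler_wpM2r ?cmod_ge0//.
exact: le_mxmax_norm.
Qed.

End ComplexNorm.

Section ComplexIntegral.
Context d (T : measurableType d) (R : realType).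
Variable mu : {measure set T -> \bar R}.
Implicit Types f g : T -> R[i].

Lemma normr_fine_integral (h : T -> R) : measurable_fun setT h ->
  (`|\int[mu]_x h x|%:E <= \int[mu]_x `|h x|%:E)%E.
Proof.
move=> mh; apply: (@le_trans _ _ `|\int[mu]_x (h x)%:E|%E).
  rewrite /Rintegral; case: (\int[mu]_x (h x)%:E)%E => [r| |] //=;
    by rewrite normr0 leey.
apply: le_abse_integral => //; exact/measurable_EFinP.
Qed.

(** The factor 2 comes from estimating the real and the imaginary part
    separately. *)
Lemma cmod_complex_integral f : complex_measurable f ->
  ((cmod (complex_integral mu f))%:E <= 2%:E * \int[mu]_x (cmod (f x))%:E)%E.
Proof.
move=> mf; have [mR mI] := mf; have mc := measurable_cmod mf.
have h (h : T -> R) : measurable_fun setT h -> (forall x, `|h x| <= cmod (f x)) ->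
    (`|\int[mu]_x h x|%:E <= \int[mu]_x (cmod (f x))%:E)%E.
  move=> mh hf; apply: (le_trans (normr_fine_integral mh)).
  apply: ge0_le_integral => //.
  - by apply/measurable_EFinP; exact: measurableT_comp.
  - exact/measurable_EFinP.
  - by move=> x _; rewrite lee_fin.
apply: (@le_trans _ _ (`|\int[mu]_x complex.Re (f x)|%:E +
    `|\int[mu]_x complex.Im (f x)|%:E)%E).
  by rewrite -EFinD lee_fin; exact: cmod_le_l1.
have -> : (2%:E : \bar R) = (1 + 1)%E by [].
rewrite ge0_muleDl// mul1e; apply: leeD; apply: h => //.
- by move=> x; exact: normr_Re_le.
- by move=> x; exact: normr_Im_le.
Qed.

Definition complex_integrable f : Prop :=
  mu.-integrable setT (EFin \o (fun x => complex.Re (f x))) /\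
  mu.-integrable setT (EFin \o (fun x => complex.Im (f x))).

Lemma finite_cmod_integrable f : complex_measurable f ->
  (\int[mu]_x (cmod (f x))%:E < +oo)%E -> complex_integrable f.
Proof.
move=> mf foo; have [mR mI] := mf; have mc := measurable_cmod mf.
have ic : mu.-integrable setT (EFin \o (fun x => cmod (f x))).
  apply/integrableP; split; first exact/measurable_EFinP.
  by under eq_integral => x _ do rewrite /= ger0_norm ?cmod_ge0//.
split; apply: le_integrable ic => //; try exact/measurable_EFinP.
- by move=> x _ /=; rewrite lee_fin [leRHS]ger0_norm ?cmod_ge0// normr_Re_le.
- by move=> x _ /=; rewrite lee_fin [leRHS]ger0_norm ?cmod_ge0// normr_Im_le.
Qed.

Lemma complex_integralB f g : complex_integrable f -> complex_integrable g ->
  complex_integral mu (fun x => f x - g x) =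
  complex_integral mu f - complex_integral mu g.
Proof.
move=> [fR fI] [gR gI]; rewrite /complex_integral.
apply/eqP; rewrite eq_complex /=; apply/andP; split; apply/eqP.
  rewrite -RintegralB//; apply: eq_Rintegral => x _.
  by case: (f x) (g x) => [a b] [c e].
rewrite -RintegralB//; apply: eq_Rintegral => x _.
by case: (f x) (g x) => [a b] [c e].
Qed.

Lemma complex_integralZ (r : R) f : complex_integrable f ->
  complex_integral mu (fun x => (r%:C)%C * f x) =
  (r%:C)%C * complex_integral mu f.
Proof.
move=> [fR fI]; rewrite /complex_integral.
apply/eqP; rewrite eq_complex /= !mul0r subr0 addr0.
rewrite -!RintegralZl//; apply/andP; split; apply/eqP;
  apply: eq_Rintegral => x _; case: (f x) => [a b] /=; ring.
Qed.

Lemma complex_integrableZ (r : R) f : complex_integrable f ->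
  complex_integrable (fun x => (r%:C)%C * f x).
Proof.
move=> [fR fI]; split.
- rewrite (_ : _ \o _ = (fun x => r%:E * (EFin \o (fun x => complex.Re (f x))) x)%E).
    exact: integrableZl.
  by apply/funext => x /=; case: (f x) => a b /=; rewrite mul0r subr0 EFinM.
- rewrite (_ : _ \o _ = (fun x => r%:E * (EFin \o (fun x => complex.Im (f x))) x)%E).
    exact: integrableZl.
  by apply/funext => x /=; case: (f x) => a b /=; rewrite mul0r addr0 EFinM.
Qed.

Lemma complex_integral_ae f g : complex_measurable f -> complex_measurable g ->
  f = g %[ae mu] -> complex_integral mu f = complex_integral mu g.
Proof.
move=> [fR fI] [gR gI] fg; congr Complex; congr fine;
  apply: ae_eq_integral => //; try exact/measurable_EFinP.
- by move: fg; apply: filterS => x /= h _; rewrite (h I).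
- by move: fg; apply: filterS => x /= h _; rewrite (h I).
Qed.

End ComplexIntegral.

Section OrbitSup.
Context (R : realType) (G : topologicalGroupType) (Z : pmetricType R).
Variables (m : {measure set (borel G) -> \bar R}) (tau : G -> Z -> Z) (N : nat).
Variable k : G -> Z -> 'M[R[i]]_N.
Hypothesis cG : @second_countable G.
Hypothesis sys : dynamical_system tau.
Hypothesis kb : bounded_kernel tau m k.

(** One point in every non-empty set of a countable base. *)
Lemma second_countable_dense_sequence (T : ptopologicalType) : @second_countable T ->
  exists s : nat -> T, forall U, open U -> U !=set0 -> exists n, U (s n).
Proof.
move=> [B /countable_injP[f finj] [oB bB]].
have /choice[s sP] : forall n, exists t : T, forall b, B b -> f b = n -> b !=set0 -> b t.
  move=> n; have [[b [Bb fb [t bt]]]|nex] :=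
    pselect (exists b, [/\ B b, f b = n & b !=set0]).
    exists t => c Bc fc _; have -> // : c = b.
    by apply: finj; rewrite ?inE// fc fb.
  by exists point => b Bb fb b0; exfalso; apply: nex; exists b.
exists s => U oU [t Ut]; have : nbhs t U by exact: open_nbhs_nbhs.
move=> /bB[b [Bb bt] bU]; exists (f b); apply: bU; apply: sP => //.
by exists t.
Qed.

Lemma matrix_entry_continuous (T : topologicalType) p q (i : 'I_p) (j : 'I_q) :
  continuous (fun M : 'M[T]_(p, q) => M i j).
Proof.
move=> M U MU; rewrite /nbhs /=.
exists (fun i' j' => if (i' == i) && (j' == j) then U else setT) => /=.
  by move=> i' j'; case: ifPn => [/andP[/eqP-> /eqP->]//|_]; exact: filterT.
by move=> M' /(_ i j); rewrite !eqxx.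
Qed.

Let tau_inv_continuous x : continuous (fun g : G => tau g^-1%g x).
Proof.
have [_ [ctau _ _]] := sys; move=> g.
apply: (@continuous_comp _ _ _ (fun g => (g^-1%g, x)) (fun p : G * Z => tau p.1 p.2)).
  by apply: cvg_pair => /=; [exact: invg_continuous|exact: cvg_cst].
exact: ctau.
Qed.

Lemma kernel_entry_continuous u x i j :
  continuous (fun g : G => k u (tau g^-1%g x) i j).
Proof.
have [_ ck _] := kb; move=> g.
apply: (@continuous_comp _ _ _ (fun g => tau g^-1%g x) (fun y => k u y i j)).
  exact: tau_inv_continuous.
apply: (@continuous_comp _ _ _ (k u) (fun M : 'M[R[i]]_N => M i j)).
  exact: ck.
exact: matrix_entry_continuous.
Qed.

Lemma orbit_sup_ge u x g :
  ((mxmax_norm (k u (tau g^-1%g x)))%:E <= orbit_sup tau k u x)%E.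
Proof. by apply: ereal_sup_ubound; exists g. Qed.

Lemma orbit_sup_ge0 u x : (0 <= orbit_sup tau k u x)%E.
Proof.
by apply: le_trans (orbit_sup_ge u x 1%g); rewrite lee_fin mxmax_norm_ge0.
Qed.

(** The supremum over the orbit is a supremum over a sequence, because the kernel
    is continuous in its second argument. Its measurability rests on this. *)
Lemma orbit_sup_dense (s : nat -> G) u x :
  (forall U, open U -> U !=set0 -> exists n, U (s n)) ->
  orbit_sup tau k u x =
  ereal_sup (range (fun n => (mxmax_norm (k u (tau (s n)^-1%g x)))%:E)).
Proof.
move=> ds; apply/eqP; rewrite eq_le; apply/andP; split; last first.
  by apply: ge_ereal_sup => _ [n _ <-]; exact: orbit_sup_ge.
apply: ge_ereal_sup => _ [g _ <-].
set S := ereal_sup _.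
have Sn n : ((mxmax_norm (k u (tau (s n)^-1%g x)))%:E <= S)%E.
  by apply: ereal_sup_ubound; exists n.
have S0 : (0 <= S)%E by apply: le_trans (Sn 0%N); rewrite lee_fin mxmax_norm_ge0.
have [Soo|Sfin] := eqVneq S +oo%E; first by rewrite Soo leey.
have SE : S = (fine S)%:E by rewrite fineK// ge0_fin_numE// ltey.
rewrite SE lee_fin; apply: mxmax_norm_le; first exact: fine_ge0.
move=> i j; apply/ler_addgt0Pr => e e0.
have := @kernel_entry_continuous u x i j g _ (nbhs_cmod (k u (tau g^-1%g x) i j) e0).
rewrite nbhs_simpl nbhsE => -[U [oU Ug] Ue].
have [n Un] := ds U oU (ex_intro _ g Ug).
have := Ue _ Un => /= h.
have -> : k u (tau g^-1%g x) i j = k u (tau (s n)^-1%g x) i j +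
    (k u (tau g^-1%g x) i j - k u (tau (s n)^-1%g x) i j) by rewrite addrC subrK.
rewrite (le_trans (cmodD _ _))// lerD//; last exact: ltW.
by rewrite (le_trans (le_mxmax_norm _ _ _))// -lee_fin -SE.
Qed.

Lemma kernel_measurable y i j : complex_measurable (fun u : borel G => k u y i j).
Proof.
have [mk _ _] := kb.
exact: (complex_measurable_comp (@pair2_measurable _ _ (borel G) (borel Z) y) (mk i j)).
Qed.

Lemma measurable_mxmax_norm d (T : measurableType d) (M : T -> 'M[R[i]]_N) :
  (forall i j, complex_measurable (fun t => M t i j)) ->
  measurable_fun setT (fun t => mxmax_norm (M t)).
Proof.
move=> mM; have mbig (I : Type) (l : seq I) (F : I -> T -> R) :
    (forall i, measurable_fun setT (F i)) ->
    measurable_fun setT (fun t => \big[Num.max/0]_(i <- l) F i t).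
  move=> mF; elim: l => [|i l IH].
    by under eq_fun do rewrite big_nil; exact: measurable_cst.
  by under eq_fun do rewrite big_cons; exact: measurable_maxr.
by apply: (mbig) => i; apply: (mbig) => j; exact: measurable_cmod.
Qed.

Lemma measurable_orbit_sup x :
  measurable_fun setT (fun u : borel G => orbit_sup tau k u x).
Proof.
have [s ds] := second_countable_dense_sequence cG.
pose f n (u : borel G) := (mxmax_norm (k u (tau (s n)^-1%g x)))%:E : \bar R.
rewrite (_ : (fun _ => _) = (fun u => esups (f ^~ u) 0%N)).
  apply: measurable_fun_esups => n; apply/measurable_EFinP.
  by apply: measurable_mxmax_norm => i j; exact: kernel_measurable.
apply/funext => u; rewrite (orbit_sup_dense _ _ ds) /esups /sdrop /=.
congr ereal_sup; apply/seteqP; split=> _ [n _ <-]; by exists n.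
Qed.

End OrbitSup.

Lemma measurable_partial_Rintegral d1 d2 (T1 : measurableType d1)
    (T2 : measurableType d2) (R : realType)
    (mu : {sigma_finite_measure set T2 -> \bar R}) (f : T1 * T2 -> R) :
  measurable_fun setT f ->
  measurable_fun setT (fun x => \int[mu]_y f (x, y)).
Proof.
move=> mf; apply: measurableT_comp => //.
have mE : measurable_fun setT (EFin \o f) by exact/measurable_EFinP.
under eq_fun do rewrite integralE.
apply: emeasurable_funB.
- rewrite (_ : (fun _ => _) =
      (fun x => \int[mu]_y (EFin \o f)^\+%E (x, y))%E); last first.
    by apply/funext => x; apply: eq_integral => y _; rewrite !funeposE.
  apply: (measurable_fun_fubini_tonelli_F (EFin \o f)^\+%E).
    exact: measurable_funepos.
  by move=> p; exact: funepos_ge0.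
- rewrite (_ : (fun _ => _) =
      (fun x => \int[mu]_y (EFin \o f)^\-%E (x, y))%E); last first.
    by apply/funext => x; apply: eq_integral => y _; rewrite !funenegE.
  apply: (measurable_fun_fubini_tonelli_F (EFin \o f)^\-%E).
    exact: measurable_funeneg.
  by move=> p; exact: funeneg_ge0.
Qed.

Section RawOperator.
Context (R : realType) (G : topologicalGroupType) (Z : pmetricType R).
Variables (m : {sigma_finite_measure set (borel G) -> \bar R}).
Variables (tau : G -> Z -> Z) (N : nat) (k : G -> Z -> 'M[R[i]]_N).
Hypothesis N_gt0 : (0 < N)%N.
Hypothesis cG : @second_countable G.
Hypothesis uni : unimodular m.
Hypothesis sys : dynamical_system tau.
Hypothesis kb : bounded_kernel tau m k.
Local Notation V := 'cV[R[i]]_N.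
Local Notation K := (orbit_sup tau k).
Local Notation l2 := (square_integrable m).
Implicit Types (psi phi : borel G -> V).

Definition vmeasurable d (T : measurableType d) (psi : T -> V) : Prop :=
  forall i, complex_measurable (fun x => psi x i 0).

Lemma vmeasurableB d (T : measurableType d) (f g : T -> V) :
  vmeasurable f -> vmeasurable g -> vmeasurable (fun x => f x - g x).
Proof.
move=> mf mg i; rewrite (_ : (fun _ => _) = (fun x => f x i 0 - g x i 0)).
  exact: complex_measurableB.
by apply/funext => x; rewrite !mxE.
Qed.

Lemma vmeasurableZ d (T : measurableType d) (c : T -> R[i]) (f : T -> V) :
  complex_measurable c -> vmeasurable f -> vmeasurable (fun x => c x *: f x).
Proof.
move=> mc mf i; rewrite (_ : (fun _ => _) = (fun x => c x * f x i 0)).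
  exact: complex_measurableM.
by apply/funext => x; rewrite mxE.
Qed.

Lemma measurable_l1norm d (T : measurableType d) (psi : T -> V) :
  vmeasurable psi -> measurable_fun setT (fun x => l1norm (psi x)).
Proof. by move=> mpsi; apply: measurable_sum => j; exact: measurable_cmod. Qed.

Lemma integral_sqr_l1norm psi : vmeasurable psi ->
  (\int[m]_g (l1norm (psi g) ^+ 2)%:E <=
   N%:R%:E * \int[m]_g (sqnorm (psi g))%:E)%E.
Proof.
move=> mpsi; have ml1 := measurable_l1norm mpsi.
rewrite -ge0_integralZl//; last 2 first.
- exact: measurable_sqnorm.
- by move=> g _; rewrite lee_fin sqnorm_ge0.
apply: ge0_le_integral => //.
- by move=> g _; rewrite lee_fin sqr_ge0.
- by apply/measurable_EFinP; exact: measurable_funX.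
- by apply: measurable_funeM; exact: measurable_sqnorm.
- by move=> g _; rewrite -EFinM lee_fin sqr_l1norm.
Qed.

(** [raw_operator] acts on functions, so that cut-offs and pointwise estimates
    make sense; [dyn_operator] acts on classes modulo null sets, and
    [dyn_operator_ae] relates the two. *)
Definition integrand (x : Z) psi (g : borel G) (n : 'I_N) (h : borel G) : R[i] :=
  (k (g^-1 * h)%g (tau g^-1%g x) *m psi h) n 0.

Definition raw_operator (x : Z) psi (g : borel G) : V :=
  \col_n complex_integral m (integrand x psi g n).

Lemma integrand_measurable2 x psi n : vmeasurable psi ->
  complex_measurable (fun p : borel G * borel G => integrand x psi p.1 n p.2).
Proof.
move=> mpsi; have [mk _ _] := kb; have [_ [ctau _ _]] := sys.
rewrite (_ : (fun _ => _) = (fun p : borel G * borel G =>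
   \sum_j k (p.1^-1 * p.2)%g (tau p.1^-1%g x) n j * psi p.2 j 0)); last first.
  by apply/funext => p; rewrite /integrand mxE.
apply: complex_measurable_sum => j; apply: complex_measurableM; last first.
  exact: (complex_measurable_comp (@measurable_snd _ _ (borel G) (borel G)) (mpsi j)).
have inv1 : continuous (fun p : G * G => (p.1^-1)%g).
  move=> p; apply: (@continuous_comp _ _ _ (fun p : G * G => p.1) (fun g => g^-1%g)).
    exact: cvg_fst.
  exact: invg_continuous.
have m1 : measurable_fun setT (fun p : borel G * borel G => (p.1^-1 * p.2)%g : borel G).
  apply: continuous_prod_borel => // p.
  apply: (@continuous_comp _ _ _ (fun p : G * G => (p.1^-1, p.2)%g)
    (fun p : G * G => (p.1 * p.2)%g)).
    by apply: cvg_pair => /=; [exact: inv1|exact: cvg_snd].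
  exact: mulg_continuous.
have m2 : measurable_fun setT (fun p : borel G * borel G => tau p.1^-1%g x : borel Z).
  apply: continuous_prod_borel => // p.
  apply: (@continuous_comp _ _ _ (fun p : G * G => (p.1^-1%g, x))
    (fun p : G * Z => tau p.1 p.2)).
    by apply: cvg_pair => /=; [exact: inv1|exact: cvg_cst].
  exact: ctau.
exact: (complex_measurable_comp (measurable_fun_pair m1 m2) (mk n j)).
Qed.

Lemma integrand_measurable x psi g n : vmeasurable psi ->
  complex_measurable (integrand x psi g n).
Proof.
move=> mpsi.
exact: (complex_measurable_comp (@pair1_measurable _ _ (borel G) (borel G) g)
  (integrand_measurable2 x n mpsi)).
Qed.

Lemma raw_operator_measurable x psi : vmeasurable psi ->
  vmeasurable (raw_operator x psi).
Proof.
move=> mpsi n; have [mR mI] := integrand_measurable2 x n mpsi.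
split; under eq_fun do rewrite mxE /=.
  exact: (measurable_partial_Rintegral m mR).
exact: (measurable_partial_Rintegral m mI).
Qed.

(** The substitution [h = g u]. With [u = g^-1 h] as variable the kernel no
    longer depends on [g] except through the point of the orbit. *)
Lemma integral_translate (kap f : borel G -> \bar R) g :
  measurable_fun setT kap -> measurable_fun setT f ->
  (forall u, 0 <= kap u)%E -> (forall u, 0 <= f u)%E ->
  (\int[m]_h (kap (g^-1 * h)%g * f h) = \int[m]_u (kap u * f (g * u)%g))%E.
Proof.
move=> mkap mf kap0 f0.
rewrite -(integral_mulgl uni g (f := fun h => kap (g^-1 * h)%g * f h)%E).
- by apply: eq_integral => u _; rewrite mulKg.
- apply: emeasurable_funM => //.
  exact: measurableT_comp mkap (mulg_borel (g^-1)%g).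
- by move=> h; rewrite mule_ge0.
Qed.

Lemma measurable_translate d' (S : measurableType d') (f : borel G -> S) (g : G) :
  measurable_fun setT f ->
  measurable_fun setT (fun u : borel G => f (g * u)%g).
Proof. by move=> mf; exact: measurableT_comp mf (mulg_borel g). Qed.

Let mK x : measurable_fun setT (fun u : borel G => K u x).
Proof. exact: (measurable_orbit_sup cG sys kb). Qed.

Lemma cmod_integrand_le x psi g n h :
  ((cmod (integrand x psi g n h))%:E <=
   K (g^-1 * h)%g x * (l1norm (psi h))%:E)%E.
Proof.
apply: (@le_trans _ _ ((mxmax_norm (k (g^-1 * h)%g (tau g^-1%g x)))%:E *
  (l1norm (psi h))%:E)%E).
  by rewrite -EFinM lee_fin; exact: cmod_mulmx.
by rewrite lee_wpmul2r ?lee_fin ?l1norm_ge0//; exact: orbit_sup_ge.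
Qed.

Lemma integral_cmod_integrand_le x psi g n : vmeasurable psi ->
  (\int[m]_h (cmod (integrand x psi g n h))%:E <=
   \int[m]_u (K u x * (l1norm (psi (g * u)%g))%:E))%E.
Proof.
move=> mpsi; have ml1 := measurable_l1norm mpsi.
rewrite -(@integral_translate (fun u => K u x) (fun h => (l1norm (psi h))%:E))//.
- apply: ge0_le_integral => //.
  + by move=> h _; rewrite lee_fin cmod_ge0.
  + by apply/measurable_EFinP; exact: measurable_cmod (integrand_measurable _ _ _ _).
  + apply: emeasurable_funM; last exact/measurable_EFinP.
    exact: (@measurable_translate _ _ (fun u => K u x)).
  + by move=> h _; exact: cmod_integrand_le.
- exact/measurable_EFinP.
- by move=> u; exact: orbit_sup_ge0.
- by move=> u; rewrite lee_fin l1norm_ge0.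
Qed.

Lemma cmod_raw_operator_le x psi g n : vmeasurable psi ->
  ((cmod (raw_operator x psi g n 0))%:E <=
   2%:E * \int[m]_u (K u x * (l1norm (psi (g * u)%g))%:E))%E.
Proof.
move=> mpsi; rewrite mxE.
apply: le_trans (cmod_complex_integral _ (integrand_measurable _ _ _ mpsi)) _.
by rewrite lee_wpmul2l// integral_cmod_integrand_le.
Qed.

Lemma sqnorm_le_sqr (v : V) (J : \bar R) : (0 <= J)%E ->
  (forall n, (cmod (v n 0))%:E <= 2%:E * J)%E ->
  ((sqnorm v)%:E <= (N%:R * 4)%:E * J ^+ 2)%E.
Proof.
move=> J0 vJ; have [Joo|Jfin] := eqVneq J +oo%E.
  by rewrite Joo expe2 mulyy gt0_muley ?leey// lte_fin mulr_gt0// ltr0n.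
have JE : J = (fine J)%:E by rewrite fineK// ge0_fin_numE// ltey.
rewrite JE -EFin_expe -EFinM lee_fin /sqnorm.
rewrite -mulrA mulr_natl -[X in _ *+ X]card_ord -sumr_const.
apply: ler_sum => n _.
have -> : 4 * fine J ^+ 2 = (2 * fine J) ^+ 2 by ring.
apply: lerXn2r; rewrite ?nnegrE ?cmod_ge0 ?mulr_ge0 ?fine_ge0//.
by rewrite -lee_fin EFinM -JE; exact: vJ.
Qed.

(** Schur's test for the majorant of [Phi]. The 4 in the constant is
    the square of the 2 in the hypothesis; one factor [N] counts the coordinates
    of [Phi], the other one comes from [sqr_l1norm]. *)
Lemma sqnorm_schur (kap : borel G -> \bar R) psi (Phi : borel G -> V) (A : R) :
    measurable_fun setT kap -> (forall u, 0 <= kap u)%E -> 0 < A ->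
    (\int[m]_u kap u <= A%:E)%E -> vmeasurable psi -> vmeasurable Phi ->
    (\forall g \ae m, forall n : 'I_N, ((cmod (Phi g n 0))%:E <=
      2%:E * \int[m]_u (kap u * (l1norm (psi (g * u)%g))%:E))%E) ->
  (\int[m]_g (sqnorm (Phi g))%:E <=
   (4 * N%:R ^+ 2 * A ^+ 2)%:E * \int[m]_g (sqnorm (psi g))%:E)%E.
Proof.
move=> mkap kap0 A0 kapA mpsi mPhi hPhi.
pose I (g : borel G) : \bar R :=
  (\int[m]_u (kap u * (l1norm (psi (g * u)%g))%:E))%E.
have ml1 := measurable_l1norm mpsi.
have mI : measurable_fun setT I.
  apply: (@measurable_convolution _ _ m cG kap (fun u => (l1norm (psi u))%:E)) => //.
    exact/measurable_EFinP.
  by move=> u; rewrite lee_fin l1norm_ge0.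
have I0 g : (0 <= I g)%E.
  by apply: integral_ge0 => u _; rewrite mule_ge0// lee_fin l1norm_ge0.
have mI2 : measurable_fun setT (fun g => I g ^+ 2)%E.
  by under eq_fun do rewrite expe2; exact: emeasurable_funM.
apply: (@le_trans _ _ (\int[m]_g ((N%:R * 4)%:E * I g ^+ 2))%E).
  apply: ae_ge0_le_integral => //.
  - by move=> g _; rewrite lee_fin sqnorm_ge0.
  - exact: measurable_sqnorm.
  - by move=> g _; rewrite mule_ge0 ?sqre_ge0.
  - exact: measurable_funeM.
  - by move: hPhi; apply: filterS => g hg _; exact: sqnorm_le_sqr.
rewrite ge0_integralZl//; last by move=> g _; exact: sqre_ge0.
apply: (@le_trans _ _ ((N%:R * 4)%:E * ((A ^+ 2)%:E *
    \int[m]_g (l1norm (psi g) ^+ 2)%:E))%E).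
  rewrite lee_wpmul2l ?lee_fin ?mulr_ge0//.
  by apply: schur_test => // u; exact: l1norm_ge0.
apply: (@le_trans _ _ ((N%:R * 4)%:E * ((A ^+ 2)%:E *
    (N%:R%:E * \int[m]_g (sqnorm (psi g))%:E)))%E).
  rewrite !lee_wpmul2l ?lee_fin ?mulr_ge0 ?sqr_ge0 ?(ltW A0)//.
  exact: integral_sqr_l1norm.
rewrite !muleA -!EFinM; apply: lee_wpmul2r.
  by apply: integral_ge0 => g _; rewrite lee_fin sqnorm_ge0.
by rewrite lee_fin le_eqVlt; apply/orP; left; apply/eqP; ring.
Qed.

Lemma bounded_kernel_mass : exists2 A : R, 0 < A &
  forall x, (\int[m]_u K u x <= A%:E)%E.
Proof.
have [_ _] := kb; set S := ereal_sup _ => Soo.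
have le x : (\int[m]_u K u x <= S)%E by apply: ereal_sup_ubound; exists x.
have S0 : (0 <= S)%E.
  by apply: le_trans (le point); apply: integral_ge0 => u _; exact: orbit_sup_ge0.
have SE : S = (fine S)%:E by rewrite fineK// ge0_fin_numE.
exists (fine S + 1); first by rewrite ltr_wpDl// fine_ge0.
by move=> x; rewrite (le_trans (le x))// SE lee_fin lerDl.
Qed.

Lemma raw_operator_bound x psi (A : R) : 0 < A -> (\int[m]_u K u x <= A%:E)%E ->
    vmeasurable psi ->
  (\int[m]_g (sqnorm (raw_operator x psi g))%:E <=
   (4 * N%:R ^+ 2 * A ^+ 2)%:E * \int[m]_g (sqnorm (psi g))%:E)%E.
Proof.
move=> A0 KA mpsi; apply: (@sqnorm_schur (fun u => K u x)) => //.
- by move=> u; exact: orbit_sup_ge0.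
- exact: raw_operator_measurable.
- by apply: aeW => g n; exact: cmod_raw_operator_le.
Qed.

Lemma raw_operator_square_integrable x psi : l2 psi -> l2 (raw_operator x psi).
Proof.
move=> [mpsi ipsi]; have [A A0 KA] := bounded_kernel_mass.
split; first exact: raw_operator_measurable.
apply: le_lt_trans (raw_operator_bound A0 (KA x) mpsi) _.
rewrite lte_mul_pinfty// lee_fin.
by apply: mulr_ge0; [apply: mulr_ge0 => //|]; exact: sqr_ge0.
Qed.

Lemma dyn_operator_ae x (psi : L2 m N) :
  ((dyn_operator tau k x psi : L2 m N) : _ -> V) = raw_operator x psi %[ae m].
Proof.
rewrite /dyn_operator /to_L2; case: pselect => [sf|nsf].
  exact: L2_classE.
exfalso; apply: nsf.
exact: raw_operator_square_integrable (L2_fun_square_integrable psi).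
Qed.

Lemma raw_operator_ae_eq x psi phi : vmeasurable psi -> vmeasurable phi ->
  psi = phi %[ae m] -> raw_operator x psi = raw_operator x phi.
Proof.
move=> mpsi mphi e; apply/funext => g; apply/matrixP => n j; rewrite !mxE.
apply: complex_integral_ae; [exact: integrand_measurable|exact: integrand_measurable|].
by move: e; apply: filterS => h /= hE _; rewrite /integrand (hE I).
Qed.

(** The integral that defines the operator converges absolutely at almost every
    [g], because its majorant is square integrable by Schur's test. Only there is
    it linear in the integrand. *)
Lemma integrand_integrable_ae x psi : l2 psi ->
  \forall g \ae m, forall n : 'I_N,
    (\int[m]_h (cmod (integrand x psi g n h))%:E < +oo)%E.
Proof.
move=> [mpsi ipsi]; have [A A0 KA] := bounded_kernel_mass.
have ml1 := measurable_l1norm mpsi.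
pose J (g : borel G) : \bar R :=
  (\int[m]_u (K u x * (l1norm (psi (g * u)%g))%:E))%E.
have mJ : measurable_fun setT J.
  apply: (@measurable_convolution _ _ m cG (fun u => K u x)
    (fun u => (l1norm (psi u))%:E)) => //.
  - exact/measurable_EFinP.
  - by move=> u; exact: orbit_sup_ge0.
  - by move=> u; rewrite lee_fin l1norm_ge0.
have J0 g : (0 <= J g)%E.
  by apply: integral_ge0 => u _; rewrite mule_ge0 ?orbit_sup_ge0// lee_fin l1norm_ge0.
have iJ : (\int[m]_g (J g ^+ 2) < +oo)%E.
  apply: (@le_lt_trans _ _ ((A ^+ 2)%:E * \int[m]_g (l1norm (psi g) ^+ 2)%:E)%E).
    apply: schur_test => //.
    - by move=> u; exact: orbit_sup_ge0.
    - by move=> u; exact: l1norm_ge0.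
  apply: (@le_lt_trans _ _ ((A ^+ 2)%:E * (N%:R%:E * \int[m]_g (sqnorm (psi g))%:E))%E).
    by rewrite lee_wpmul2l ?lee_fin ?sqr_ge0// integral_sqr_l1norm.
  by rewrite lte_mul_pinfty ?lee_fin ?sqr_ge0// lte_mul_pinfty.
have J2int : m.-integrable setT (fun g => J g ^+ 2)%E.
  apply/integrableP; split.
    by under eq_fun do rewrite expe2; exact: emeasurable_funM.
  by under eq_integral => g _ do rewrite gee0_abs ?sqre_ge0//.
have := integrable_ae measurableT J2int; apply: filterS => g /= /(_ I) Jfin n.
apply: le_lt_trans (integral_cmod_integrand_le _ _ _ mpsi) _.
rewrite -/(J g) ltey; apply/eqP => Joo; move: Jfin.
by rewrite Joo mulyy.
Qed.

End RawOperator.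

Section Localization.
Context (R : realType) (G : topologicalGroupType) (dG : G -> G -> R).
Context (Z : pmetricType R).
Variables (m : {sigma_finite_measure set (borel G) -> \bar R}).
Variables (tau : G -> Z -> Z) (N : nat) (k : G -> Z -> 'M[R[i]]_N).
Hypothesis N_gt0 : (0 < N)%N.
Hypothesis cG : @second_countable G.
Hypothesis uni : unimodular m.
Hypothesis adG : adapted_metric dG.
Hypothesis sys : dynamical_system tau.
Hypothesis kb : bounded_kernel tau m k.
Variable cs : R.
Hypothesis cs_gt0 : 0 < cs.
Local Notation V := 'cV[R[i]]_N.
Local Notation K := (orbit_sup tau k).
Local Notation l2 := (square_integrable m).
Local Notation raw := (raw_operator m tau k).
Implicit Types (psi phi : borel G -> V).

Definition decay (x : Z) (u : borel G) : \bar R := (K u x * (dG 1%g u)%:E)%E.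

Hypothesis kdecay : forall x, (\int[m]_u decay x u <= cs%:E)%E.

Let dG_ge0 g h : 0 <= dG g h. Proof. by have [[]] := adG. Qed.
Let dG_sym g h : dG g h = dG h g. Proof. by have [[]] := adG. Qed.
Let dG_tri g h l : dG g l <= dG g h + dG h l. Proof. by have [[]] := adG. Qed.
Let dG_inv a g h : dG (a * g)%g (a * h)%g = dG g h.
Proof. by have [_ []] := adG. Qed.

Lemma dist_mulr g u : dG g (g * u)%g = dG 1%g u.
Proof. by rewrite -[X in dG X _]mulg1 dG_inv. Qed.

Lemma measurable_dist g : measurable_fun setT (fun h : borel G => dG g h).
Proof.
apply: continuous_borel_real => h.
apply: (@continuous_comp _ _ _ (fun h => (g, h)) (fun p : G * G => dG p.1 p.2)).
  by apply: cvg_pair => /=; [exact: cvg_cst|exact: cvg_id].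
by have [_ [cd _ _ _]] := adG; exact: cd.
Qed.

Let mK x : measurable_fun setT (fun u : borel G => K u x).
Proof. exact: (measurable_orbit_sup cG sys kb). Qed.

Lemma measurable_decay x : measurable_fun setT (decay x).
Proof.
apply: emeasurable_funM; first exact: mK.
by apply/measurable_EFinP; exact: measurable_dist.
Qed.

Lemma decay_ge0 x u : (0 <= decay x u)%E.
Proof. by rewrite mule_ge0 ?orbit_sup_ge0// lee_fin. Qed.

(** The Lipschitz constant [1 / (2 r)] is the source of the small factor in
    [commutator_bound]. *)
Definition cutoff (r : R) (g : G) (h : borel G) : R :=
  Num.max 0 (1 - dG g h / (2 * r)).

Definition ball_indic (r : R) (g : G) (h : borel G) : R :=
  \1_(nearby dG (2 * r)) (g, h).

Lemma ball_indicE r g h : ball_indic r g h = (dG g h < 2 * r)%R%:R.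
Proof.
rewrite /ball_indic indicE; congr (nat_of_bool _)%:R.
by apply/idP/idP; rewrite inE.
Qed.

Lemma ball_indic_ge0 r g h : 0 <= ball_indic r g h.
Proof. by rewrite ball_indicE. Qed.

Lemma sqr_ball_indic r g h : ball_indic r g h ^+ 2 = ball_indic r g h.
Proof. by rewrite ball_indicE; case: (_ < _); rewrite ?expr1n ?expr0n. Qed.

Lemma measurable_cutoff r g : measurable_fun setT (cutoff r g).
Proof.
apply: measurable_maxr => //; apply: measurable_funB => //.
by apply: measurable_funM => //; exact: measurable_dist.
Qed.

Lemma measurable_ball_indic r g : measurable_fun setT (ball_indic r g).
Proof.
have mi : measurable_fun setT (\1_(nearby dG (2 * r)) : borel G * borel G -> R).
  by apply: measurable_indic; exact: measurable_nearby.
exact: (measurableT_comp mi (@pair1_measurable _ _ (borel G) (borel G) g)).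
Qed.

Lemma cutoff_ge0 r g h : 0 <= cutoff r g h.
Proof. by rewrite /cutoff le_max lexx. Qed.

Section Radius.
Variable r : R.
Hypothesis r_gt0 : 0 < r.

Let r2 : 0 < 2 * r. Proof. by rewrite mulr_gt0. Qed.

Lemma cutoff_le_ball_indic g h : cutoff r g h <= ball_indic r g h.
Proof.
rewrite ball_indicE /cutoff; case: (ltP (dG g h) (2 * r)) => hr.
  rewrite ge_max ler01 /= gerBl divr_ge0// ltW//.
by rewrite ge_max lexx /= subr_le0 ler_pdivlMr// mul1r.
Qed.

Lemma cutoff_ge_half g h : dG g h < r -> 1 / 2 <= cutoff r g h.
Proof.
move=> hr; rewrite /cutoff le_max; apply/orP; right.
rewrite lerBrDr -lerBrDl ler_pdivrMr//; lra.
Qed.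

(** The indicators keep the estimate local: both values are 0 if neither point
    is within [2 r] of [g]. *)
Lemma cutoff_lipschitz g h h' : `|cutoff r g h - cutoff r g h'| <=
  dG h h' / (2 * r) * (ball_indic r g h + ball_indic r g h').
Proof.
have hl a b : Num.max 0 (1 - dG g a / (2 * r)) - Num.max 0 (1 - dG g b / (2 * r)) <=
    dG a b / (2 * r).
  rewrite lerBlDr ge_max; apply/andP; split.
    by rewrite addr_ge0 ?divr_ge0 ?(ltW r2)// le_max lexx.
  have : 1 - dG g b / (2 * r) <= Num.max 0 (1 - dG g b / (2 * r)).
    by rewrite le_max lexx orbT.
  have : dG g b / (2 * r) <= dG g a / (2 * r) + dG a b / (2 * r).
    by rewrite -mulrDl ler_pM2r ?invr_gt0.
  lra.
have lip : `|cutoff r g h - cutoff r g h'| <= dG h h' / (2 * r).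
  rewrite ler_norml hl andbT lerNl opprB (dG_sym h h'); exact: hl.
have := cutoff_le_ball_indic g h; have := cutoff_le_ball_indic g h'.
have := cutoff_ge0 r g h; have := cutoff_ge0 r g h'.
have d0 : 0 <= dG h h' / (2 * r) by rewrite divr_ge0// ltW.
rewrite !ball_indicE.
case: (_ < _); case: (_ < _) => /=; rewrite ?mulr1n ?mulr0n => c1 c2 c3 c4.
- by rewrite (le_trans lip)// ler_peMr//; lra.
- by rewrite ?addr0 ?add0r mulr1.
- by rewrite ?addr0 ?add0r mulr1.
- have -> : cutoff r g h = 0 by apply/eqP; rewrite eq_le c2 c4.
  have -> : cutoff r g h' = 0 by apply/eqP; rewrite eq_le c1 c3.
  by rewrite subrr normr0 addr0 mulr0.
Qed.

Definition localized g psi (h : borel G) : V :=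
  ((cutoff r g h)%:C)%C *: psi h.

Lemma complex_cutoff_measurable g :
  complex_measurable (fun h : borel G => ((cutoff r g h)%:C)%C).
Proof. by split; [exact: measurable_cutoff|exact: measurable_cst]. Qed.

Lemma localized_measurable g psi : vmeasurable psi -> vmeasurable (localized g psi).
Proof. exact: vmeasurableZ (complex_cutoff_measurable g). Qed.

Lemma sqnorm_localized g psi h :
  sqnorm (localized g psi h) = cutoff r g h ^+ 2 * sqnorm (psi h).
Proof. by rewrite sqnormZ cmod_real real_normK ?num_real. Qed.

Lemma cutoff_le1 g h : cutoff r g h <= 1.
Proof.
rewrite (le_trans (cutoff_le_ball_indic g h))// ball_indicE.
by case: (_ < _).
Qed.

Lemma localized_square_integrable g psi : l2 psi -> l2 (localized g psi).
Proof.
move=> [mpsi ipsi]; have ml := localized_measurable g mpsi.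
split=> //; apply: le_lt_trans ipsi; apply: ge0_le_integral => //.
- by move=> h _; rewrite lee_fin sqnorm_ge0.
- exact: measurable_sqnorm.
- exact: measurable_sqnorm.
- move=> h _; rewrite lee_fin sqnorm_localized ler_piMl ?sqnorm_ge0//.
  by rewrite expr_le1 ?cutoff_ge0// cutoff_le1.
Qed.

(** The mass of [psi] as seen from [h], weighted by the kernel and the
    distance. *)
Definition transported x psi (h : borel G) : \bar R :=
  (\int[m]_u (decay x u * (l1norm (psi (h * u)%g) ^+ 2)%:E))%E.

(** The density that dominates the commutator near [g]. The first term comes from
    the points where [psi] is evaluated, the second one from the points where the
    result is. *)
Definition commutator_mass x psi (h : borel G) : \bar R :=
  ((2 * N%:R * cs / r ^+ 2)%:E *
    (cs%:E * (l1norm (psi h) ^+ 2)%:E + transported x psi h))%E.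

(** The commutator has the kernel of the operator multiplied by
    [cutoff h - cutoff g'], and [cutoff_lipschitz] turns this factor into a
    distance, to be absorbed by the decay of the kernel. *)
Lemma commutator_pointwise x psi g g' (n : 'I_N) : vmeasurable psi ->
    (\int[m]_h (cmod (integrand tau k x psi g' n h))%:E < +oo)%E ->
  ((cmod ((raw x (localized g psi) g' -
     ((cutoff r g g')%:C)%C *: raw x psi g') n 0))%:E <=
  2%:E * \int[m]_u (decay x u *
    ((ball_indic r g (g' * u)%g + ball_indic r g g') / (2 * r) *
      l1norm (psi (g' * u)%g))%:E))%E.
Proof.
move=> mpsi ipsi; have ml1 := measurable_l1norm mpsi.
have E h : integrand tau k x (localized g psi) g' n h =
    ((cutoff r g h)%:C)%C * integrand tau k x psi g' n h.
  by rewrite /integrand /localized -scalemxAr mxE.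
have mI := integrand_measurable cG sys kb x g' n mpsi.
have mL := integrand_measurable cG sys kb x g' n (localized_measurable g mpsi).
have iI := finite_cmod_integrable mI ipsi.
have iL : complex_integrable m (integrand tau k x (localized g psi) g' n).
  apply: finite_cmod_integrable => //; apply: le_lt_trans ipsi.
  apply: ge0_le_integral => //.
  - by move=> h _; rewrite lee_fin cmod_ge0.
  - by apply/measurable_EFinP; exact: measurable_cmod.
  - by apply/measurable_EFinP; exact: measurable_cmod.
  - move=> h _; rewrite lee_fin E cmodM cmod_real ger0_norm ?cutoff_ge0//.
    by rewrite ler_piMl ?cmod_ge0// cutoff_le1.
pose F (h : borel G) : \bar R :=
  ((ball_indic r g h + ball_indic r g g') / (2 * r) * l1norm (psi h))%:E.
have mF : measurable_fun setT F.
  apply/measurable_EFinP; apply: measurable_funM => //.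
  apply: measurable_funM => //; apply: measurable_funD => //.
  exact: measurable_ball_indic.
have F0 h : (0 <= F h)%E.
  rewrite lee_fin !mulr_ge0 ?l1norm_ge0 ?addr_ge0 ?ball_indic_ge0//.
  by rewrite invr_ge0 ltW.
rewrite -(@integral_translate _ _ m uni (decay x) F)//; last first.
- exact: decay_ge0.
- exact: measurable_decay.
rewrite !mxE -complex_integralZ// -complex_integralB//; last exact: complex_integrableZ.
have mD : complex_measurable (fun h => integrand tau k x (localized g psi) g' n h -
    ((cutoff r g g')%:C)%C * integrand tau k x psi g' n h).
  by apply: complex_measurableB => //; exact: complex_measurableM.
apply: (le_trans (cmod_complex_integral m mD)).
rewrite lee_wpmul2l//; apply: ge0_le_integral => //.
- by move=> h _; rewrite lee_fin cmod_ge0.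
- by apply/measurable_EFinP; exact: measurable_cmod.
- apply: emeasurable_funM => //.
  exact: measurable_translate (measurable_decay x).
- move=> h _; rewrite E -mulrBl -rmorphB cmodM cmod_real EFinM.
  apply: (@le_trans _ _ ((dG h g' / (2 * r) *
      (ball_indic r g h + ball_indic r g g'))%:E *
      (K (g'^-1 * h)%g x * (l1norm (psi h))%:E))%E).
    apply: lee_pmul; rewrite ?lee_fin ?cmod_ge0//; first exact: cutoff_lipschitz.
    exact: cmod_integrand_le.
  have -> : dG h g' = dG 1%g (g'^-1 * h)%g.
    by rewrite dG_sym -(dG_inv g'^-1%g) mulVg.
  rewrite /decay /F; set t := dG 1%g _; set b := _ + _; set l := l1norm _.
  rewrite muleCA -muleA -!EFinM le_eqVlt; apply/orP; left; apply/eqP.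
  by congr (_ * _%:E)%E; ring.
Qed.

Lemma sum_ball_indic_sqr_le g h h' (t : R) :
  ((ball_indic r g h + ball_indic r g h') / (2 * r) * t) ^+ 2 <=
  (2 * r ^+ 2)^-1 * (ball_indic r g h * t ^+ 2 + ball_indic r g h' * t ^+ 2).
Proof.
have := sqr_ball_indic r g h; have := sqr_ball_indic r g h'.
set b := ball_indic r g h; set b' := ball_indic r g h' => hb' hb.
have -> : ((b + b') / (2 * r) * t) ^+ 2 =
    (2 * r ^+ 2)^-1 * ((b + b') ^+ 2 / 2 * t ^+ 2) by field; rewrite gt_eqF.
apply: ler_wpM2l; first by rewrite invr_ge0 mulr_ge0 ?sqr_ge0.
rewrite -mulrDl; apply: ler_wpM2r; first exact: sqr_ge0.
have := sqr_ge0 (b - b'); lra.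
Qed.

(** The Cauchy-Schwarz inequality with respect to the density [decay], of mass at
    most [cs], then integration over [g']. In the term with the indicator at
    [g' u] the translation by [u] is removed by right invariance. The constant of
    [commutator_mass] is [4 N] (from [sqnorm_le_sqr]) times [cs] times
    [1 / (2 r^2)] (from [sum_ball_indic_sqr_le]). *)
Lemma commutator_bound x psi g : l2 psi ->
  (\int[m]_g' (sqnorm (raw x (localized g psi) g' -
     ((cutoff r g g')%:C)%C *: raw x psi g'))%:E <=
   local_mass dG m (2 * r) (commutator_mass x psi) g)%E.
Proof.
move=> lpsi; have [mpsi ipsi] := lpsi; have ml1 := measurable_l1norm mpsi.
have mdec := measurable_decay x; have dec0 := decay_ge0 x.
pose c0 : R := 2 * N%:R * cs / r ^+ 2.
have c00 : 0 <= c0.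
  by rewrite divr_ge0 ?sqr_ge0// !mulr_ge0// ltW.
pose l2n (h : borel G) : \bar R := (l1norm (psi h) ^+ 2)%:E.
have ml2n : measurable_fun setT l2n.
  by apply/measurable_EFinP; exact: measurable_funX.
have l2n0 h : (0 <= l2n h)%E by rewrite lee_fin sqr_ge0.
pose b (h : borel G) : \bar R := (ball_indic r g h)%:E.
have mb : measurable_fun setT b.
  by apply/measurable_EFinP; exact: measurable_ball_indic.
have b0 h : (0 <= b h)%E by rewrite lee_fin ball_indic_ge0.
have mT : measurable_fun setT (transported x psi).
  exact: (@measurable_convolution _ _ m cG (decay x) l2n).
have T0 h : (0 <= transported x psi h)%E.
  by apply: integral_ge0 => u _; rewrite mule_ge0// lee_fin sqr_ge0.
have mbl : measurable_fun setT (fun h => b h * l2n h)%E by exact: emeasurable_funM.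
pose A1 (h : borel G) : \bar R :=
  (\int[m]_u (decay x u * (b (h * u)%g * l2n (h * u)%g)))%E.
have mA1 : measurable_fun setT A1.
  apply: (@measurable_convolution _ _ m cG (decay x) (fun h => b h * l2n h)%E) => //.
  by move=> u; rewrite mule_ge0.
have A10 h : (0 <= A1 h)%E.
  by apply: integral_ge0 => u _; apply: mule_ge0 => //; exact: mule_ge0.
pose B1 (h : borel G) : \bar R := (b h * transported x psi h)%E.
have mB1 : measurable_fun setT B1 by exact: emeasurable_funM.
have B10 h : (0 <= B1 h)%E by rewrite mule_ge0.
apply: (@le_trans _ _ (\int[m]_h (c0%:E * (A1 h + B1 h)))%E).
  apply: ae_ge0_le_integral => //.
  - by move=> h _; rewrite lee_fin sqnorm_ge0.
  - apply: measurable_sqnorm; apply: vmeasurableB.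
      by apply: raw_operator_measurable => //; exact: localized_measurable.
    apply: vmeasurableZ; last exact: raw_operator_measurable.
    exact: complex_cutoff_measurable.
  - by move=> h _; apply: mule_ge0; [rewrite lee_fin|exact: adde_ge0].
  - by apply: measurable_funeM; exact: emeasurable_funD.
  have := integrand_integrable_ae cG uni sys kb x lpsi.
  apply: filterS => g' hg' _.
  pose F (u : borel G) : R := (ball_indic r g (g' * u)%g + ball_indic r g g') / (2 * r) *
    l1norm (psi (g' * u)%g).
  have F0 u : 0 <= F u.
    by rewrite !mulr_ge0 ?l1norm_ge0 ?addr_ge0 ?ball_indic_ge0// invr_ge0 ltW.
  have mF : measurable_fun setT F.
    apply: measurable_funM.
      apply: measurable_funM => //; apply: measurable_funD => //.
      exact: measurable_translate (measurable_ball_indic r g).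
    exact: measurable_translate ml1.
  apply: (le_trans (@sqnorm_le_sqr R N N_gt0 _ (\int[m]_u (decay x u * (F u)%:E))%E _ _)).
  - by apply: integral_ge0 => u _; rewrite mule_ge0// lee_fin.
  - by move=> n; exact: commutator_pointwise.
  apply: (@le_trans _ _ ((N%:R * 4)%:E *
      (cs%:E * \int[m]_u (decay x u * (F u ^+ 2)%:E)))%E).
    rewrite lee_wpmul2l ?lee_fin ?mulr_ge0//.
    exact: integral_cauchy_schwarz.
  have mG1 : measurable_fun setT (fun u : borel G => b (g' * u)%g * l2n (g' * u)%g)%E.
    exact: (measurable_translate g' mbl).
  have mG2 : measurable_fun setT (fun u : borel G => b g' * l2n (g' * u)%g)%E.
    by apply: measurable_funeM; exact: (measurable_translate g' ml2n).
  apply: (@le_trans _ _ ((N%:R * 4)%:E * (cs%:E * ((2 * r ^+ 2)^-1%:E *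
      \int[m]_u (decay x u * (b (g' * u)%g * l2n (g' * u)%g) +
                 decay x u * (b g' * l2n (g' * u)%g)))))%E).
    rewrite !lee_wpmul2l ?lee_fin ?mulr_ge0 ?(ltW cs_gt0)//.
    rewrite -ge0_integralZl//; last 3 first.
    - by apply: emeasurable_funD; exact: emeasurable_funM.
    - by move=> u _; apply: adde_ge0; apply: mule_ge0 => //; exact: mule_ge0.
    - by rewrite lee_fin invr_ge0 mulr_ge0 ?sqr_ge0.
    apply: ge0_le_integral => //.
    - by move=> u _; rewrite mule_ge0// lee_fin sqr_ge0.
    - apply: emeasurable_funM => //; apply/measurable_EFinP; exact: measurable_funX.
    - by apply: measurable_funeM; apply: emeasurable_funD; exact: emeasurable_funM.
    - move=> u _; rewrite -ge0_muleDr ?mule_ge0//.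
      rewrite muleCA lee_wpmul2l//.
      have := sum_ball_indic_sqr_le g (g' * u)%g g' (l1norm (psi (g' * u)%g)).
      by rewrite -lee_fin; exact.
  rewrite ge0_integralD//; last 4 first.
  - by move=> u _; apply: mule_ge0 => //; exact: mule_ge0.
  - exact: emeasurable_funM.
  - by move=> u _; apply: mule_ge0 => //; exact: mule_ge0.
  - exact: emeasurable_funM.
  rewrite -/(A1 g')
    (_ : (\int[m]_u (decay x u * (b g' * l2n (g' * u)%g)) = B1 g')%E); last first.
    rewrite /B1 /transported -ge0_integralZl//; last 2 first.
    - apply: emeasurable_funM => //; exact: (measurable_translate g' ml2n).
    - by move=> u _; apply: mule_ge0 => //; exact: l2n0.
    by apply: eq_integral => u _; rewrite muleCA.
  rewrite !muleA -!EFinM; apply: lee_wpmul2r; first exact: adde_ge0.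
  rewrite lee_fin /c0.
  by rewrite le_eqVlt; apply/orP; left; apply/eqP; field; rewrite gt_eqF.
rewrite ge0_integralZl//; last 2 first.
- exact: emeasurable_funD.
- by move=> h _; rewrite adde_ge0.
rewrite ge0_integralD//.
rewrite /A1 (integral_convolution cG uni mdec mbl)//; last by move=> u; rewrite mule_ge0.
rewrite /local_mass.
rewrite [leRHS](_ : _ = \int[m]_h (c0%:E * (cs%:E * (b h * l2n h) + B1 h)))%E; last first.
  apply: eq_integral => h _; rewrite /commutator_mass.
  rewrite -[LHS]/(b h * (c0%:E * (cs%:E * l2n h + transported x psi h)))%E.
  rewrite muleCA; congr (_ * _)%E.
  have csl : (0 <= cs%:E * l2n h)%E by apply: mule_ge0 => //; rewrite lee_fin ltW.
  by rewrite ge0_muleDr// [(b h * (cs%:E * _))%E]muleCA.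
rewrite ge0_integralZl//; last 2 first.
- by apply: emeasurable_funD => //; exact: measurable_funeM.
- move=> h _; apply: adde_ge0 => //; apply: mule_ge0; last exact: mule_ge0.
  by rewrite lee_fin ltW.
rewrite lee_wpmul2l ?lee_fin// ge0_integralD//; last 2 first.
- move=> h _; apply: mule_ge0; last exact: mule_ge0.
  by rewrite lee_fin ltW.
- exact: measurable_funeM.
rewrite leeD2r// ge0_integralZl//; last 2 first.
- by move=> h _; exact: mule_ge0.
- by rewrite lee_fin ltW.
by rewrite lee_wpmul2r// integral_ge0// => h _; rewrite mule_ge0.
Qed.

Lemma commutator_mass_ge0 x psi h : (0 <= commutator_mass x psi h)%E.
Proof.
apply: mule_ge0.
  by rewrite lee_fin divr_ge0 ?sqr_ge0// !mulr_ge0// ltW.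
apply: adde_ge0.
  by apply: mule_ge0; rewrite lee_fin; [exact: ltW|exact: sqr_ge0].
apply: integral_ge0 => u _; apply: mule_ge0; first exact: decay_ge0.
by rewrite lee_fin sqr_ge0.
Qed.

Lemma measurable_commutator_mass x psi : vmeasurable psi ->
  measurable_fun setT (commutator_mass x psi).
Proof.
move=> mpsi; have ml1 := measurable_l1norm mpsi.
have ml2n : measurable_fun setT (fun h => (l1norm (psi h) ^+ 2)%:E : \bar R).
  by apply/measurable_EFinP; exact: measurable_funX.
apply: measurable_funeM; apply: emeasurable_funD.
  exact: measurable_funeM.
apply: (@measurable_convolution _ _ m cG (decay x)
  (fun h => (l1norm (psi h) ^+ 2)%:E)%E) => //.
- exact: measurable_decay.
- exact: decay_ge0.
- by move=> u; rewrite lee_fin sqr_ge0.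
Qed.

(** Linear decay bounds both terms, which is why the commutator is of relative
    size [1 / r]. *)
Lemma integral_commutator_mass x psi : vmeasurable psi ->
  (\int[m]_h commutator_mass x psi h <=
   (4 * N%:R ^+ 2 * cs ^+ 2 / r ^+ 2)%:E * \int[m]_h (sqnorm (psi h))%:E)%E.
Proof.
move=> mpsi; have ml1 := measurable_l1norm mpsi.
have mdec := measurable_decay x; have dec0 := decay_ge0 x.
pose l2n (h : borel G) : \bar R := (l1norm (psi h) ^+ 2)%:E.
have ml2n : measurable_fun setT l2n.
  by apply/measurable_EFinP; exact: measurable_funX.
have l2n0 h : (0 <= l2n h)%E by rewrite lee_fin sqr_ge0.
have mT : measurable_fun setT (transported x psi).
  exact: (@measurable_convolution _ _ m cG (decay x) l2n).
have T0 h : (0 <= transported x psi h)%E.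
  by apply: integral_ge0 => u _; rewrite mule_ge0// lee_fin sqr_ge0.
have csE : (0 <= cs%:E)%E by rewrite lee_fin ltW.
have csl h : (0 <= cs%:E * l2n h)%E by exact: mule_ge0.
have c00 : 0 <= 2 * N%:R * cs / r ^+ 2.
  by rewrite divr_ge0 ?sqr_ge0// !mulr_ge0// ltW.
rewrite ge0_integralZl//; last 2 first.
- by apply: emeasurable_funD => //; exact: measurable_funeM.
- by move=> h _; apply: adde_ge0; [exact: csl|exact: T0].
rewrite ge0_integralD//; last 2 first.
- by move=> h _; exact: csl.
- exact: measurable_funeM.
rewrite ge0_integralZl//; last by move=> h _; exact: l2n0.
rewrite (integral_convolution cG uni mdec ml2n)//.
have J0 : (0 <= \int[m]_h l2n h)%E by apply: integral_ge0.
have S0 : (0 <= \int[m]_h (sqnorm (psi h))%:E)%E.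
  by apply: integral_ge0 => h _; rewrite lee_fin sqnorm_ge0.
have JS : (\int[m]_h l2n h <= N%:R%:E * \int[m]_h (sqnorm (psi h))%:E)%E.
  exact: integral_sqr_l1norm.
apply: (@le_trans _ _ ((2 * N%:R * cs / r ^+ 2)%:E *
    (cs%:E * (N%:R%:E * \int[m]_h (sqnorm (psi h))%:E) +
    cs%:E * (N%:R%:E * \int[m]_h (sqnorm (psi h))%:E)))%E).
  apply: lee_wpmul2l; first by rewrite lee_fin.
  apply: leeD; first exact: lee_wpmul2l.
  apply: lee_pmul => //; exact: integral_ge0.
rewrite -ge0_muleDl ?lee_fin ?(ltW cs_gt0)// !muleA -EFinD -!EFinM.
apply: lee_wpmul2r => //; rewrite lee_fin.
by rewrite le_eqVlt; apply/orP; left; apply/eqP; field; rewrite gt_eqF.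
Qed.

(** The kernel of the difference at [u = g'^-1 h] matters only for [h] within
    [2 r] of [g]. If [g'] is within [4 r] of [g], the two orbits are [L]-close at
    [g'] and the modulus [kap0] applies. Otherwise [u] has distance at least [2 r]
    from the identity, and the linear decay of both kernels gains [1 / (2 r)].
    Schur's test for the sum of both majorants concludes. *)
Lemma difference_bound x y phi g (L A0 : R) (kap0 : borel G -> R) :
    l2 phi -> (forall h, l1norm (phi h) != 0 -> dG g h < 2 * r) ->
    (forall g', dG g g' < 4 * r ->
      mdist (tau g'^-1%g y) (tau g'^-1%g x) <= L) ->
    measurable_fun setT kap0 -> (forall u, 0 <= kap0 u) ->
    (\int[m]_u (kap0 u)%:E <= A0%:E)%E -> 0 <= A0 ->
    {ae m, forall u : borel G, forall p q, mdist p q <= L ->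
      mxmax_norm (k u p - k u q) <= kap0 u} ->
  (\int[m]_g' (sqnorm (raw y phi g' - raw x phi g'))%:E <=
   (4 * N%:R ^+ 2 * (A0 + cs / r) ^+ 2)%:E * \int[m]_h (sqnorm (phi h))%:E)%E.
Proof.
move=> lphi supp near mkap0 kap00 ikap0 A00 modulus; have [mphi iphi] := lphi.
have ml1 := measurable_l1norm mphi.
pose kap (u : borel G) : \bar R :=
  ((kap0 u)%:E + (2 * r)^-1%:E * (decay x u + decay y u))%E.
have r2i : (0 <= (2 * r)^-1%:E :> \bar R)%E by rewrite lee_fin invr_ge0 ltW.
have dxy0 u : (0 <= decay x u + decay y u)%E.
  by apply: adde_ge0; exact: decay_ge0.
have mdxy : measurable_fun setT (fun u => decay x u + decay y u)%E.
  by apply: emeasurable_funD; exact: measurable_decay.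
have mk0 : measurable_fun setT (fun u => (kap0 u)%:E : \bar R).
  exact/measurable_EFinP.
have mkap : measurable_fun setT kap.
  by apply: emeasurable_funD => //; exact: measurable_funeM.
have kap_ge0 u : (0 <= kap u)%E.
  by apply: adde_ge0; [rewrite lee_fin|exact: mule_ge0].
have ikap : (\int[m]_u kap u <= (A0 + cs / r)%:E)%E.
  rewrite ge0_integralD//; last 3 first.
  - by move=> u _; rewrite lee_fin.
  - by move=> u _; exact: mule_ge0.
  - exact: measurable_funeM.
  rewrite EFinD; apply: leeD => //.
  rewrite ge0_integralZl//.
  rewrite ge0_integralD//; last 4 first.
  - by move=> u _; exact: decay_ge0.
  - exact: measurable_decay.
  - by move=> u _; exact: decay_ge0.
  - exact: measurable_decay.
  apply: (@le_trans _ _ ((2 * r)^-1%:E * (cs%:E + cs%:E))%E).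
    by apply: lee_wpmul2l => //; exact: leeD.
  rewrite -EFinD -EFinM lee_fin le_eqVlt; apply/orP; left; apply/eqP.
  by field; rewrite gt_eqF.
apply: (@sqnorm_schur _ _ m N N_gt0 cG uni kap) => //.
- by rewrite ltr_wpDl// divr_gt0.
- by apply: vmeasurableB; exact: raw_operator_measurable.
move: (integrand_integrable_ae cG uni sys kb x lphi)
  (integrand_integrable_ae cG uni sys kb y lphi).
apply: filterS2 => g' hx hy n.
pose dk (u : borel G) : R :=
  mxmax_norm (k u (tau g'^-1%g y) - k u (tau g'^-1%g x)).
have mdk : measurable_fun setT (fun u => (dk u)%:E : \bar R).
  apply/measurable_EFinP; apply: measurable_mxmax_norm => i j.
  rewrite (_ : (fun _ => _) = (fun u => k u (tau g'^-1%g y) i j -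
    k u (tau g'^-1%g x) i j)).
    by apply: complex_measurableB; exact: (kernel_measurable kb).
  by apply/funext => u; rewrite !mxE.
have dk0 u : 0 <= dk u by exact: mxmax_norm_ge0.
have mIx := integrand_measurable cG sys kb x g' n mphi.
have mIy := integrand_measurable cG sys kb y g' n mphi.
have mD : complex_measurable (fun h => integrand tau k y phi g' n h -
    integrand tau k x phi g' n h) by exact: complex_measurableB.
rewrite !mxE -complex_integralB//; try exact: finite_cmod_integrable.
apply: (le_trans (cmod_complex_integral m mD)).
apply: lee_wpmul2l => //.
have mE : measurable_fun setT (fun h => (l1norm (phi h))%:E : \bar R).
  exact/measurable_EFinP.
apply: (@le_trans _ _ (\int[m]_u ((dk u)%:E * (l1norm (phi (g' * u)%g))%:E))%E).
  rewrite -(@integral_translate _ _ m uni (fun u => (dk u)%:E)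
    (fun h => (l1norm (phi h))%:E))//.
  apply: ge0_le_integral => //.
  - by move=> h _; rewrite lee_fin cmod_ge0.
  - by apply/measurable_EFinP; exact: measurable_cmod.
  - by apply: emeasurable_funM => //; exact: (measurable_translate g'^-1%g mdk).
  - move=> h _; rewrite -EFinM lee_fin /integrand /dk.
    have -> : (k (g'^-1 * h)%g (tau g'^-1%g y) *m phi h) n 0 -
        (k (g'^-1 * h)%g (tau g'^-1%g x) *m phi h) n 0 =
        ((k (g'^-1 * h)%g (tau g'^-1%g y) -
          k (g'^-1 * h)%g (tau g'^-1%g x)) *m phi h) n 0.
      by rewrite mulmxBl !mxE.
    exact: cmod_mulmx.
  - by move=> u; rewrite lee_fin l1norm_ge0.
have mlt := measurable_translate g' mE.
apply: ae_ge0_le_integral => //.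
- by move=> u _; rewrite -EFinM lee_fin mulr_ge0// l1norm_ge0.
- exact: emeasurable_funM.
- by move=> u _; apply: mule_ge0 => //; rewrite lee_fin l1norm_ge0.
- exact: emeasurable_funM.
move: modulus; apply: filterS => u hu _.
have [->|nz] := eqVneq (l1norm (phi (g' * u)%g)) 0; first by rewrite !mule0.
apply: lee_wpmul2r; first by rewrite lee_fin l1norm_ge0.
have hsupp := supp _ nz.
have [gg|gg] := ltP (dG g g') (4 * r).
  rewrite /kap -[leLHS]adde0; apply: leeD; last exact: mule_ge0.
  by rewrite lee_fin; apply: hu; exact: near.
have du : 2 * r <= dG 1%g u.
  have := dG_tri g (g' * u)%g g'.
  rewrite (dG_sym (g' * u)%g) dist_mulr; lra.
rewrite /kap -[leLHS]add0e; apply: leeD; first by rewrite lee_fin.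
rewrite -[leLHS]mul1e; have -> : (1 : \bar R)%E = ((2 * r)^-1%:E * (2 * r)%:E)%E.
  by rewrite -EFinM mulVf// gt_eqF.
rewrite -muleA; apply: lee_wpmul2l => //.
apply: (@le_trans _ _ ((2 * r)%:E * (K u x + K u y))%E).
  apply: lee_wpmul2l; first by rewrite lee_fin ltW.
  apply: (@le_trans _ _ ((mxmax_norm (k u (tau g'^-1%g x)))%:E +
      (mxmax_norm (k u (tau g'^-1%g y)))%:E)%E).
    by rewrite -EFinD lee_fin addrC; exact: mxmax_normB.
  by apply: leeD; exact: orbit_sup_ge.
rewrite /decay -ge0_muleDl ?orbit_sup_ge0// muleC.
apply: lee_wpmul2l; first by apply: adde_ge0; exact: orbit_sup_ge0.
by rewrite lee_fin.
Qed.

End Radius.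
End Localization.

(** * Transfer of spectrum between operators of the family *)

Section Transfer.
Context (R : realType) (G : topologicalGroupType) (dG : G -> G -> R).
Context (Z : pmetricType R).
Variables (m : {sigma_finite_measure set (borel G) -> \bar R}).
Variables (tau : G -> Z -> Z) (N : nat) (k : G -> Z -> 'M[R[i]]_N).
Hypothesis N_gt0 : (0 < N)%N.
Hypothesis cG : @second_countable G.
Hypothesis uni : unimodular m.
Hypothesis adG : adapted_metric dG.
Hypothesis sys : dynamical_system tau.
Hypothesis kb : bounded_kernel tau m k.
Local Notation V := 'cV[R[i]]_N.
Local Notation H := (L2 m N).
Local Notation K := (orbit_sup tau k).
Local Notation l2 := (square_integrable m).
Local Notation raw := (raw_operator m tau k).
Local Notation A := (dyn_operator tau (m := m) k).
Local Notation nm := (dnorm (@l2_inner _ (borel G) R m N)).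
Hypothesis normalA : forall x, normal_operator (A x).

Let inP := @l2_inner_real_inner_product _ (borel G) R m N.

Lemma dyn_operator_sub_ae x z (u : H) :
  ((A x u - z *: u : H) : _ -> V) = (fun g => raw x u g - z *: u g) %[ae m].
Proof.
have h1 := L2_sub_ae (A x u) (z *: u).
have h2 := dyn_operator_ae N_gt0 cG uni sys kb x u.
have h3 := L2_scaleE z u.
apply: (filterS3 _ _ h1 h2 h3) => g /= e1 e2 e3 _.
by rewrite (e1 I) (e2 I) (e3 I).
Qed.

Lemma sqr_norm_ae (u : H) (f : borel G -> V) : vmeasurable f ->
  ((u : _ -> V) = f %[ae m]) ->
  ((nm u ^+ 2)%:E = \int[m]_g (sqnorm (f g))%:E)%E.
Proof.
move=> mf uf; rewrite sqr_l2_norm; apply: ae_eq_integral => //.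
- exact: measurable_sqnorm (L2_fun_square_integrable _).1.
- exact: measurable_sqnorm.
- by move: uf; apply: filterS => g /= e _; rewrite (e I).
Qed.

Lemma shifted_measurable x z (f : borel G -> V) : vmeasurable f ->
  vmeasurable (fun g => raw x f g - z *: f g).
Proof.
move=> mf; apply: vmeasurableB; first exact: raw_operator_measurable.
apply: (vmeasurableZ (c := fun=> z)) => //; exact: complex_measurable_cst.
Qed.

Lemma operator_bound : exists2 M : R, 0 < M &
  forall x (u : H), L2_norm (A x u) <= M * L2_norm u.
Proof.
have [B B0 KB] := bounded_kernel_mass kb.
have M0 : 0 < 2 * N%:R * B by rewrite !mulr_gt0// ltr0n.
exists (2 * N%:R * B) => // x u; rewrite !L2_normE.
rewrite -(ler_pXn2r (n := 2))// ?nnegrE ?dnorm_ge0//; last first.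
  by rewrite mulr_ge0 ?dnorm_ge0// ltW.
have mu := (L2_fun_square_integrable u).1.
rewrite -lee_fin (sqr_norm_ae (raw_operator_measurable cG sys kb x mu)
  (dyn_operator_ae N_gt0 cG uni sys kb x u)).
apply: (le_trans (raw_operator_bound N_gt0 cG uni sys kb B0 (KB x) mu)).
rewrite exprMn [leRHS]EFinM (sqr_l2_norm u).
apply: lee_wpmul2r; first by apply: integral_ge0 => g _; rewrite lee_fin sqnorm_ge0.
by rewrite lee_fin le_eqVlt; apply/orP; left; apply/eqP; ring.
Qed.

Lemma spectrum_bound M x z :
  (forall x (u : H), L2_norm (A x u) <= M * L2_norm u) ->
  spectrum (A x) z -> cmod z <= M.
Proof.
move=> AM sz; apply/ler_addgt0Pr => e e0.
have [u u1 ue] := spectrum_approx (normalA x) sz e0.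
have := AM x u; rewrite u1 mulr1 => Au.
have zE : z *: u = A x u - (A x u - z *: u) by rewrite opprB addrC subrK.
have : cmod z = L2_norm (z *: u) by rewrite L2_normE (dnormZ inP) -L2_normE u1 mulr1.
rewrite zE => ->; rewrite !L2_normE in Au ue *.
have := ler_dnormD inP (A x u) (- (A x u - z *: u)); rewrite (dnormN inP); lra.
Qed.

(** Any unit vector is an approximate eigenvector with an error of at most twice
    the norm. This covers sets that are far apart. *)
Lemma crude_transfer M x y z :
  (forall x (u : H), L2_norm (A x u) <= M * L2_norm u) ->
  spectrum (A x) z -> exists2 w, spectrum (A y) w & cmod (w - z) <= 8 * M.
Proof.
move=> AM sz; have zM := spectrum_bound AM sz.
have [u u1 _] := spectrum_approx (normalA x) sz ltr01.
have Au : L2_norm (A y u - z *: u) <= (2 * M) * L2_norm u.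
  have := AM y u; rewrite u1 !mulr1 !L2_normE => Ay.
  have := ler_dnormD inP (A y u) (- (z *: u)).
  rewrite (dnormN inP) (dnormZ inP) -(L2_normE u) u1; lra.
have [|w sw wz] := near_spectrum (normalA y) _ Au; first by rewrite u1.
by exists w => //; rewrite (le_trans wz)//; lra.
Qed.

Variables (cs D : R).
Hypothesis cs_gt0 : 0 < cs.
Hypothesis D_gt0 : 0 < D.
Hypothesis kdecay : forall x, (\int[m]_u decay dG tau k x u <= cs%:E)%E.
Hypothesis doubling : forall r : R, 1 <= r ->
  (0 < m (gball dG r) < +oo /\
   m (gball dG (2 * r)%R) <= D%:E * m (gball dG r))%E.

(** What matters is that it depends on the size [N] of the matrices, the decay
    and the growth only. The three terms stem from [difference_bound], from
    [commutator_bound] and the almost eigenvector, and from the step from squares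
    to norms. *)
Definition transfer_constant : R :=
  8 * N%:R ^+ 2 * (1 + cs) ^+ 2 + 4 * (16 * N%:R ^+ 2 * cs ^+ 2 * D + 4 * D + 1) + 1.

Lemma transfer_constant_gt0 : 0 < transfer_constant.
Proof.
have D0 := ltW D_gt0.
have h1 : 0 <= 8 * N%:R ^+ 2 * (1 + cs) ^+ 2 by rewrite -mulrA -exprMn mulr_ge0// sqr_ge0.
have h2 : 0 <= 16 * N%:R ^+ 2 * cs ^+ 2 * D.
  by rewrite -(mulrA 16) -exprMn mulr_ge0// mulr_ge0// sqr_ge0.
rewrite /transfer_constant; lra.
Qed.

Lemma transfer_constant_bound (r A0 : R) : 0 < r -> 0 <= A0 ->
  2 * (4 * N%:R ^+ 2 * (A0 + cs / r) ^+ 2) +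
  ((4 * (4 * N%:R ^+ 2 * cs ^+ 2 / r ^+ 2 + r^-1 ^+ 2)) * D + r^-1 ^+ 2) * 4 <=
  (transfer_constant * (A0 + r^-1)) ^+ 2.
Proof.
move=> r0 A00; have ri0 : 0 < r^-1 by rewrite invr_gt0.
have D0 := ltW D_gt0; have c0 := ltW cs_gt0.
set q := A0 + r^-1; have q0 : 0 <= q by rewrite addr_ge0// ltW.
pose E1 : R := 8 * N%:R ^+ 2 * (1 + cs) ^+ 2.
pose E2 : R := 16 * N%:R ^+ 2 * cs ^+ 2 * D + 4 * D + 1.
have E10 : 0 <= E1 by rewrite /E1 -mulrA -exprMn mulr_ge0// sqr_ge0.
have E20 : 0 <= E2.
  rewrite addr_ge0// addr_ge0//; last by rewrite mulr_ge0.
  by rewrite -(mulrA 16) -exprMn mulr_ge0// mulr_ge0// sqr_ge0.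
have -> : ((4 * (4 * N%:R ^+ 2 * cs ^+ 2 / r ^+ 2 + r^-1 ^+ 2)) * D + r^-1 ^+ 2) * 4
    = 4 * E2 * r^-1 ^+ 2 by rewrite /E2; field; rewrite gt_eqF.
have h1 : 2 * (4 * N%:R ^+ 2 * (A0 + cs / r) ^+ 2) <= E1 * q ^+ 2.
  have -> : E1 * q ^+ 2 = 8 * N%:R ^+ 2 * ((1 + cs) * q) ^+ 2 by rewrite /E1; ring.
  rewrite mulrA (_ : 2 * (4 * N%:R ^+ 2) = 8 * N%:R ^+ 2); last by ring.
  apply: ler_wpM2l; first by rewrite mulr_ge0 ?sqr_ge0.
  have n1 : 0 <= A0 + cs / r by rewrite addr_ge0// mulr_ge0// ltW.
  apply: lerXn2r; rewrite ?nnegrE// ?mulr_ge0 ?addr_ge0 ?(ltW ri0)//.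
  rewrite /q mulrDl mul1r mulrDr; have := mulr_ge0 c0 A00.
  have := ltW ri0; lra.
have h2 : 4 * E2 * r^-1 ^+ 2 <= 4 * E2 * q ^+ 2.
  apply: ler_wpM2l; first by rewrite mulr_ge0.
  by apply: lerXn2r; rewrite ?nnegrE ?(ltW ri0)// /q lerDr.
have -> : transfer_constant = E1 + 4 * E2 + 1 by rewrite /transfer_constant /E1 /E2; ring.
set E := E1 + 4 * E2; have E0 : 0 <= E by rewrite addr_ge0// mulr_ge0.
have h3 : E * q ^+ 2 <= ((E + 1) * q) ^+ 2.
  rewrite exprMn; apply: ler_wpM2r; first exact: sqr_ge0.
  have := sqr_ge0 E; lra.
have h4 : E1 * q ^+ 2 + 4 * E2 * q ^+ 2 = E * q ^+ 2 by rewrite /E; ring.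
lra.
Qed.

(** The point [y] is allowed to depend on [g], because the averaging that selects
    [g] involves [x] only. The hypothesis [near] says that [y] is close to [x]
    along the part of the orbit that the cut-off at [g] sees. *)
Lemma spectrum_transfer (r L A0 : R) (kap0 : borel G -> R) (Y : set Z) x z :
    1 <= r -> 0 <= A0 ->
    measurable_fun setT kap0 -> (forall u, 0 <= kap0 u) ->
    (\int[m]_u (kap0 u)%:E <= A0%:E)%E ->
    {ae m, forall u : borel G, forall p q, mdist p q <= L ->
      mxmax_norm (k u p - k u q) <= kap0 u} ->
    (forall g : G, exists2 y, Y y & forall g' : G, dG g g' < 4 * r ->
      mdist (tau g'^-1%g y) (tau g'^-1%g x) <= L) ->
    spectrum (A x) z ->
  exists2 y, Y y & exists2 w, spectrum (A y) w &
    cmod (w - z) <= 4 * (transfer_constant * (A0 + r^-1)).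
Proof.
move=> r1 A00 mkap0 kap00 ikap0 modulus near sz.
have r0 : 0 < r by rewrite (lt_le_trans ltr01).
have ri0 : 0 < r^-1 by rewrite invr_gt0.
have [u u1 ue] := spectrum_approx (normalA x) sz ri0.
rewrite !L2_normE in u1 ue.
pose psi : borel G -> V := u.
have lpsi : l2 psi := L2_fun_square_integrable u.
have mpsi : vmeasurable psi := lpsi.1.
have ipsi : (\int[m]_h (sqnorm (psi h))%:E = 1)%E.
  by rewrite -sqr_l2_norm u1 expr1n.
pose rho (h : borel G) : \bar R := (sqnorm (raw x psi h - z *: psi h))%:E.
have mrho : measurable_fun setT rho.
  by apply: measurable_sqnorm; exact: shifted_measurable.
have rho0 h : (0 <= rho h)%E by rewrite lee_fin sqnorm_ge0.
have irho : (\int[m]_h rho h <= (r^-1 ^+ 2)%:E)%E.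
  rewrite -(sqr_norm_ae (shifted_measurable x z mpsi) (dyn_operator_sub_ae x z u)).
  by rewrite lee_fin; apply: lerXn2r; rewrite ?nnegrE ?dnorm_ge0 ?(ltW ri0)// ltW.
pose cm := commutator_mass dG m tau k cs r x psi.
have mcm : measurable_fun setT cm by exact: measurable_commutator_mass.
have cm0 h : (0 <= cm h)%E by exact: commutator_mass_ge0.
have icm : (\int[m]_h cm h <= (4 * N%:R ^+ 2 * cs ^+ 2 / r ^+ 2)%:E)%E.
  have := @integral_commutator_mass _ _ dG _ m tau N k cG uni adG sys kb cs cs_gt0
    kdecay r r0 x psi mpsi.
  by rewrite ipsi mule1.
(* Twice the factor 2 of [sqnormD], for a sum of three terms. *)
pose W (h : borel G) : \bar R := (4%:E * (cm h + rho h))%E.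
have mcr : measurable_fun setT (fun h => cm h + rho h)%E by exact: emeasurable_funD.
have mW : measurable_fun setT W by exact: measurable_funeM.
have cr0 h : (0 <= cm h + rho h)%E by apply: adde_ge0.
have W0 h : (0 <= W h)%E by exact: mule_ge0.
pose a : R := 4 * (4 * N%:R ^+ 2 * cs ^+ 2 / r ^+ 2 + r^-1 ^+ 2).
have a0 : 0 <= a.
  rewrite mulr_ge0// addr_ge0 ?sqr_ge0// divr_ge0 ?sqr_ge0//.
  by apply: mulr_ge0; [apply: mulr_ge0 => //|]; exact: sqr_ge0.
have iW : (\int[m]_h W h <= a%:E * \int[m]_h (sqnorm (psi h))%:E)%E.
  rewrite ipsi mule1 ge0_integralZl// ge0_integralD// /a EFinM.
  by apply: lee_wpmul2l => //; rewrite EFinD; exact: leeD.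
have [mB mBB] := doubling r1.
(* Any number above [a D]; this one is of the order [r^-2] as well. *)
pose a' : R := a * D + r^-1 ^+ 2.
have aa' : a * D < a' by rewrite ltrDl exprn_gt0.
have mw : measurable_fun setT (fun h => (sqnorm (psi h))%:E).
  exact: measurable_sqnorm.
have w0 h : (0 <= (sqnorm (psi h))%:E :> \bar R)%E by rewrite lee_fin sqnorm_ge0.
have [|g hg] :=
  exists_local_mass_lt cG uni adG mw w0 mW W0 mB mBB _ iW a0 aa' (ltW D_gt0).
  by rewrite ipsi lte01 ltry.
have [y Yy ynear] := near g.
exists y => //.
pose phi := localized dG r g psi.
have lphi : l2 phi by exact: localized_square_integrable.
have mphi := lphi.1.
pose S := (\int[m]_h (sqnorm (phi h))%:E)%E.
have S0 : (0 <= S)%E by apply: integral_ge0 => h _; rewrite lee_fin sqnorm_ge0.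
have ind0 (s : R) (p : borel G * borel G) : (0 <= (\1_(nearby dG s) p)%:E :> \bar R)%E.
  by rewrite lee_fin indicE; case: (_ \in _).
have mnear s :
  measurable_fun setT (fun h : borel G => (\1_(nearby dG s) (g, h))%:E : \bar R).
  apply/measurable_EFinP.
  have mi : measurable_fun setT (\1_(nearby dG s) : borel G * borel G -> R).
    by apply: measurable_indic; exact: measurable_nearby.
  exact: (measurableT_comp mi (@pair1_measurable _ _ (borel G) (borel G) g)).
(* The cut-off is at least 1/2 on the ball of radius [r]. *)
have mass_phi : (local_mass dG m r (fun h => (sqnorm (psi h))%:E) g <= 4%:E * S)%E.
  rewrite -ge0_integralZl//; last 2 first.
  - exact: measurable_sqnorm.
  - by move=> h _; rewrite lee_fin sqnorm_ge0.
  apply: ge0_le_integral => //.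
  - by move=> h _; apply: mule_ge0; [exact: ind0|].
  - by apply: emeasurable_funM => //; exact: mnear.
  - by apply: measurable_funeM; exact: measurable_sqnorm.
  move=> h _; rewrite /phi sqnorm_localized -!EFinM lee_fin mulrA.
  apply: ler_wpM2r; first exact: sqnorm_ge0.
  rewrite indicE; have [/set_mem hh|_] := boolP ((g, h) \in nearby dG r); last first.
    by rewrite mulr_ge0// sqr_ge0.
  have : 1 / 2 <= cutoff dG r g h by exact: cutoff_ge_half.
  move=> /= hc; nra.
have Sfin : S \is a fin_num by rewrite ge0_fin_numE//; exact: lphi.2.
have lW : (local_mass dG m (2 * r) W g =
    4%:E * (local_mass dG m (2 * r) cm g + local_mass dG m (2 * r) rho g))%E.
  rewrite /local_mass -ge0_integralD//; last 4 first.
  - by move=> h _; apply: mule_ge0; [exact: ind0|].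
  - by apply: emeasurable_funM => //; exact: mnear.
  - by move=> h _; apply: mule_ge0; [exact: ind0|].
  - by apply: emeasurable_funM => //; exact: mnear.
  rewrite -ge0_integralZl//; last 2 first.
  - by apply: emeasurable_funD; apply: emeasurable_funM => //; exact: mnear.
  - by move=> h _; apply: adde_ge0; apply: mule_ge0 => //; exact: ind0.
  by apply: eq_integral => h _; rewrite /W muleCA ge0_muleDr.
have hS : (local_mass dG m (2 * r) W g < a'%:E * (4%:E * S))%E.
  apply: (lt_le_trans hg); apply: lee_wpmul2l => //.
  by rewrite lee_fin addr_ge0 ?sqr_ge0// mulr_ge0// ltW.
have lW0 : (0 <= local_mass dG m (2 * r) W g)%E by exact: local_mass_ge0.
(* The strict inequality at [g] ensures that the cut-off vector is not 0. *)
have S_gt0 : (0 < S)%E.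
  rewrite lt_neqAle S0 andbT; apply/eqP => S00.
  by move: (le_lt_trans lW0 hS); rewrite -S00 !mule0 ltxx.
pose B := transfer_constant * (A0 + r^-1).
have main : (\int[m]_h (sqnorm (raw y phi h - z *: phi h))%:E <= (B ^+ 2)%:E * S)%E.
  have mnx := shifted_measurable y z mphi.
  pose D1 (h : borel G) : V := raw y phi h - raw x phi h.
  pose chi (h : borel G) : R[i] := ((cutoff dG r g h)%:C)%C.
  pose D2 (h : borel G) : V := raw x phi h - chi h *: raw x psi h.
  pose D3 (h : borel G) : V := chi h *: (raw x psi h - z *: psi h).
  have mD1 : vmeasurable D1 by apply: vmeasurableB; exact: raw_operator_measurable.
  have mchi : complex_measurable chi by exact: complex_cutoff_measurable.
  have mD2 : vmeasurable D2.
    apply: vmeasurableB; first exact: raw_operator_measurable.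
    by apply: vmeasurableZ => //; exact: raw_operator_measurable.
  have mD3 : vmeasurable D3.
    by apply: vmeasurableZ => //; exact: shifted_measurable.
  have split3 h : sqnorm (raw y phi h - z *: phi h) <=
      2 * sqnorm (D1 h) + 4 * (sqnorm (D2 h) + sqnorm (D3 h)).
    have -> : raw y phi h - z *: phi h = D1 h + (D2 h + D3 h).
      rewrite /D1 /D2 /D3 /phi /localized -/(chi h) scalerBr !scalerA.
      by rewrite (mulrC z) addrA subrKA addrA subrK.
    have := sqnormD (D1 h) (D2 h + D3 h); have := sqnormD (D2 h) (D3 h); lra.
  have msq (f : borel G -> V) : vmeasurable f ->
      measurable_fun setT (fun h => (sqnorm (f h))%:E : \bar R).
    by move=> mf; exact: measurable_sqnorm.
  have sq0 (f : borel G -> V) h : (0 <= (sqnorm (f h))%:E :> \bar R)%E.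
    by rewrite lee_fin sqnorm_ge0.
  have i1 : (\int[m]_h (sqnorm (D1 h))%:E <=
      (4 * N%:R ^+ 2 * (A0 + cs / r) ^+ 2)%:E * S)%E.
    apply: (difference_bound N_gt0 cG uni adG sys kb cs_gt0 kdecay r0 lphi _ ynear
      mkap0 kap00 ikap0 A00 modulus).
    move=> h; apply: contraNlt => hfar.
    have c0 : cutoff dG r g h = 0.
      apply/eqP; rewrite eq_le cutoff_ge0 andbT.
      apply: (le_trans (cutoff_le_ball_indic adG r0 g h)).
      by rewrite ball_indicE ltNge hfar.
    by rewrite /phi /localized c0 scale0r /l1norm big1// => j _; rewrite mxE cmod0.
  have i2 : (\int[m]_h (sqnorm (D2 h))%:E <= local_mass dG m (2 * r) cm g)%E.
    exact: (commutator_bound N_gt0 cG uni adG sys kb cs_gt0 kdecay r0 x g lpsi).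
  have i3 : (\int[m]_h (sqnorm (D3 h))%:E <= local_mass dG m (2 * r) rho g)%E.
    apply: ge0_le_integral => //.
    - exact: msq.
    - by apply: emeasurable_funM => //; exact: mnear.
    - move=> h _; rewrite /D3 sqnormZ cmod_real EFinM.
      apply: lee_wpmul2r; first by rewrite lee_fin sqnorm_ge0.
      rewrite lee_fin; apply: (@le_trans _ _ (ball_indic dG r g h ^+ 2)); last first.
        by rewrite sqr_ball_indic.
      rewrite real_normK ?num_real//; apply: lerXn2r.
      + by rewrite nnegrE cutoff_ge0.
      + by rewrite nnegrE ball_indic_ge0.
      + exact: cutoff_le_ball_indic.
  apply: (@le_trans _ _ (\int[m]_h (2%:E * (sqnorm (D1 h))%:E +
      4%:E * ((sqnorm (D2 h))%:E + (sqnorm (D3 h))%:E)))%E).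
    apply: ge0_le_integral => //.
    - by move=> h _; rewrite lee_fin sqnorm_ge0.
    - exact: msq mnx.
    - apply: emeasurable_funD; first exact: measurable_funeM (msq _ mD1).
      apply: measurable_funeM; exact: emeasurable_funD (msq _ mD2) (msq _ mD3).
    - by move=> h _; have := split3 h; rewrite -lee_fin.
  rewrite ge0_integralD//; last 4 first.
  - by move=> h _; apply: mule_ge0.
  - exact: measurable_funeM (msq _ mD1).
  - by move=> h _; apply: mule_ge0 => //; apply: adde_ge0; exact: sq0.
  - apply: measurable_funeM; exact: emeasurable_funD (msq _ mD2) (msq _ mD3).
  rewrite (ge0_integralZl _ _ (msq _ mD1))//.
  rewrite (ge0_integralZl _ _ (emeasurable_funD (msq _ mD2) (msq _ mD3)))//; last first.
    by move=> h _; apply: adde_ge0; exact: sq0.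
  rewrite ge0_integralD//; [|exact: msq mD2|exact: msq mD3].
  apply: (@le_trans _ _ (2%:E * ((4 * N%:R ^+ 2 * (A0 + cs / r) ^+ 2)%:E * S) +
      a'%:E * (4%:E * S))%E).
    apply: leeD; first exact: lee_wpmul2l.
    apply: le_trans (ltW hS); rewrite lW; apply: lee_wpmul2l => //.
    exact: leeD.
  rewrite -(fineK Sfin) -!EFinM -EFinD lee_fin.
  rewrite (mulrA a') (mulrA 2) -mulrDl; apply: ler_wpM2r; first exact: fine_ge0.
  exact: transfer_constant_bound.
pose v : H := L2_class lphi.
have vphi : (v : _ -> V) = phi %[ae m] := L2_classE lphi.
have v2 : ((nm v ^+ 2)%:E = S)%E := sqr_norm_ae mphi vphi.
have v_gt0 : 0 < nm v.
  rewrite lt_neqAle dnorm_ge0 andbT; apply/eqP => v0.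
  by move: S_gt0; rewrite -v2 -v0 expr0n /= ltxx.
have B0 : 0 <= B.
  by rewrite mulr_ge0 ?(ltW transfer_constant_gt0)// addr_ge0// ltW.
apply: (@near_spectrum _ _ _ _ _ (A y) z v B (normalA y)); rewrite !L2_normE//.
rewrite -(ler_pXn2r (n := 2))// ?nnegrE ?dnorm_ge0//; last first.
  by apply: mulr_ge0 => //; exact: dnorm_ge0.
rewrite exprMn -lee_fin [leRHS]EFinM v2.
have rawv : raw y v = raw y phi.
  by apply: raw_operator_ae_eq => //; exact: (L2_fun_square_integrable v).1.
have e : ((A y v - z *: v : H) : _ -> V) = (fun h => raw y phi h - z *: phi h) %[ae m].
  move: (dyn_operator_sub_ae y z v) vphi; apply: filterS2 => h /= e1 e2 _.
  by rewrite (e1 I) rawv (e2 I).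
by rewrite (sqr_norm_ae (shifted_measurable y z mphi) e).
Qed.

End Transfer.

(** * Hausdorff distances of spectra *)

Section ComplexPlane.
Context (R : realType).

Lemma nbhs_cmodP (z : R[i]) (U : set R[i]) : nbhs z U ->
  exists2 e : R, 0 < e & forall w, cmod (z - w) < e -> U w.
Proof.
move=> /(@nbhs_ballP R[i] R[i]^o)[e /= e0 eU].
have eE : e = ((complex.Re e)%:C)%C.
  by case: e e0 {eU} => a b; rewrite ltcE /= => /andP[/eqP -> _].
have re0 : 0 < complex.Re e by rewrite -ltcR -eE.
exists (complex.Re e) => // w zw; apply: eU.
rewrite -(@ball_normE R[i] R[i]^o) /ball_ /= eE.
by rewrite -ltcR in zw; apply: zw.
Qed.

Lemma complex_of_pair_continuous :
  continuous (fun p : R * R => (p.1 +i* p.2)%C : R[i]).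
Proof.
move=> p U /nbhs_cmodP[e e0 eU].
have e20 : 0 < e / 2 by rewrite divr_gt0.
exists (ball p.1 (e / 2), ball p.2 (e / 2)) => /=.
  by split; exact: nbhsx_ballx.
case=> a b /= [pa pb]; apply: eU.
rewrite (le_lt_trans (cmod_le_l1 _))//=.
have pa' : `|p.1 - a| < e / 2 by exact: pa.
have pb' : `|p.2 - b| < e / 2 by exact: pb.
lra.
Qed.

Lemma closure_cmod (S : set R[i]) z (e : R) : closure S z -> 0 < e ->
  exists2 w, S w & cmod (z - w) < e.
Proof. by move=> Sz e0; have [w [Sw zw]] := Sz _ (nbhs_cmod z e0); exists w. Qed.

Lemma bounded_closure_compact (S : set R[i]) (M : R) :
  (forall z, S z -> cmod z <= M) -> compact (closure S).
Proof.
move=> SM.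
pose E := (fun p : R * R => (p.1 +i* p.2)%C : R[i]) @`
  (`[- (M + 1), M + 1]%classic `*` `[- (M + 1), M + 1]%classic).
have cE : compact E.
  apply: continuous_compact.
    by apply: continuous_subspaceT; exact: complex_of_pair_continuous.
  by apply: compact_setX; exact: segment_compact.
apply: (subclosed_compact _ cE); first exact: closed_closure.
move=> z /closure_cmod/(_ ltr01)[w Sw zw].
have zM : cmod z <= M + 1.
  have := SM _ Sw; have := cmodD (z - w) w; rewrite subrK; lra.
exists (complex.Re z, complex.Im z); last by case: (z).
have := normr_Re_le z; have := normr_Im_le z.
by split; rewrite /= in_itv /= -ler_norml; lra.
Qed.

Lemma cdist_sym (z w : R[i]) : cdist z w = cdist w z.
Proof. by rewrite /cdist -cmodN opprB. Qed.

End ComplexPlane.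

Section HausdorffDistance.
Context (R : realType).

Lemma hausdorff_dist_sym (T : Type) (dist : T -> T -> R) (A B : set T) :
  (forall a b, dist a b = dist b a) ->
  hausdorff_dist dist A B = hausdorff_dist dist B A.
Proof.
move=> sym; rewrite /hausdorff_dist maxC; congr maxe; congr ereal_sup;
  apply: eq_imagel => a _; congr ereal_inf; apply: eq_imagel => b _;
  by rewrite sym.
Qed.

Lemma hausdorff_dist_lt (T : Type) (dist : T -> T -> R) (A B : set T) (d : R) a :
  (hausdorff_dist dist A B < d%:E)%E -> A a -> exists2 b, B b & dist a b < d.
Proof.
move=> hd Aa.
have : (ereal_inf [set (dist a b)%:E | b in B] < d%:E)%E.
  apply: le_lt_trans hd; rewrite /hausdorff_dist le_max; apply/orP; left.
  by apply: ereal_sup_ubound; exists a.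
by move=> /ereal_inf_lt[_ [b Bb <-]]; rewrite lte_fin => h; exists b.
Qed.

Lemma hausdorff_dist_ge0 (T : Type) (dist : T -> T -> R) (A B : set T) :
  (forall a b, 0 <= dist a b) -> A !=set0 -> (0 <= hausdorff_dist dist A B)%E.
Proof.
move=> dist_ge0 [a Aa]; rewrite /hausdorff_dist le_max; apply/orP; left.
apply: (@le_trans _ _ (ereal_inf [set (dist a b)%:E | b in B])).
  by apply: le_ereal_inf_tmp => _ [b _ <-]; rewrite lee_fin.
by apply: ereal_sup_ubound; exists a.
Qed.

(** Passing to closures costs nothing, since the bound is not strict. *)
Lemma hausdorff_closure_le (S S' : set R[i]) (b : R) :
    (forall z, S z -> exists2 w, S' w & cmod (w - z) <= b) ->
    (forall z, S' z -> exists2 w, S w & cmod (w - z) <= b) ->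
  (hausdorff_dist (@cdist R) (closure S) (closure S') <= b%:E)%E.
Proof.
have side (S1 S2 : set R[i]) :
    (forall z, S1 z -> exists2 w, S2 w & cmod (w - z) <= b) ->
    (ereal_sup [set ereal_inf [set (cdist z w)%:E | w in closure S2] |
      z in closure S1] <= b%:E)%E.
  move=> h; apply: ge_ereal_sup => _ [z /closure_cmod Sz <-].
  apply/lee_addgt0Pr => e e0.
  have [z' Sz' zz'] := Sz e e0; have [w Sw wz'] := h _ Sz'.
  apply: (@le_trans _ _ (cdist z w)%:E).
    by apply: ereal_inf_lbound; exists w => //; exact: subset_closure.
  rewrite -EFinD lee_fin /cdist.
  have -> : z - w = (z - z') + - (w - z') by rewrite opprB addrA subrK.
  have := cmodD (z - z') (- (w - z')); rewrite cmodN; lra.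
move=> h1 h2; rewrite /hausdorff_dist ge_max side//=.
have := side _ _ h2; congr (ereal_sup _ <= _)%E.
apply: eq_imagel => w _; congr ereal_inf; apply: eq_imagel => z _.
by rewrite cdist_sym.
Qed.

(** A Hausdorff distance [d] yields partners only at distances less than [d'] for
    each [d' > d]; the bound for [d] follows in the limit. *)
Lemma le_sqrt_modulus (h : \bar R) (C d : R) : 0 < C -> 0 <= d ->
  (forall d', d < d' -> (h <= (C * Num.sqrt d')%:E)%E) ->
  (h <= C%:E * d%:E `^ 2^-1)%E.
Proof.
move=> C0 d0 hd; rewrite poweR_EFin powR12_sqrt// -EFinM.
apply/lee_addgt0Pr => e e0.
have s0 : 0 <= Num.sqrt d + e / C by rewrite addr_ge0 ?sqrtr_ge0// divr_ge0 ?ltW.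
have lt : d < (Num.sqrt d + e / C) ^+ 2.
  rewrite -[ltLHS](sqr_sqrtr d0) ltr_pXn2r ?nnegrE ?sqrtr_ge0//.
  by rewrite ltrDl divr_gt0.
apply: (le_trans (hd _ lt)); rewrite -EFinD lee_fin sqrtr_sqr ger0_norm//.
by rewrite mulrDr lerD2l mulrCA divff ?gt_eqF// mulr1.
Qed.

Lemma le_linear_modulus (h : \bar R) (C d : R) : 0 < C ->
  (forall d', d < d' -> (h <= (C * d')%:E)%E) -> (h <= C%:E * d%:E)%E.
Proof.
move=> C0 hd; rewrite -EFinM; apply/lee_addgt0Pr => e e0.
have lt : d < d + e / C by rewrite ltrDl divr_gt0.
apply: (le_trans (hd _ lt)); rewrite -EFinD lee_fin.
by rewrite mulrDr lerD2l mulrCA divff ?gt_eqF// mulr1.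
Qed.

End HausdorffDistance.

Lemma Lfun_infty_ae_bounded d (T : measurableType d) (R : realType)
    (mu : {measure set T -> \bar R}) (f : T -> R) :
  (0 < mu setT)%E -> f \in Lfun mu +oo ->
  exists2 M : R, 0 < M & \forall x \ae mu, f x <= M.
Proof.
move=> mu0; rewrite inE => /andP[_]; rewrite inE /= /finite_norm unlock mu0 => foo.
have [M Mf] := @ess_supr_bounded _ _ _ mu (fun x => `|f x|) foo.
exists (`|M| + 1); first by rewrite ltr_wpDl.
move: Mf; apply: filterS => x /= h; rewrite (le_trans (ler_norm _))//.
by rewrite (le_trans h)// (le_trans (ler_norm M))// lerDl.
Qed.

(** * Continuity of the spectral map *)

Section SpectralMap.
Context (R : realType) (G : topologicalGroupType) (dG : G -> G -> R).
Context (Z : pmetricType R).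
Variables (m : {sigma_finite_measure set (borel G) -> \bar R}).
Variables (tau : G -> Z -> Z) (N : nat) (k : G -> Z -> 'M[R[i]]_N).
Hypothesis N_gt0 : (0 < N)%N.
Hypothesis cG : @second_countable G.
Hypothesis uni : unimodular m.
Hypothesis adG : adapted_metric dG.
Hypothesis growth : strictly_polynomial_growth dG m.
Hypothesis m_neq0 : m setT != 0%E.
Hypothesis sys : dynamical_system tau.
Hypothesis tau_lip : lipschitz_system tau dG.
Hypothesis kb : bounded_kernel tau m k.
Hypothesis kd : linearly_decaying tau dG m k.
Local Notation H := (L2 m N).
Local Notation A := (dyn_operator tau (m := m) k).
Hypothesis normalA : forall x, normal_operator (A x).

Lemma spectra_compact (Y : set Z) : compact (family_spectrum tau m k Y).
Proof.
have [M M0 AM] := operator_bound N_gt0 cG uni sys kb.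
apply: (@bounded_closure_compact _ _ M) => z [y Yy sz].
exact: (spectrum_bound normalA AM sz).
Qed.

(** Both regularity assumptions on the kernel enter through the modulus [kap0] at
    the scale [(4 Ctau r + 1) d], which is how far orbits at distance [d] can
    spread within distance [4 r]. The crude bound [M] serves when [d] is too large
    for a radius [r >= 1] to be useful. *)
Lemma spectral_map_modulus : exists C M Ctau : R,
  [/\ 0 < C, 0 < M, 0 < Ctau &
  (forall X Y, invariant_set tau X -> invariant_set tau Y ->
    (hausdorff_dist (@cdist R) (family_spectrum tau m k X)
      (family_spectrum tau m k Y) <= M%:E)%E) /\
  forall (r d A0 : R) (kap0 : borel G -> R) (X Y : set Z),
    1 <= r -> 0 <= A0 ->
    measurable_fun setT kap0 -> (forall u, 0 <= kap0 u) ->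
    (\int[m]_u (kap0 u)%:E <= A0%:E)%E ->
    {ae m, forall u : borel G, forall p q,
      mdist p q <= (4 * Ctau * r + 1) * d ->
      mxmax_norm (k u p - k u q) <= kap0 u} ->
    invariant_set tau X -> invariant_set tau Y ->
    (hausdorff_dist (@mdist R Z) X Y < d%:E)%E ->
    (hausdorff_dist (@cdist R) (family_spectrum tau m k X)
      (family_spectrum tau m k Y) <= (C * (A0 + r^-1))%:E)%E].
Proof.
have [M M0 AM] := operator_bound N_gt0 cG uni sys kb.
have [cs cs0 kdec] := kd.
have {}kdec x : (\int[m]_u decay dG tau k x u <= cs%:E)%E.
  by apply: le_trans kdec; apply: ereal_sup_ubound; exists x.
have [D D0 doubling] := polynomial_growth_doubling growth.
have [Ctau Ctau0 lip] := tau_lip.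
have [_ [_ tau1 tauM]] := sys.
have [[dG_ge0 _ dG_sym _] [_ dG_inv _ _]] := adG.
pose C := 4 * transfer_constant N cs D.
have C0 : 0 < C.
  by rewrite mulr_gt0// transfer_constant_gt0.
exists C, (8 * M), Ctau; split=> //; first by rewrite mulr_gt0.
(* One inclusion; the roles of [X] and [Y] are symmetric. *)
have half (X Y : set Z) (r d A0 : R) (kap0 : borel G -> R) : 1 <= r -> 0 <= A0 ->
    measurable_fun setT kap0 -> (forall u, 0 <= kap0 u) ->
    (\int[m]_u (kap0 u)%:E <= A0%:E)%E ->
    {ae m, forall u : borel G, forall p q,
      mdist p q <= (4 * Ctau * r + 1) * d ->
      mxmax_norm (k u p - k u q) <= kap0 u} ->
    invariant_set tau X -> invariant_set tau Y ->
    (forall x, X x -> exists2 y, Y y & mdist x y < d) ->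
    forall z, (\bigcup_(x in X) spectrum (A x)) z ->
    exists2 w, (\bigcup_(y in Y) spectrum (A y)) w & cmod (w - z) <= C * (A0 + r^-1).
  move=> r1 A00 mk0 k00 ik0 modulus [_ _ invX] [_ _ invY] XY z [x Xx sz].
  have r0 : 0 < r by rewrite (lt_le_trans ltr01).
  have near g : exists2 y, Y y & forall g', dG g g' < 4 * r ->
      mdist (tau g'^-1%g y) (tau g'^-1%g x) <= (4 * Ctau * r + 1) * d.
    have [y Yy xy] := XY _ (invX g^-1%g x Xx).
    exists (tau g y); first exact: invY.
    move=> g' gg'.
    have -> : tau g'^-1%g (tau g y) = tau (g'^-1 * g)%g y by rewrite tauM.
    have -> : tau g'^-1%g x = tau (g'^-1 * g)%g (tau g^-1%g x).
      by rewrite -tauM mulgK.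
    apply: (le_trans (lip _ _ _)).
    have dgg : dG 1%g (g'^-1 * g)%g < 4 * r.
      by rewrite -(dG_inv g') mulg1 mulVKg dG_sym.
    apply: ler_pM => //.
    - by rewrite addr_ge0// mulr_ge0// ltW.
    - exact: mdist_ge0.
    - rewrite lerD2r -mulrA [leRHS]mulrCA; apply: ler_wpM2l; exact: ltW.
    - by rewrite metric_sym ltW.
  have [y Yy [w sw wz]] := spectrum_transfer N_gt0 cG uni adG sys kb normalA cs0 D0
    kdec doubling r1 A00 mk0 k00 ik0 modulus near sz.
  exists w; first by exists y.
  by rewrite /C -mulrA.
split.
  move=> X Y [[x Xx] _ _] [[y Yy] _ _]; apply: hausdorff_closure_le.
    move=> z [x' Xx' sz]; have [w sw wz] := crude_transfer normalA y AM sz.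
    by exists w => //; exists y.
  move=> z [y' Yy' sz]; have [w sw wz] := crude_transfer normalA x AM sz.
  by exists w => //; exists x.
move=> r d A0 kap0 X Y r1 A00 mk0 k00 ik0 modulus iX iY XY.
apply: hausdorff_closure_le.
  by apply: (half X Y r d A0 kap0) => // x Xx; exact: hausdorff_dist_lt XY Xx.
apply: (half Y X r d A0 kap0) => // y Yy.
apply: hausdorff_dist_lt Yy.
by rewrite hausdorff_dist_sym//; exact: metric_sym.
Qed.

(** With [r = d^(-1/2)], both the modulus, of order [r d], and [1 / r] are of
    order [sqrt d]. *)
Lemma spectral_map_root_hoelder : lipschitz_kernel m k ->
  exists2 C : R, 0 < C &
  forall X Y : set Z, invariant_set tau X -> invariant_set tau Y ->
    (hausdorff_dist (@cdist R) (family_spectrum tau m k X)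
      (family_spectrum tau m k Y) <=
     C%:E * (hausdorff_dist (@mdist R Z) X Y) `^ 2^-1)%E.
Proof.
move=> [ck [ck0 /Lfun1_integrable ick modulus]].
have [C [M [Ctau [C0 M0 Ct0 [triv main]]]]] := spectral_map_modulus.
have mck : measurable_fun setT ck by apply/measurable_EFinP; case/integrableP : ick.
pose I0 := fine (\int[m]_u (ck u)%:E).
have ickE : (\int[m]_u (ck u)%:E = I0%:E)%E.
  by rewrite /I0 fineK//; exact: integrable_fin_num ick.
have I00 : 0 <= I0.
  by rewrite /I0 fine_ge0//; apply: integral_ge0 => u _; rewrite lee_fin.
pose Ca := C * (I0 * (4 * Ctau + 1) + 1) + M.
have cI : 0 <= I0 * (4 * Ctau + 1).
  by rewrite mulr_ge0// addr_ge0// mulr_ge0// ltW.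
have Ca0 : 0 < Ca.
  by rewrite addr_gt0// mulr_gt0// ltr_wpDl.
exists Ca => // X Y iX iY.
set h := hausdorff_dist (@mdist R Z) X Y.
have h0 : (0 <= h)%E.
  by have [X0 _ _] := iX; apply: hausdorff_dist_ge0 => // *; exact: mdist_ge0.
have [hoo|hfin] := eqVneq h +oo%E.
  by rewrite hoo poweRyr ?invr_eq0 ?pnatr_eq0// gt0_muley ?leey.

have hE : h = (fine h)%:E by rewrite fineK// ge0_fin_numE// ltey.
rewrite hE; apply: le_sqrt_modulus => //; first exact: fine_ge0.
move=> d hd; have d0 : 0 < d by rewrite (le_lt_trans _ hd)// fine_ge0.
have s0 : 0 < Num.sqrt d by rewrite sqrtr_gt0.
have [d1|d1] := leP 1 d.
  apply: (le_trans (triv X Y iX iY)); rewrite lee_fin.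
  have s1 : 1 <= Num.sqrt d by rewrite -sqrtr1 ler_sqrt ?(ltW d0).
  apply: (@le_trans _ _ (M * Num.sqrt d)); first by rewrite ler_peMr// ltW.
  apply: ler_wpM2r; first exact: ltW.
  by rewrite /Ca lerDr; apply: mulr_ge0; [exact: ltW|exact: addr_ge0].
pose r := (Num.sqrt d)^-1.
have s1 : Num.sqrt d <= 1 by rewrite -sqrtr1 ler_sqrt ?ltW.
have r1 : 1 <= r by rewrite -invr1 lef_pV2 ?posrE.
pose L := (4 * Ctau * r + 1) * d.
have L0 : 0 <= L.
  rewrite mulr_ge0 ?(ltW d0)// addr_ge0// !mulr_ge0 ?(ltW Ct0)//.
  by rewrite invr_ge0 ltW.
have xi := main r d (I0 * L) (fun u => ck u * L) X Y r1 (mulr_ge0 I00 L0).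
apply: le_trans (xi _ _ _ _ iX iY _) _.
- by apply: measurable_funM.
- by move=> u; rewrite mulr_ge0.
- under eq_integral do rewrite EFinM.
  rewrite ge0_integralZr//.
  + by rewrite ickE.
  + by apply/measurable_EFinP.
  + by move=> u _; rewrite lee_fin.
- have aeF := ae_filter_ringOfSetsType m; apply: filterS modulus => u hu p q pq.
  by rewrite (le_trans (hu p q))// ler_wpM2l.
- by rewrite -/h hE lte_fin.
have dE : d = Num.sqrt d ^+ 2 by rewrite sqr_sqrtr// ltW.
rewrite lee_fin /r invrK.
have LE : L <= (4 * Ctau + 1) * Num.sqrt d.
  rewrite /L /r {2}dE.
  have -> : (4 * Ctau * (Num.sqrt d)^-1 + 1) * Num.sqrt d ^+ 2 =
    4 * Ctau * Num.sqrt d + Num.sqrt d ^+ 2 by field; rewrite gt_eqF.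
  by rewrite (mulrDl (4 * Ctau)) mul1r lerD2l expr2 ler_piMl// ltW.
rewrite /Ca (mulrDl _ M) [leRHS]addrC; apply: ler_wpDl.
  by rewrite mulr_ge0 ?(ltW M0) ?(ltW s0).
rewrite -mulrA; apply: ler_wpM2l; first exact: ltW.
by rewrite (mulrDl (I0 * _)) mul1r lerD2r -mulrA ler_wpM2l.
Qed.

(** With [r] a small multiple of [1 / d], the scale [(4 Ctau r + 1) d] stays below
    the radius on which the kernel is constant, so that [1 / r] is the only
    error. *)
Lemma spectral_map_lipschitz : locally_constant_kernel m k ->
  exists2 C : R, 0 < C &
  forall X Y : set Z, invariant_set tau X -> invariant_set tau Y ->
    (hausdorff_dist (@cdist R) (family_spectrum tau m k X)
      (family_spectrum tau m k Y) <=
     C%:E * hausdorff_dist (@mdist R Z) X Y)%E.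
Proof.
move=> [ck [ck0 ckoo modulus]].
have [C [M [Ctau [C0 M0 Ct0 [triv main]]]]] := spectral_map_modulus.
have mT0 : (0 < m setT)%E by rewrite lt_neqAle eq_sym m_neq0 measure_ge0.
have [ka ka0 ckka] := Lfun_infty_ae_bounded mT0 ckoo.
pose k1 := ka + 1; have k10 : 0 < k1 by rewrite addr_gt0.
pose Lb := k1 * (4 * Ctau + 1).
have Lb0 : 0 < Lb by rewrite mulr_gt0// ltr_wpDl// mulr_ge0// ltW.
pose Cb := (C + M) * Lb.
have Cb0 : 0 < Cb by rewrite mulr_gt0// addr_gt0.
exists Cb => // X Y iX iY.
set h := hausdorff_dist (@mdist R Z) X Y.
have h0 : (0 <= h)%E.
  by have [X0 _ _] := iX; apply: hausdorff_dist_ge0 => // *; exact: mdist_ge0.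
have [hoo|hfin] := eqVneq h +oo%E.
  by rewrite hoo gt0_muley ?leey.
have hE : h = (fine h)%:E by rewrite fineK// ge0_fin_numE// ltey.
rewrite hE; apply: le_linear_modulus => // d hd.
have d0 : 0 < d by rewrite (le_lt_trans _ hd)// fine_ge0.
have [d1|d1] := leP 1 (Lb * d).
  apply: (le_trans (triv X Y iX iY)); rewrite lee_fin /Cb -mulrA mulrDl.
  apply: ler_wpDl; first by rewrite mulr_ge0 ?(ltW C0)// (le_trans ler01).
  by rewrite ler_peMr// ltW.
have Ld0 : 0 < Lb * d by rewrite mulr_gt0.
pose r := (Lb * d)^-1.
have r1 : 1 <= r by rewrite -invr1 lef_pV2 ?posrE// ltW.
have r0 : 0 < r by rewrite invr_gt0.
have xi := main r d 0 (fun=> 0) X Y r1 (lexx _).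
apply: le_trans (xi _ _ _ _ iX iY _) _ => //.
- by rewrite integral0.
- have aeF := ae_filter_ringOfSetsType m; apply: filterS2 modulus ckka => u hu uka p q pq.
  have -> : k u p = k u q.
    apply: hu; have [->|ckn] := eqVneq (ck u) 0; [by left|right].
    have cku : 0 < ck u by rewrite lt_neqAle eq_sym ckn ck0.
    apply: (@le_lt_trans _ _ k1^-1); last first.
      by rewrite ltf_pV2 ?posrE// (le_lt_trans uka)// /k1 ltrDl.
    apply: (le_trans pq); rewrite -(ler_pM2l k10) mulfV ?gt_eqF//.
    have rLd : r * (Lb * d) = 1 by rewrite /r mulVf// gt_eqF.
    rewrite -[leRHS]rLd /Lb.
    have -> : r * (k1 * (4 * Ctau + 1) * d) = k1 * ((4 * Ctau * r + r) * d) by ring.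
    rewrite ler_wpM2l ?(ltW k10)// ler_wpM2r ?(ltW d0)//.
    by rewrite lerD2l.
  by rewrite subrr /mxmax_norm; apply: mxmax_norm_le => // i j; rewrite mxE cmod0.
- by rewrite -/h hE lte_fin.
rewrite lee_fin /r invrK add0r /Cb -mulrA.
by rewrite ler_wpM2r ?(ltW Ld0)// lerDl ltW.
Qed.

End SpectralMap.

Section SigmaFinite.
Context d (T : measurableType d) (R : realType).
Variables (mu : {measure set T -> \bar R}) (sf : sigma_finite setT mu).

(** A copy of the measure that carries its sigma-finiteness, which the
    integration theory takes as part of the structure of the measure. The proof
    is an argument so that the structures below can refer to it. *)
Definition sigma_finite_copy of sigma_finite setT mu : set T -> \bar R := mu.
HB.instance Definition _ := Measure.on (sigma_finite_copy sf).
HB.instance Definition _ := Measure_isSigmaFinite.Build d T R (sigma_finite_copy sf) sf.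

End SigmaFinite.

Lemma sigma_finite_structure d (T : measurableType d) (R : realType)
    (mu : {measure set T -> \bar R}) : sigma_finite setT mu ->
  exists nu : {sigma_finite_measure set T -> \bar R},
    (nu : {measure set T -> \bar R}) = mu.
Proof.
move=> sf; exists (sigma_finite_copy sf : {sigma_finite_measure set T -> \bar R}).
case: mu sf => f [c1 c2] sf; reflexivity.
Qed.

Theorem theorem4p7 (R : realType)
    (G : topologicalGroupType)
    (G_locally_compact : locally_compact [set: G])
    (G_second_countable : @second_countable G)
    (G_hausdorff : hausdorff_space G)
    (dG : G -> G -> R) (dG_adapted : adapted_metric dG)
    (m : {measure set (borel G) -> \bar R}) (m_haar : left_haar m)
    (G_unimodular : unimodular m)
    (G_growth : strictly_polynomial_growth dG m)
    (Z : pmetricType R) (tau : G -> Z -> Z)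
    (tau_system : dynamical_system tau)
    (tau_lipschitz : lipschitz_system tau dG)
    (N : nat) (N_gt0 : (0 < N)%N)
    (k : G -> Z -> 'M[R[i]]_N)
    (k_bounded : bounded_kernel tau m k)
    (k_decay : linearly_decaying tau dG m k)
    (A_normal : forall x : Z, normal_operator (dyn_operator tau (m := m) k x)) :
  [/\ forall Y : set Z, invariant_set tau Y ->
        compact (family_spectrum tau m k Y),
      (lipschitz_kernel m k ->
        exists2 C : R, 0 < C &
        forall X Y : set Z, invariant_set tau X -> invariant_set tau Y ->
        (hausdorff_dist (@cdist R)
            (family_spectrum tau m k X) (family_spectrum tau m k Y)
          <= C%:E * (hausdorff_dist (@mdist R Z) X Y) `^ 2^-1)%E) &
      (locally_constant_kernel m k ->
        exists2 C : R, 0 < C &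
        forall X Y : set Z, invariant_set tau X -> invariant_set tau Y ->
        (hausdorff_dist (@cdist R)
            (family_spectrum tau m k X) (family_spectrum tau m k Y)
          <= C%:E * hausdorff_dist (@mdist R Z) X Y)%E)].
Proof.
have [_ m_neq0 _] := m_haar.
have [nu nuE] := sigma_finite_structure (proper_metric_sigma_finite dG_adapted m_haar).
subst m; split.
- move=> Y _; apply: (spectra_compact N_gt0 G_second_countable G_unimodular
    tau_system k_bounded A_normal).
- exact: (spectral_map_root_hoelder N_gt0 G_second_countable G_unimodular dG_adapted
    G_growth tau_system tau_lipschitz k_bounded k_decay A_normal).
- exact: (spectral_map_lipschitz N_gt0 G_second_countable G_unimodular dG_adapted
    G_growth m_neq0 tau_system tau_lipschitz k_bounded k_decay A_normal).
Qed.
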